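(* Consider a linear program $\min\{\mathbf c^{\intercal}\mathbf x : A\mathbf x=\mathbf b,\ B\mathbf x\le \mathbf d,\ \mathbf x\in\mathbb R^n\}$ whose feasible region $\mathcal P$ is a 0/1 polytope. Then: (i) from any vertex of $\mathcal P$ one can construct a monotone path on the 1-skeleton of $\mathcal P$ to an optimal vertex that uses only steepest edges, and whose length is strongly-polynomial in the input size of the LP; (ii) if moreover $\mathcal P$ is a non-degenerate 0/1 polytope, the Simplex method with a steepest-descent pivot rule reaches an optimal solution in strongly-polynomial time.
   Context: Standing assumptions: $A\in\mathbb Z^{m_A\times n}$, $B\in\mathbb Z^{m_B\times n}$ with $m_B\ge 1$, $\mathbf b,\mathbf d,\mathbf c$ integral, $A$ has full row rank and the stacked matrix $\binom{A}{B}$ has rank $n$. A 0/1 polytope is a polytope all of whose vertices lie in $\{0,1\}^n$. The 1-skeleton of $\mathcal P$ is the graph of its vertices and edges; a path on it is monotone if each vertex on the path has strictly larger objective value than the next one. For a vertex $\bar{\mathbf x}$, the feasible cone at $\bar{\mathbf x}$ is $\{\mathbf z: A\mathbf z=\mathbf 0,\ B_{T}\mathbf z\le \mathbf 0\}$ where $T$ indexes the inequalities of $B\mathbf x\le\mathbf d$ tight at $\bar{\mathbf x}$; its extreme rays are the edge-directions at $\bar{\mathbf x}$. A steepest edge at $\bar{\mathbf x}$ is an edge-direction $\mathbf g$ at $\bar{\mathbf x}$ minimizing $\mathbf c^{\intercal}\mathbf g/\|\mathbf g\|_1$; the steepest-descent pivot rule moves at each step from the current vertex along a steepest (improving) edge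 to the adjacent vertex. *)

(* Defs.v *)
(* The linear program lives over an arbitrary ordered field R, the real numbers
   being the intended instance. *)
From HB Require Import structures.
From mathcomp Require Import all_boot all_order all_algebra.

Set Implicit Arguments.
Unset Strict Implicit.
Unset Printing Implicit Defensive.

Import Order.TTheory GRing.Theory Num.Theory.
Local Open Scope ring_scope.

(** * Linear programs min { c^T x : A x = b, B x <= d } with integral data *)

Record LP (mA mB n : nat) := MkLP {
  lpA : 'M[int]_(mA, n);
  lpB : 'M[int]_(mB, n);
  lpb : 'cV[int]_mA;
  lpd : 'cV[int]_mB;
  lpc : 'cV[int]_n
}.

Definition standing_assumptions (mA mB n : nat) (lp : LP mA mB n) : Prop :=
  [/\ (1 <= mB)%N,
      row_free (map_mx intr (lpA lp) : 'M[rat]_(mA, n)) &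
      \rank (map_mx intr (col_mx (lpA lp) (lpB lp)) : 'M[rat]_(mA + mB, n)) = n].

Definition dotv (R : realFieldType) (n : nat) (u v : 'cV[R]_n) : R :=
  (u^T *m v) 0 0.

Definition norm1 (R : realFieldType) (n : nat) (g : 'cV[R]_n) : R :=
  \sum_(j < n) `|g j 0|.

Definition objective (R : realFieldType) (mA mB n : nat) (lp : LP mA mB n)
    (x : 'cV[R]_n) : R :=
  dotv (map_mx intr (lpc lp)) x.

Definition Amul (R : realFieldType) (mA mB n : nat) (lp : LP mA mB n)
    (x : 'cV[R]_n) : 'cV[R]_mA :=
  map_mx intr (lpA lp) *m x.

Definition Bmul (R : realFieldType) (mA mB n : nat) (lp : LP mA mB n)
    (x : 'cV[R]_n) : 'cV[R]_mB :=
  map_mx intr (lpB lp) *m x.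

(* The coordinate d_i of the right-hand side, as an element of R. *)
Definition rhs (R : realFieldType) (mA mB n : nat) (lp : LP mA mB n)
    (i : 'I_mB) : R :=
  (lpd lp i 0)%:~R.

Definition feasible (R : realFieldType) (mA mB n : nat) (lp : LP mA mB n)
    (x : 'cV[R]_n) : Prop :=
  Amul lp x = map_mx intr (lpb lp) /\ forall i, Bmul lp x i 0 <= rhs R lp i.

Definition optimal (R : realFieldType) (mA mB n : nat) (lp : LP mA mB n)
    (x : 'cV[R]_n) : Prop :=
  feasible lp x /\ forall y : 'cV[R]_n, feasible lp y ->
    objective lp x <= objective lp y.

(** * Faces, vertices, the 1-skeleton *)

(* F is the set of minimizers over P of some linear functional. *)
Definition face (R : realFieldType) (n : nat) (P F : 'cV[R]_n -> Prop) : Prop :=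
  exists w : 'cV[R]_n, forall z,
    F z <-> P z /\ forall y, P y -> dotv w z <= dotv w y.

Definition vertex (R : realFieldType) (mA mB n : nat) (lp : LP mA mB n)
    (x : 'cV[R]_n) : Prop :=
  face (feasible lp) (fun z => z = x).

Definition segment (R : realFieldType) (n : nat) (x y z : 'cV[R]_n) : Prop :=
  exists2 t : R, 0 <= t <= 1 & z = (1 - t) *: x + t *: y.

Definition adjacent (R : realFieldType) (mA mB n : nat) (lp : LP mA mB n)
    (x y : 'cV[R]_n) : Prop :=
  [/\ vertex lp x, vertex lp y, x <> y & face (feasible lp) (segment x y)].

Definition zero_one_polytope (R : realFieldType) (mA mB n : nat)
    (lp : LP mA mB n) : Prop :=
  (exists M : R, forall x : 'cV[R]_n, feasible lp x -> forall j, `|x j 0| <= M)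
  /\ (forall x : 'cV[R]_n, vertex lp x -> forall j, x j 0 = 0 \/ x j 0 = 1).

Definition tight (R : realFieldType) (mA mB n : nat) (lp : LP mA mB n)
    (x : 'cV[R]_n) : {set 'I_mB} :=
  [set i | Bmul lp x i 0 == rhs R lp i].

(* At every vertex the number of tight inequalities is the least possible one,
   namely the codimension n - mA left by the equations. *)
Definition nondegenerate_polytope (R : realFieldType) (mA mB n : nat)
    (lp : LP mA mB n) : Prop :=
  forall x : 'cV[R]_n, vertex lp x -> (mA + #|tight lp x|)%N = n.

(** * Edge-directions, steepest edges, monotone paths *)

Definition feasible_cone (R : realFieldType) (mA mB n : nat) (lp : LP mA mB n)
    (x z : 'cV[R]_n) : Prop :=
  Amul lp z = 0 /\ forall i, i \in tight lp x -> Bmul lp z i 0 <= 0.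

(* g generates an extreme ray of the feasible cone at x. *)
Definition edge_direction (R : realFieldType) (mA mB n : nat)
    (lp : LP mA mB n) (x g : 'cV[R]_n) : Prop :=
  [/\ g <> 0, feasible_cone lp x g &
      forall u v : 'cV[R]_n, feasible_cone lp x u -> feasible_cone lp x v ->
        u + v = g -> exists2 a : R, 0 <= a & u = a *: g].

Definition steepness (R : realFieldType) (mA mB n : nat) (lp : LP mA mB n)
    (g : 'cV[R]_n) : R :=
  objective lp g / norm1 g.

Definition steepest_edge (R : realFieldType) (mA mB n : nat)
    (lp : LP mA mB n) (x g : 'cV[R]_n) : Prop :=
  edge_direction lp x g /\
  forall h, edge_direction lp x h -> steepness lp g <= steepness lp h.

Fixpoint chain (V : Type) (E : V -> V -> Prop) (x : V) (p : seq V) : Prop :=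
  if p is y :: q then E x y /\ chain E y q else True.

Definition steepest_edge_step (R : realFieldType) (mA mB n : nat)
    (lp : LP mA mB n) (x y : 'cV[R]_n) : Prop :=
  [/\ adjacent lp x y, objective lp y < objective lp x &
      steepest_edge lp x (y - x)].

(** * The Simplex method with a steepest-descent pivot rule *)

(* A basis is given by the n - mA inequalities that are required to be tight. *)
Definition basis (mA mB n : nat) (lp : LP mA mB n) (T : {set 'I_mB}) : Prop :=
  (mA + #|T|)%N = n /\
  \rank (map_mx intr (col_mx (lpA lp)
           (rowsub (enum_val : 'I_#|T| -> 'I_mB) (lpB lp)))
         : 'M[rat]_(mA + #|T|, n)) = n.

Definition basic_solution (R : realFieldType) (mA mB n : nat)
    (lp : LP mA mB n) (T : {set 'I_mB}) (x : 'cV[R]_n) : Prop :=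
  Amul lp x = map_mx intr (lpb lp) /\
  forall i, i \in T -> Bmul lp x i 0 = rhs R lp i.

Definition feasible_basis (R : realFieldType) (mA mB n : nat)
    (lp : LP mA mB n) (T : {set 'I_mB}) : Prop :=
  basis lp T /\ exists2 x : 'cV[R]_n, basic_solution lp T x & feasible lp x.

(* The inequality i leaves the basis; moving along the corresponding direction g
   up to the first blocking inequality j (ratio test), j enters the basis. The
   rule leaves ties, in the choice of i and of j, unresolved. *)
Definition steepest_descent_pivot (R : realFieldType) (mA mB n : nat)
    (lp : LP mA mB n) (T T' : {set 'I_mB}) : Prop :=
  exists (x g : 'cV[R]_n) (i j : 'I_mB),
  [/\ basic_solution lp T x /\ feasible lp x,
      [/\ i \in T, Amul lp g = 0, Bmul lp g i 0 < 0 &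
          forall k, k \in T -> k != i -> Bmul lp g k 0 = 0],
      steepest_edge lp x g /\ objective lp g < 0,
      0 < Bmul lp g j 0 /\
        forall k, 0 < Bmul lp g k 0 ->
          (rhs R lp j - Bmul lp x j 0) / Bmul lp g j 0
            <= (rhs R lp k - Bmul lp x k 0) / Bmul lp g k 0 &
      T' = j |: (T :\ i)].

(* The bases visited after T0, up to one where no further pivot exists. *)
Definition complete_run (R : realFieldType) (mA mB n : nat)
    (lp : LP mA mB n) (T0 : {set 'I_mB}) (p : seq {set 'I_mB}) : Prop :=
  chain (steepest_descent_pivot R lp) T0 p /\
  forall T', ~ steepest_descent_pivot R lp (last T0 p) T'.

(** * Strongly polynomial time: a unit-cost arithmetic random access machine

   A machine state has natural-number index registers and a memory of rationals,
   addressed through the index registers. No information flows from the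
   rationals to the indices except by comparisons (in particular there is no
   rounding). The stream [choices] resolves the [Choose] instructions, i.e. the
   nondeterminism of a program. *)

Record state := MkState {
  ireg : nat -> nat;
  rmem : nat -> rat;
  choices : nat -> nat
}.

Inductive iop := IAdd | ISub | IMul.
Inductive rop := RAdd | RSub | RMul | RDiv.

Inductive instr :=
| IConst of nat & nat             (* ireg i := constant *)
| IOp of iop & nat & nat & nat    (* ireg i := ireg j op ireg k *)
| RConst of nat & rat             (* rmem[ireg i] := constant *)
| ROp of rop & nat & nat & nat    (* rmem[ireg i] := rmem[ireg j] op rmem[ireg k] *)
| Choose of nat & nat.            (* ireg i := any number below ireg j *)

Inductive test :=
| ILt of nat & nat                (* ireg i < ireg j *)
| RLe of nat & nat.               (* rmem[ireg i] <= rmem[ireg j] *)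

Inductive program :=
| Skip
| Instr of instr
| Seq of program & program
| If of test & program & program
| While of test & program.

Definition iop_fun (o : iop) : nat -> nat -> nat :=
  match o with IAdd => addn | ISub => subn | IMul => muln end.

Definition rop_fun (o : rop) (x y : rat) : rat :=
  match o with
  | RAdd => x + y | RSub => x - y | RMul => x * y | RDiv => x / y
  end.

Definition upd (T : Type) (f : nat -> T) (i : nat) (v : T) : nat -> T :=
  fun k => if k == i then v else f k.

Definition set_ireg (s : state) (i v : nat) : state :=
  MkState (upd (ireg s) i v) (rmem s) (choices s).

Definition set_rmem (s : state) (i : nat) (v : rat) : state :=
  MkState (ireg s) (upd (rmem s) (ireg s i) v) (choices s).

Definition rload (s : state) (i : nat) : rat := rmem s (ireg s i).

Definition step (a : instr) (s : state) : state :=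
  match a with
  | IConst i v => set_ireg s i v
  | IOp o i j k => set_ireg s i (iop_fun o (ireg s j) (ireg s k))
  | RConst i q => set_rmem s i q
  | ROp o i j k => set_rmem s i (rop_fun o (rload s j) (rload s k))
  | Choose i j =>
      MkState (upd (ireg s) i (choices s 0%N %% ireg s j)%N) (rmem s)
              (fun k => choices s k.+1)
  end.

Definition eval_test (e : test) (s : state) : bool :=
  match e with
  | ILt i j => (ireg s i < ireg s j)%N
  | RLe i j => rload s i <= rload s j
  end.

Definition nat_bits (m : nat) : nat := (trunc_log 2 m).+1.

Definition rat_bits (q : rat) : nat :=
  (nat_bits `|numq q|%N + nat_bits `|denq q|%N)%N.

Definition fits (S : nat) (s : state) : Prop :=
  (forall i, (nat_bits (ireg s i) <= S)%N) /\
  (forall k, (rat_bits (rmem s k) <= S)%N).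

(* [exec S P s t s']: started in s, the program P halts in s' after t unit-cost
   steps, and every number stored on the way has at most S bits. *)
Inductive exec (S : nat) : program -> state -> nat -> state -> Prop :=
| exec_skip s : exec S Skip s 0 s
| exec_instr a s : fits S (step a s) -> exec S (Instr a) s 1 (step a s)
| exec_seq P Q s t s' u s'' :
    exec S P s t s' -> exec S Q s' u s'' -> exec S (Seq P Q) s (t + u) s''
| exec_if e P Q s t s' :
    exec S (if eval_test e s then P else Q) s t s' ->
    exec S (If e P Q) s t.+1 s'
| exec_while_done e P s : ~~ eval_test e s -> exec S (While e P) s 1 s
| exec_while_loop e P s t s' u s'' :
    eval_test e s -> exec S P s t s' -> exec S (While e P) s' u s'' ->
    exec S (While e P) s (t + u).+1 s''.

Definition matrix_entries (m n : nat) (M : 'M[int]_(m, n)) : seq rat :=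
  [seq (M i j)%:~R | i <- enum 'I_m, j <- enum 'I_n].

Definition set_code (m : nat) (T : {set 'I_m}) : seq rat :=
  [seq (i \in T)%:R | i <- enum 'I_m].

Definition input (mA mB n : nat) (lp : LP mA mB n) (T0 : {set 'I_mB}) :
    seq rat :=
  matrix_entries (lpA lp) ++ matrix_entries (lpb lp) ++
  matrix_entries (lpB lp) ++ matrix_entries (lpd lp) ++
  matrix_entries (lpc lp) ++ set_code T0.

Definition input_bits (mA mB n : nat) (lp : LP mA mB n) (T0 : {set 'I_mB}) :
    nat :=
  (\sum_(q <- input lp T0) rat_bits q)%N.

Definition init (mA mB n : nat) (lp : LP mA mB n) (T0 : {set 'I_mB})
    (o : nat -> nat) : state :=
  MkState (nth 0%N [:: n; mA; mB]) (nth 0 (input lp T0)) o.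

(* The machine outputs the number of pivots, the bases visited after T0, and the
   basic solution of the last basis. *)
Definition outputs (mB n : nat) (s : state) (p : seq {set 'I_mB})
    (y : 'cV[rat]_n) : Prop :=
  let out := flatten [seq set_code T | T <- p] ++ [seq y j 0 | j <- enum 'I_n] in
  ireg s 0 = size p /\ forall k, (k < size out)%N -> rmem s k = nth 0 out k.

(* With the choices o, the program P produces the run p and an optimal solution
   of the linear program within t steps, on numbers of at most S bits. *)
Definition computes_run (R : realFieldType) (mA mB n : nat) (lp : LP mA mB n)
    (T0 : {set 'I_mB}) (P : program) (t S : nat) (o : nat -> nat)
    (p : seq {set 'I_mB}) : Prop :=
  exists (u : nat) (s : state) (y : 'cV[rat]_n),
  [/\ exec S P (init lp T0 o) u s, (u <= t)%N, outputs s p y,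
      basic_solution lp (last T0 p) y & optimal lp (map_mx ratr y : 'cV[R]_n)].

(* Main.v *)
(* On the feasible cone at a vertex x of a 0/1 polytope the 1-norm is linear, so the
   feasible direction towards an optimal vertex is at most as steep as the steepest
   edge. A steepest step has norm at least 1, hence it multiplies the gap to the
   optimum by at most 1 - 1/n, and 2n steps divide it by 3. The gaps are the values of
   one linear functional at vectors x_t - x* with 0/±1 entries of fixed signs. Among
   the subset sums of q such vectors two would coincide as soon as 2^q > (q+1)^n,
   which is impossible when the values decrease by factors of 3; so there are O(n^3)
   steps, whatever the size of c.

   In the non-degenerate case a basis is the set T of tight inequalities at a vertex.
   Let E be the matrix of the equations and of the inequalities in T, and N = E^T E.
   The edge-directions are the columns of - adj(N) E^T, and the next vertex is
   determined by their signs. The Faddeev-LeVerrier recursion yields adj(N) and det(N)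
   with integers of polynomial size only, so the machine recomputes everything from T
   at each pivot. *)

(* Besides the number of steps, the bits of every stored number must be bounded, and Gaussian
   elimination would call for a separate study of its intermediate fractions and for a search of
   nonzero pivots. The adjugate of a Gram matrix avoids both: the basis is selected by 0/1 weights
   on a fixed array, and the determinant is a positive square. Since edges join 0/1 points, no ratio
   test has to be computed.

   The linear program lives over [R] while the machine computes in [rat], so the pivot rule is
   restated as a condition on quotients of integers. Ties have to be broken in every possible way:
   each iteration asks for a row and accepts it only if it is a maximizer, so any stream of choices
   yields a legal run, and a given run is obtained by proposing its own rows.

   The program is verified in a small language whose semantics is a total function, and a single
   simulation theorem transports the result to the machine. *)
Require Import Defs.
From Stdlib Require Import Classical FunctionalExtensionality.
From HB Require Import structures.
From mathcomp Require Import all_boot all_order all_algebra.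
From mathcomp Require Import perm ring lra zify.

Set Implicit Arguments.
Unset Strict Implicit.
Unset Printing Implicit Defensive.

Import Order.TTheory GRing.Theory Num.Theory.

(** * A structured language with bounded loops and two-dimensional arrays *)

(* The cell (a, v, w) is the entry of the array a in row v and column w, where v
   and w are index variables. *)
Definition cell := (nat * nat * nat)%type.

(** The only loop is bounded by a variable that well-formed bodies leave alone, so [hsem] is a total
    function and the running time can be read off the syntax. *)
Inductive hprog :=
| HSkip
| HNat of nat & nat
| HInt of iop & nat & nat & nat
| HRat of cell & rat
| HOp of rop & cell & cell & cell
| HChoose of nat & nat
| HSeq of hprog & hprog
| HIfLt of nat & nat & hprog & hprog
| HIfLe of cell & cell & hprog & hprog
| HFor of nat & nat & hprog.

Record hstate := HState {
  hv : nat -> nat;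
  hm : nat -> nat -> nat -> rat;
  hc : nat -> nat
}.

Definition hget (s : hstate) (c : cell) : rat := hm s c.1.1 (hv s c.1.2) (hv s c.2).

Definition hsetv (s : hstate) (v x : nat) : hstate :=
  HState (upd (hv s) v x) (hm s) (hc s).

Definition hsetm (s : hstate) (c : cell) (q : rat) : hstate :=
  HState (hv s)
    (fun a i j => if [&& a == c.1.1, i == hv s c.1.2 & j == hv s c.2] then q
                  else hm s a i j) (hc s).

Fixpoint hsem (p : hprog) (s : hstate) {struct p} : hstate :=
  match p with
  | HSkip => s
  | HNat v c => hsetv s v c
  | HInt o v w u => hsetv s v (iop_fun o (hv s w) (hv s u))
  | HRat c q => hsetm s c q
  | HOp o c d e => hsetm s c (rop_fun o (hget s d) (hget s e))
  | HChoose v w =>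
      HState (upd (hv s) v (hc s 0 %% hv s w)) (hm s) (fun k => hc s k.+1)
  | HSeq p q => hsem q (hsem p s)
  | HIfLt v w p q => if hv s v < hv s w then hsem p s else hsem q s
  | HIfLe c d p q => if (hget s c <= hget s d)%R then hsem p s else hsem q s
  | HFor v w p => iteri (hv s w) (fun k t => hsetv (hsem p t) v k.+1) (hsetv s v 0)
  end.

(* Every index stored by p is at most V and every rational has at most S bits. *)
Fixpoint hok (S V : nat) (p : hprog) (s : hstate) {struct p} : Prop :=
  match p with
  | HSkip => True
  | HNat v c => c <= V
  | HInt o v w u => iop_fun o (hv s w) (hv s u) <= V
  | HRat c q => rat_bits q <= S
  | HOp o c d e => rat_bits (rop_fun o (hget s d) (hget s e)) <= S
  | HChoose v w => 0 < hv s w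
  | HSeq p q => hok S V p s /\ hok S V q (hsem p s)
  | HIfLt v w p q => if hv s v < hv s w then hok S V p s else hok S V q s
  | HIfLe c d p q => if (hget s c <= hget s d)%R then hok S V p s else hok S V q s
  | HFor v w p => forall k, k < hv s w ->
      hok S V p (iteri k (fun k t => hsetv (hsem p t) v k.+1) (hsetv s v 0))
  end.

Fixpoint modv (p : hprog) : seq nat :=
  match p with
  | HNat v _ | HInt _ v _ _ | HChoose v _ => [:: v]
  | HSeq p q | HIfLt _ _ p q | HIfLe _ _ p q => modv p ++ modv q
  | HFor v _ p => v :: modv p
  | _ => [::]
  end.

Fixpoint moda (p : hprog) : seq nat :=
  match p with
  | HRat c _ | HOp _ c _ _ => [:: c.1.1]
  | HSeq p q | HIfLt _ _ p q | HIfLe _ _ p q => moda p ++ moda q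
  | HFor _ _ p => moda p
  | _ => [::]
  end.

Fixpoint choice_free (p : hprog) : bool :=
  match p with
  | HChoose _ _ => false
  | HSeq p q | HIfLt _ _ p q | HIfLe _ _ p q => choice_free p && choice_free q
  | HFor _ _ p => choice_free p
  | _ => true
  end.

Lemma hsem_modv p s v : v \notin modv p -> hv (hsem p s) v = hv s v.
Proof.
elim: p s => //=.
- by move=> w c s; rewrite inE /upd => /negPf ->.
- by move=> o w u1 u2 s; rewrite inE /upd => /negPf ->.
- by move=> w u s; rewrite inE /upd => /negPf ->.
- by move=> p IHp q IHq s; rewrite mem_cat negb_or => /andP[vp vq]; rewrite IHq ?IHp.
- move=> w u p IHp q IHq s; rewrite mem_cat negb_or => /andP[vp vq].
  by case: ifP => _; rewrite ?IHq ?IHp.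
- move=> w u p IHp q IHq s; rewrite mem_cat negb_or => /andP[vp vq].
  by case: ifP => _; rewrite ?IHq ?IHp.
move=> w u p IHp s; rewrite inE negb_or => /andP[/negPf vw vp].
by elim: (hv s u) => [|k IHk] /=; rewrite /upd vw // IHp.
Qed.

Lemma hsem_moda p s a : a \notin moda p -> hm (hsem p s) a = hm s a.
Proof.
elim: p s => //=.
- move=> c q s; rewrite inE => /negPf ac.
  by apply: functional_extensionality => i; apply: functional_extensionality => j; rewrite ac.
- move=> o c d e s; rewrite inE => /negPf ac.
  by apply: functional_extensionality => i; apply: functional_extensionality => j; rewrite ac.
- by move=> p IHp q IHq s; rewrite mem_cat negb_or => /andP[vp vq]; rewrite IHq ?IHp.
- move=> w u p IHp q IHq s; rewrite mem_cat negb_or => /andP[vp vq].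
  by case: ifP => _; rewrite ?IHq ?IHp.
- move=> w u p IHp q IHq s; rewrite mem_cat negb_or => /andP[vp vq].
  by case: ifP => _; rewrite ?IHq ?IHp.
move=> w u p IHp s vp.
by elim: (hv s u) => [|k IHk] //=; rewrite IHp.
Qed.

Lemma hsem_choice p s : choice_free p -> hc (hsem p s) = hc s.
Proof.
elim: p s => //=.
- by move=> p IHp q IHq s /andP[vp vq]; rewrite IHq ?IHp.
- by move=> w u p IHp q IHq s /andP[vp vq]; case: ifP => _; rewrite ?IHq ?IHp.
- by move=> w u p IHp q IHq s /andP[vp vq]; case: ifP => _; rewrite ?IHq ?IHp.
move=> w u p IHp s vp.
by elim: (hv s u) => [|k IHk] //=; rewrite IHp.
Qed.

(** * Compilation *)

(** Any bounds above the indices in use would do. Registers from [num_vars] on are reserved to the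
    compiler. *)
Definition num_vars := 40.
Definition num_arrays := 40.

Definition cell_wf (c : cell) :=
  [&& c.1.1 < num_arrays, c.1.2 < num_vars & c.2 < num_vars].

(** A loop body must change neither its counter nor its bound: the compiled [While] reads both again
    at every turn. *)
Fixpoint hwf (p : hprog) : bool :=
  match p with
  | HSkip => true
  | HNat v _ => v < num_vars
  | HInt _ v w u => [&& v < num_vars, w < num_vars & u < num_vars]
  | HRat c _ => cell_wf c
  | HOp _ c d e => [&& cell_wf c, cell_wf d & cell_wf e]
  | HChoose v w => (v < num_vars) && (w < num_vars)
  | HSeq p q => hwf p && hwf q
  | HIfLt v w p q => [&& v < num_vars, w < num_vars, hwf p & hwf q]
  | HIfLe c d p q => [&& cell_wf c, cell_wf d, hwf p & hwf q]
  | HFor v w p => [&& v < num_vars, w < num_vars, v != w, v \notin modv p,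
                      w \notin modv p & hwf p]
  end.

(** Three address registers suffice for the operands of one operation; [rT] holds a constant, [rW]
    the row length and [rK] the number of arrays. *)
Definition tmp (k : nat) := num_vars + k.
Definition rT := num_vars + 3.
Definition rW := num_vars + 4.
Definition rK := num_vars + 5.

Fixpoint code (l : seq instr) : program :=
  if l is a :: l' then Seq (Instr a) (code l') else Skip.

Definition caddr (t : nat) (c : cell) : seq instr :=
  [:: IOp IMul t c.1.2 rK; IConst rT c.1.1; IOp IAdd t t rT; IOp IMul t t rW;
      IOp IAdd t t c.2].

Fixpoint compile (p : hprog) : program :=
  match p with
  | HSkip => Skip
  | HNat v c => Instr (IConst v c)
  | HInt o v w u => Instr (IOp o v w u)
  | HRat c q => Seq (code (caddr (tmp 0) c)) (Instr (RConst (tmp 0) q))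
  | HOp o c d e =>
      Seq (code (caddr (tmp 0) c)) (Seq (code (caddr (tmp 1) d))
        (Seq (code (caddr (tmp 2) e)) (Instr (ROp o (tmp 0) (tmp 1) (tmp 2)))))
  | HChoose v w => Instr (Choose v w)
  | HSeq p q => Seq (compile p) (compile q)
  | HIfLt v w p q => If (ILt v w) (compile p) (compile q)
  | HIfLe c d p q =>
      Seq (code (caddr (tmp 0) c)) (Seq (code (caddr (tmp 1) d))
        (If (RLe (tmp 0) (tmp 1)) (compile p) (compile q)))
  | HFor v w p =>
      Seq (Instr (IConst v 0))
        (While (ILt v w)
          (Seq (compile p) (code [:: IConst rT 1; IOp IAdd v v rT])))
  end.

(** The constants count compiled instructions: five per cell address, three per turn of a loop
    (test, constant, increment), and two for the first assignment and the failing test. [V] bounds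
    every loop length. *)
Fixpoint htime (V : nat) (p : hprog) : nat :=
  match p with
  | HSkip => 0
  | HNat _ _ | HInt _ _ _ _ | HChoose _ _ => 1
  | HRat _ _ => 6
  | HOp _ _ _ _ => 16
  | HSeq p q => htime V p + htime V q
  | HIfLt _ _ p q => (htime V p + htime V q).+1
  | HIfLe _ _ p q => (htime V p + htime V q) + 11
  | HFor _ _ p => V * (htime V p + 3) + 2
  end.

(** The program is fixed, so the exponent may depend on it: a loop adds one to the degree, and in
    compositions the degrees are simply added. *)
Lemma htime_poly p : exists C k, forall V, htime V p <= C * V.+1 ^ k.
Proof.
have comb p1 p2 : (exists C k, forall V, htime V p1 <= C * V.+1 ^ k) ->
    (exists C k, forall V, htime V p2 <= C * V.+1 ^ k) ->
    exists C k, forall V, htime V p1 + htime V p2 + 11 <= C * V.+1 ^ k.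
  move=> [C1 [k1 h1]] [C2 [k2 h2]]; exists (C1 + C2 + 11), (k1 + k2) => V.
  rewrite !mulnDl; apply: leq_add; first apply: leq_add.
  - by apply: leq_trans (h1 V) _; rewrite leq_mul2l leq_pexp2l ?leq_addr ?orbT.
  - by apply: leq_trans (h2 V) _; rewrite leq_mul2l leq_pexp2l ?leq_addl ?orbT.
  - by rewrite leq_pmulr // expn_gt0.
elim: p => [|v c|o v w u|c q|o c d e|v w|p IHp q IHq|v w p IHp q IHq|c d p IHp q IHq|v w p [C [k h]]] /=;
  try by (exists 16, 0 => V; rewrite expn0).
- by have [C [k h]] := comb _ _ IHp IHq; exists C, k => V; apply: leq_trans (h V); lia.
- by have [C [k h]] := comb _ _ IHp IHq; exists C, k => V; apply: leq_trans (h V); lia.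
- by have [C [k h]] := comb _ _ IHp IHq; exists C, k => V; apply: leq_trans (h V); lia.
exists (C + 5), k.+1 => V; rewrite expnS.
have : 0 < V.+1 ^ k by rewrite expn_gt0.
have := h V; move: (htime V p) (V.+1 ^ k) => x y; nia.
Qed.

(** * Simulation of the structured language by the machine *)

Section Simulation.
Variables S V : nat.

(* Row 0 of the array 0 occupies the addresses 0, ..., V: it holds the input at the
   start and receives the output at the end. *)
Definition addr a i j := (i * num_arrays + a) * V.+1 + j.

Hypothesis S_large : nat_bits (addr num_arrays V V) <= S.

(** Rows are not bounded, since the arrays are interleaved row by row; only the column has to stay
    within the row length. *)
Definition sim (h : hstate) (s : state) : Prop :=
  [/\ forall v, v < num_vars -> ireg s v = hv h v /\ hv h v <= V,
      ireg s rW = V.+1 /\ ireg s rK = num_arrays,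
      forall a i j, a < num_arrays -> j <= V -> rmem s (addr a i j) = hm h a i j,
      choices s = hc h & fits S s].

Lemma nat_bits_le x y : x <= y -> nat_bits x <= nat_bits y.
Proof. by move=> xy; rewrite /nat_bits ltnS leq_trunc_log. Qed.

Lemma small_bits x : x <= addr num_arrays V V -> nat_bits x <= S.
Proof. by move=> h; apply: leq_trans S_large; apply: nat_bits_le. Qed.

Lemma fits_ireg s i x : fits S s -> nat_bits x <= S -> fits S (set_ireg s i x).
Proof. by move=> [fi fr] xS; split=> // k /=; rewrite /upd; case: eqP. Qed.

Lemma fits_rmem s i q : fits S s -> rat_bits q <= S -> fits S (set_rmem s i q).
Proof. by move=> [fi fr] xS; split=> // k /=; rewrite /upd; case: eqP. Qed.

(** [addr] is a numeral in mixed radix whose leading digit, the row, is unbounded; remainders and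
    quotients recover the three digits. *)
Lemma addr_inj a i j a' i' j' : a < num_arrays -> a' < num_arrays -> j <= V -> j' <= V ->
  (addr a i j == addr a' i' j') = [&& a == a', i == i' & j == j'].
Proof.
move=> aK aK' jV jV'; apply/eqP/and3P => [|[/eqP-> /eqP-> /eqP->] //].
rewrite /addr => e.
have ej : j = j' by have := congr1 (fun x => x %% V.+1) e; rewrite !modnMDl !modn_small.
have {}e : i * num_arrays + a = i' * num_arrays + a'.
  have := congr1 (fun x => x %/ V.+1) e.
  by rewrite !divnMDl // !(divn_small (_ : _ < V.+1)) // !addn0.
have ea : a = a'.
  by have := congr1 (fun x => x %% num_arrays) e; rewrite !modnMDl !modn_small.
have ei : i = i'.
  have := congr1 (fun x => x %/ num_arrays) e.
  by rewrite !divnMDl // !divn_small // !addn0.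
by rewrite ea ei ej.
Qed.

Lemma exec_code a l s t s' : fits S (step a s) -> exec S (code l) (step a s) t s' ->
  exec S (code (a :: l)) s t.+1 s'.
Proof. by move=> f e; rewrite -add1n; apply: exec_seq e; apply: exec_instr. Qed.

Lemma sim_ireg h s r x : sim h s -> num_vars <= r -> r != rW -> r != rK ->
  nat_bits x <= S -> sim h (set_ireg s r x).
Proof.
move=> [sv [sW sK] sm sc sf] rv rnW rnK xS; split=> //; last exact: fits_ireg.
  move=> v vn; rewrite /= /upd ifN; first exact: sv.
  by rewrite neq_ltn (leq_trans vn rv).
by rewrite /= /upd ![_ == r]eq_sym (negPf rnW) (negPf rnK).
Qed.

Lemma sim_setv h s v x : sim h s -> v < num_vars -> x <= V ->
  sim (hsetv h v x) (set_ireg s v x).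
Proof.
move=> [sv [sW sK] sm sc sf] vn xV; split=> //.
- by move=> w wn; rewrite /= /upd; case: eqP => // _; apply: sv.
- by rewrite /= /upd !ifN //; apply/eqP => e; move: vn; rewrite -e.
- apply: fits_ireg => //; apply: small_bits; rewrite /addr; lia.
Qed.

Definition cell_addr h (c : cell) := addr c.1.1 (hv h c.1.2) (hv h c.2).

(** The other address registers are kept, because an operation computes all its addresses before it
    uses them. *)
Lemma caddr_exec h s k c : sim h s -> cell_wf c -> k < 3 ->
  exists s', [/\ exec S (code (caddr (tmp k) c)) s 5 s', sim h s',
    ireg s' (tmp k) = cell_addr h c,
    forall l, l < 3 -> l != k -> ireg s' (tmp l) = ireg s (tmp l) & rmem s' = rmem s].
Proof.
move=> sh /and3P[c1 c2 c3] k3; have [sv [sW sK] _ _ _] := sh.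
have [r1 r1V] := sv _ c2; have [r2 r2V] := sv _ c3.
have tT : (rT == tmp k) = false by rewrite eqn_add2l; case: (k) k3 => [|[|[]]].
have tW : (rW == tmp k) = false by rewrite eqn_add2l; case: (k) k3 => [|[|[]]].
have tK : (rK == tmp k) = false by rewrite eqn_add2l; case: (k) k3 => [|[|[]]].
have tv v : v < num_vars -> (v == tmp k) = false.
  by move=> vn; apply/eqP => e; move: vn; rewrite e /tmp; lia.
have vT v : v < num_vars -> (v == rT) = false.
  by move=> vn; apply/eqP => e; move: vn; rewrite e /rT; lia.
have tv' : num_vars <= tmp k by rewrite leq_addr.
have simT g u x : sim g u -> x <= addr num_arrays V V -> sim g (set_ireg u (tmp k) x).
  by move=> gu xA; apply: sim_ireg => //; rewrite ?[tmp k == _]eq_sym ?tW ?tK //; apply: small_bits.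
set i := hv h c.1.2 in r1 r1V *; set j := hv h c.2 in r2 r2V *.
have b1 : i * num_arrays <= addr num_arrays V V by rewrite /addr; nia.
have b2 : c.1.1 <= addr num_arrays V V by rewrite /addr; nia.
have b3 : i * num_arrays + c.1.1 <= addr num_arrays V V by rewrite /addr; nia.
have b4 : (i * num_arrays + c.1.1) * V.+1 <= addr num_arrays V V by rewrite /addr; nia.
have b5 : addr c.1.1 i j <= addr num_arrays V V by rewrite /addr; nia.
pose s1 := set_ireg s (tmp k) (i * num_arrays).
pose s2 := set_ireg s1 rT c.1.1.
pose s3 := set_ireg s2 (tmp k) (i * num_arrays + c.1.1).
pose s4 := set_ireg s3 (tmp k) ((i * num_arrays + c.1.1) * V.+1).
pose s5 := set_ireg s4 (tmp k) (addr c.1.1 i j).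
have sim1 : sim h s1 by apply: simT.
have sim2 : sim h s2 by apply: sim_ireg => //; apply: small_bits.
have sim3 : sim h s3 by apply: simT.
have sim4 : sim h s4 by apply: simT.
have sim5 : sim h s5 by apply: simT.
have e1 : step (IOp IMul (tmp k) c.1.2 rK) s = s1 by rewrite /= r1 sK.
have e3 : step (IOp IAdd (tmp k) (tmp k) rT) s2 = s3.
  by rewrite /= /upd /= eqxx [tmp k == rT]eq_sym tT.
have e4 : step (IOp IMul (tmp k) (tmp k) rW) s3 = s4.
  by rewrite /= /upd /= eqxx tW sW.
have e5 : step (IOp IAdd (tmp k) (tmp k) c.2) s4 = s5.
  by rewrite /= /upd /= eqxx tv // vT // r2.
exists s5; split=> //.
- have fitsP g u : sim g u -> fits S u by case.
  apply: exec_code; rewrite e1; first exact: fitsP sim1.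
  apply: exec_code; first exact: fitsP sim2.
  apply: exec_code; rewrite -/s2 e3; first exact: fitsP sim3.
  apply: exec_code; rewrite e4; first exact: fitsP sim4.
  apply: exec_code; rewrite e5; first exact: fitsP sim5.
  exact: exec_skip.
- by rewrite /= /upd eqxx.
move=> l l3 lk; rewrite /= /upd.
have -> : (tmp l == tmp k) = false by rewrite eqn_add2l (negPf lk).
by have -> : (tmp l == rT) = false by rewrite eqn_add2l; case: (l) l3 => [|[|[]]].
Qed.

Lemma sim_get h s k c : sim h s -> cell_wf c -> ireg s (tmp k) = cell_addr h c ->
  rload s (tmp k) = hget h c.
Proof.
move=> [sv _ sm _ _] /and3P[c1 c2 c3] e.
by rewrite /rload e sm //; case: (sv _ c3).
Qed.

Lemma sim_setm h s k c q : sim h s -> cell_wf c -> ireg s (tmp k) = cell_addr h c ->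
  rat_bits q <= S -> sim (hsetm h c q) (set_rmem s (tmp k) q).
Proof.
move=> [sv sWK sm sc sf] /and3P[c1 c2 c3] e qS; split=> //; last exact: fits_rmem.
move=> a i j aK jV; rewrite /= /upd e /cell_addr addr_inj //; last by case: (sv _ c3).
by case: ifP => // _; apply: sm.
Qed.

Lemma exec_compile p h s : hwf p -> sim h s -> hok S V p h ->
  exists u s', [/\ exec S (compile p) s u s', u <= htime V p & sim (hsem p h) s'].
Proof.
elim: p h s => [|v c|o v w u|c q|o c d e|v w|p IHp q IHq|v w p IHp q IHq
  |c d p IHp q IHq|v w p IHp] h s /=.
- by move=> _ sh _; exists 0, s; split=> //; apply: exec_skip.
- move=> vn sh cV; have sh' := sim_setv sh vn cV.
  by exists 1, (set_ireg s v c); split=> //; apply: exec_instr; case: sh'.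
- move=> /and3P[vn wn un] sh cV; have sh' := sim_setv sh vn cV.
  have [sv _ _ _ _] := sh; have [ew _] := sv _ wn; have [eu _] := sv _ un.
  exists 1, (step (IOp o v w u) s) => /=; rewrite ew eu; split=> //.
  by rewrite -ew -eu; apply: (@exec_instr S (IOp o v w u)) => /=; rewrite ew eu; case: sh'.
- move=> cw sh qS; have [s1 [ex1 sh1 e1 _ _]] := caddr_exec sh cw (isT : 0 < 3).
  have sh2 := sim_setm sh1 cw e1 qS.
  exists (5 + 1), (set_rmem s1 (tmp 0) q); split=> //.
  apply: exec_seq ex1 _; apply: (@exec_instr S (RConst (tmp 0) q)).
  by case: sh2.
- move=> /and3P[cw dw ew] sh qS.
  have [s1 [ex1 sh1 e1 _ _]] := caddr_exec sh cw (isT : 0 < 3).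
  have [s2 [ex2 sh2 e2 f2 _]] := caddr_exec sh1 dw (isT : 1 < 3).
  have [s3 [ex3 sh3 e3 f3 _]] := caddr_exec sh2 ew (isT : 2 < 3).
  have a1 : ireg s3 (tmp 0) = cell_addr h c by rewrite f3 // f2.
  have a2 : ireg s3 (tmp 1) = cell_addr h d by rewrite f3.
  have sh4 := sim_setm sh3 cw a1 qS.
  have st : step (ROp o (tmp 0) (tmp 1) (tmp 2)) s3 =
      set_rmem s3 (tmp 0) (rop_fun o (hget h d) (hget h e)).
    by rewrite /= (sim_get sh3 dw a2) (sim_get sh3 ew e3).
  exists (5 + (5 + (5 + 1))), (step (ROp o (tmp 0) (tmp 1) (tmp 2)) s3); split=> //.
    apply: exec_seq ex1 _; apply: exec_seq ex2 _; apply: exec_seq ex3 _.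
    by apply: exec_instr; rewrite st; case: sh4.
  by rewrite st.
- move=> /andP[vn wn] sh w0; have [sv [sW sK] sm sc sf] := sh; have [ew wV] := sv _ wn.
  have bV : hc h 0 %% hv h w <= V.
    by apply: leq_trans wV; apply: ltnW; rewrite ltn_mod.
  have [sv' sWK' _ _ sf'] := sim_setv sh vn bV.
  have st : step (Choose v w) s =
     MkState (upd (ireg s) v (hc h 0 %% hv h w)) (rmem s) (fun k => choices s k.+1).
    by rewrite /= sc ew.
  exists 1, (step (Choose v w) s); split=> //.
    by apply: exec_instr; rewrite st; have [f1 f2] := sf'; split; [exact: f1 | exact: f2].
  by rewrite st; split=> //=; rewrite sc.
- move=> /andP[wp wq] sh [okp okq].
  have [u1 [s1 [ex1 t1 sh1]]] := IHp _ _ wp sh okp.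
  have [u2 [s2 [ex2 t2 sh2]]] := IHq _ _ wq sh1 okq.
  by exists (u1 + u2), s2; split=> //; [apply: exec_seq ex1 ex2 | apply: leq_add].
- move=> /and4P[vn wn wp wq] sh ok; have [sv _ _ _ _] := sh.
  have te : eval_test (ILt v w) s = (hv h v < hv h w).
    by rewrite /=; case: (sv _ vn) => -> _; case: (sv _ wn) => -> _.
  move: ok; case: ifP => vw ok.
    have [u1 [s1 [ex1 t1 sh1]]] := IHp _ _ wp sh ok.
    exists u1.+1, s1; split=> //; first by apply: exec_if; rewrite te vw.
    by rewrite ltnS (leq_trans t1) // leq_addr.
  have [u1 [s1 [ex1 t1 sh1]]] := IHq _ _ wq sh ok.
  exists u1.+1, s1; split=> //; first by apply: exec_if; rewrite te vw.
  by rewrite ltnS (leq_trans t1) // leq_addl.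
- move=> /and4P[cw dw wp wq] sh ok.
  have [s1 [ex1 sh1 e1 _ _]] := caddr_exec sh cw (isT : 0 < 3).
  have [s2 [ex2 sh2 e2 f2 _]] := caddr_exec sh1 dw (isT : 1 < 3).
  have a1 : ireg s2 (tmp 0) = cell_addr h c by rewrite f2.
  have te : eval_test (RLe (tmp 0) (tmp 1)) s2 = (hget h c <= hget h d)%R.
    by rewrite /= (sim_get sh2 cw a1) (sim_get sh2 dw e2).
  move: ok; case: ifP => vw ok.
    have [u3 [s3 [ex3 t3 sh3]]] := IHp _ _ wp sh2 ok.
    exists (5 + (5 + u3.+1)), s3; split=> //; last by lia.
    by apply: exec_seq ex1 _; apply: exec_seq ex2 _; apply: exec_if; rewrite te vw.
  have [u3 [s3 [ex3 t3 sh3]]] := IHq _ _ wq sh2 ok.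
  exists (5 + (5 + u3.+1)), s3; split=> //; last by lia.
  by apply: exec_seq ex1 _; apply: exec_seq ex2 _; apply: exec_if; rewrite te vw.
move=> /and5P[vn wn vw vp /andP[wp pw]] sh ok.
set st := fun k => iteri k (fun k t => hsetv (hsem p t) v k.+1) (hsetv h v 0).
have stv k : hv (st k) v = k by case: k => [|k]; rewrite /st /= /upd eqxx.
have stw k : hv (st k) w = hv h w.
  elim: k => [|k IHk]; rewrite /st /= /upd eq_sym (negPf vw) //.
  by rewrite hsem_modv.
have [_ wV] : ireg s w = hv h w /\ hv h w <= V by case: sh => sv _ _ _ _; apply: sv.
(* Induction on the number [d] of turns left, from the state reached after [k] turns of [iteri]. *)
have loop d k s0 : k + d = hv h w -> sim (st k) s0 -> exists u s',
    [/\ exec S (While (ILt v w) (Seq (compile p) (code [:: IConst rT 1; IOp IAdd v v rT])))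
         s0 u s', u <= d * (htime V p + 3) + 1 & sim (st (hv h w)) s'].
  elim: d k s0 => [|d IHd] k s0 kd sh0.
    exists 1, s0; rewrite addn0 in kd; split=> //; last by rewrite -kd.
    apply: exec_while_done; have [sv _ _ _ _] := sh0.
    by rewrite /=; case: (sv _ vn) => -> _; case: (sv _ wn) => -> _; rewrite stv stw kd ltnn.
  have kw : k < hv h w by lia.
  have [u1 [s1 [ex1 t1 sh1]]] := IHp _ _ pw sh0 (ok k kw).
  have sh2 : sim (hsem p (st k)) (set_ireg s1 rT 1).
    by apply: sim_ireg => //; apply: small_bits; rewrite /addr; nia.
  have hvk : hv (hsem p (st k)) v = k by rewrite hsem_modv // stv.
  have kV : k.+1 <= V by lia.
  have sh3 := sim_setv sh2 vn kV.
  have st3 : step (IOp IAdd v v rT) (set_ireg s1 rT 1) = set_ireg (set_ireg s1 rT 1) v k.+1.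
    rewrite /= /upd eqxx ifN; last by apply/eqP => e; move: vn; rewrite e.
    by have [sv _ _ _ _] := sh1; case: (sv _ vn) => -> _; rewrite hvk addn1.
  have [|u [s' [ex t sh']]] := IHd k.+1 _ _ sh3; first by rewrite addSnnS.
  exists (u1 + 2 + u).+1, s'; split=> //; last by rewrite mulSn; lia.
  apply: exec_while_loop ex.
    have [sv _ _ _ _] := sh0.
    by rewrite /=; case: (sv _ vn) => -> _; case: (sv _ wn) => -> _; rewrite stv stw.
  apply: exec_seq ex1 _; apply: exec_code; first by case: sh2.
  apply: exec_code; first by rewrite st3; case: sh3.
  by rewrite st3; apply: exec_skip.
have sh0 : sim (st 0) (set_ireg s v 0) by apply: sim_setv.
have [u [s' [ex t sh']]] := loop (hv h w) 0 _ (erefl _) sh0.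
exists (1 + u), s'; split=> //.
  apply: exec_seq ex; apply: (@exec_instr S (IConst v 0)).
  by case: sh0.
have : hv h w * (htime V p + 3) <= V * (htime V p + 3) by rewrite leq_mul2r wV orbT.
lia.
Qed.

End Simulation.

Local Open Scope ring_scope.

(** * Geometrically decreasing values of a linear functional *)

(** Extracting n-th roots leaves 4n^2 + 1 < 16^n. This fixes 4n^2 as a value of q for which 2^q
    exceeds (q+1)^n. *)
Lemma expn_bound n : (0 < n)%N -> ((4 * n ^ 2).+1 ^ n < 2 ^ (4 * n ^ 2))%N.
Proof.
move=> n0; rewrite -mulnn mulnA expnM ltn_exp2r //.
elim: n n0 => // -[|n] IH _ //.
have := IH isT; rewrite [(4 * n.+2)%N]mulnS expnD -[X in (_ < X)%N -> _]mul1n.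
move: (2 ^ _)%N => X; lia.
Qed.

Section Geometric.
Variables (R : realFieldType) (n q : nat) (v : 'I_q -> 'I_n -> bool) (a : 'I_n -> R).
Let val (k : 'I_q) : R := \sum_j a j * (v k j)%:R.

(** The functional sees a set of vectors only through its coordinate sums, while ratios of at least
    3 make all subset sums of the values distinct. *)
Lemma geometric_subset_sums (A B : {set 'I_q}) :
  (forall k, 0 < val k) -> (forall k l : 'I_q, (k < l)%N -> 3 * val l <= val k) ->
  (forall j, \sum_(k in A) v k j = \sum_(k in B) v k j)%N -> A = B.
Proof.
move=> vpos vgeo AB.
have sAB : \sum_(k in A) val k = \sum_(k in B) val k.
  have E (C : {set 'I_q}) :
      \sum_(k in C) val k = \sum_j a j * (\sum_(k in C) v k j)%N%:R.
    rewrite exchange_big /=; apply: eq_bigr => j _.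
    by rewrite natr_sum mulr_sumr.
  by rewrite !E; apply: eq_bigr => j _; rewrite AB.
(* [2 * \sum_(l > k) val l < val k], so at the first k where A and B differ the
   sums could not agree. *)
have tail (k : 'I_q) (C : {set 'I_q}) : (forall l, l \in C -> (k < l)%N) ->
    2 * \sum_(l in C) val l < val k.
  have [m] := ubnP #|C|; elim: m => // m IH in k C * => Cm kC.
  have [->|[l0 l0C]] := set_0Vmem C; first by rewrite big_set0 mulr0.
  case: (@arg_minnP _ l0 (mem C) (fun l : 'I_q => l : nat) l0C) => l lC lmin.
  rewrite (big_setD1 l) //= mulrDr.
  have h : 2 * \sum_(i in C :\ l) val i < val l.
    apply: IH => [|i]; first by move: Cm; rewrite (cardsD1 l) (lC : l \in C).
    rewrite !inE => /andP[il iC]; rewrite ltn_neqAle lmin // andbT.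
    by apply: contra_neq il => /val_inj ->.
  by have := vgeo k l (kC l lC); move: h; lra.
(* The common part cancels; [C] gains [val k], and everything that [D] gains comes later and sums to
   less than half of it. *)
have aux (C D : {set 'I_q}) k : k \in C :\: D ->
    (forall l, l \in D :\: C -> (k < l)%N) ->
    \sum_(k in D) val k < \sum_(k in C) val k.
  move=> kC kD; rewrite (big_setID C) (big_setID (A := C) D) /= setIC ltrD2l.
  rewrite [X in _ < X](big_setD1 k) //=; have := tail k _ kD.
  have : 0 <= \sum_(i in (C :\: D) :\ k) val i by apply: sumr_ge0 => i _; apply: ltW.
  have : 0 <= \sum_(i in D :\: C) val i by apply: sumr_ge0 => i _; apply: ltW.
  lra.
apply/eqP/negPn/negP => neqAB.
have [k0 k0D] : exists k, k \in (A :\: B) :|: (B :\: A).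
  apply/set0Pn; apply: contra neqAB; rewrite setU_eq0 !setD_eq0 => /andP[h1 h2].
  by rewrite eqEsubset h1.
case: (@arg_minnP _ k0 (mem ((A :\: B) :|: (B :\: A))) (fun l : 'I_q => l : nat) k0D).
move=> k kD kmin.
have lt l (C D : {set 'I_q}) : l \in C :\: D -> k \in D :\: C ->
    (l \in (A :\: B) :|: (B :\: A)) -> (k < l)%N.
  move=> lC kC /kmin; rewrite leq_eqVlt => /orP[/eqP /val_inj kl|//].
  by case/setDP: lC => lC _; case/setDP: kC => _; rewrite kl lC.
case/setUP: (kD : k \in _ :|: _) => kE.
  suff : \sum_(k in B) val k < \sum_(k in A) val k by rewrite sAB ltxx.
  apply: (aux A B k kE) => l lD.
  by apply: (lt l B A) => //; rewrite inE lD orbT.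
suff : \sum_(k in A) val k < \sum_(k in B) val k by rewrite sAB ltxx.
apply: (aux B A k kE) => l lD.
by apply: (lt l A B) => //; rewrite inE lD.
Qed.

(** Pigeonhole: a subset of the q vectors is determined by its n coordinate sums, each of them at
    most q. *)
Lemma geometric_card :
  (forall k, 0 < val k) -> (forall k l : 'I_q, (k < l)%N -> 3 * val l <= val k) ->
  (2 ^ q <= q.+1 ^ n)%N.
Proof.
move=> vpos vgeo.
have lt (A : {set 'I_q}) j : (\sum_(k in A) v k j < q.+1)%N.
  rewrite ltnS; apply: leq_trans (_ : \sum_(k in A) 1 <= _)%N.
    by apply: leq_sum => k _; case: (v k j).
  by rewrite sum1_card; apply: leq_trans (max_card _) _; rewrite card_ord.
have inj : injective (fun A : {set 'I_q} => [ffun j => Ordinal (lt A j)]).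
  move=> A B /ffunP AB; apply: geometric_subset_sums => // j.
  by have /(congr1 (@nat_of_ord _)) := AB j; rewrite !ffunE.
have := leq_card _ inj; rewrite card_ffun !card_ord.
by rewrite -(cardsT {set 'I_q}) -powersetT card_powerset cardsT card_ord.
Qed.

End Geometric.

Lemma geometric_length (R : realFieldType) (n q : nat) (v : nat -> 'I_n -> bool)
    (a : 'I_n -> R) :
  (forall k, (k < q)%N -> 0 < \sum_j a j * (v k j)%:R) ->
  (forall k l, (k < l)%N -> (l < q)%N ->
    3 * (\sum_j a j * (v l j)%:R) <= \sum_j a j * (v k j)%:R) ->
  (0 < n)%N -> (q < 4 * n ^ 2)%N.
Proof.
move=> vpos vgeo n0; rewrite ltnNge; apply/negP => qn.
have := @geometric_card R n (4 * n ^ 2) (fun k j => v k j) a.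
move=> H; have : (2 ^ (4 * n ^ 2) <= (4 * n ^ 2).+1 ^ n)%N; last by rewrite leqNgt expn_bound.
apply: H => [k|k l kl].
- by apply: vpos; apply: leq_trans qn.
- by apply: vgeo => //; apply: leq_trans qn.
Qed.

(** Bernoulli: (1 + 1/(n-1))^(2n) is at least 1 + 2n/(n-1), hence at least 3; here with denominators
    cleared. *)
Lemma bernoulli_third (n : nat) : (0 < n)%N -> (3 * n.-1 ^ (2 * n) <= n ^ (2 * n))%N.
Proof.
case: n => // -[|n] _ //; rewrite succnK.
have B k : (n.+1 ^ k * (n.+1 + k) <= n.+2 ^ k * n.+1)%N.
  elim: k => [|k IH]; first by rewrite addn0.
  rewrite !expnS; move: IH; set X := (_ ^ k)%N; set Y := (_ ^ k)%N => IH.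
  have : (n.+2 * (X * (n.+1 + k)) <= n.+2 * (Y * n.+1))%N by rewrite leq_mul2l IH orbT.
  nia.
have := B (2 * n.+2)%N; set X := (_ ^ _)%N; set Y := (_ ^ _)%N => h.
have : (X * (3 * n.+1) <= Y * n.+1)%N.
  by apply: leq_trans h; rewrite leq_mul2l; apply/orP; right; lia.
by rewrite mulnA leq_mul2r /= mulnC.
Qed.

Section Contraction.
Variables (R : realFieldType) (n : nat).
Hypothesis n_gt0 : (0 < n)%N.

Lemma contraction_third (d : nat -> R) :
  (forall t, (t < 2 * n)%N -> n%:R * d t.+1 <= n.-1%:R * d t) ->
  0 <= d 0%N -> 3 * d (2 * n)%N <= d 0%N.
Proof.
move=> dS d0.
have E k : (k <= 2 * n)%N -> n%:R ^+ k * d k <= n.-1%:R ^+ k * d 0%N.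
  elim: k => [|k IH] kn; first by rewrite !expr0.
  rewrite !exprS -!mulrA.
  apply: (@le_trans _ _ (n%:R ^+ k * (n.-1%:R * d k))).
    by rewrite mulrCA ler_wpM2l ?exprn_ge0 // dS.
  by rewrite mulrCA ler_wpM2l // IH // ltnW.
have := E _ (leqnn _); rewrite -!natrX => h.
have p0 : 0 < (n ^ (2 * n))%:R :> R by rewrite ltr0n expn_gt0 n_gt0.
rewrite -(ler_pM2l p0) mulrCA.
apply: (@le_trans _ _ (3 * ((n.-1 ^ (2 * n))%:R * d 0%N))).
  by rewrite ler_pM2l.
rewrite mulrA ler_wpM2r // -natrM ler_nat; exact: bernoulli_third.
Qed.

End Contraction.

Definition step_bound n := (2 * n * (4 * n ^ 2))%N.

Lemma zero_one_contraction (R : realFieldType) (n m : nat) (z : nat -> 'I_n -> bool)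
    (z0 : 'I_n -> bool) (c : 'I_n -> R) :
  let d t := \sum_j c j * ((z t j)%:R - (z0 j)%:R) in
  (forall t, (t < m)%N -> 0 < d t) -> 0 <= d m ->
  (forall t, (t < m)%N -> n%:R * d t.+1 <= n.-1%:R * d t) ->
  (m <= step_bound n)%N.
Proof.
move=> d dpos dm dS.
(* In dimension 0 the gap is an empty sum, so there is no step at all. *)
have [n0|n0] := posnP n.
  have := dpos 0%N; case: m {dpos dm dS} => // m /(_ isT).
  by rewrite /d big1 ?ltxx // => j; have := ltn_ord j; rewrite {2}n0.
have dge t : (t <= m)%N -> 0 <= d t.
  by rewrite leq_eqVlt => /orP[/eqP->//|/dpos/ltW].
have third t : (t + 2 * n <= m)%N -> 3 * d (t + 2 * n)%N <= d t.
  move=> tm; have := @contraction_third R n n0 (fun k => d (t + k)%N).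
  rewrite addn0; apply; last by apply: dge; lia.
  by move=> k kn; rewrite addnS; apply: dS; lia.
have dmono k l : (k <= l)%N -> (l <= m)%N -> d l <= d k.
  move=> kl; rewrite -(subnKC kl); elim: (l - k)%N => [|e IH]; first by rewrite addn0.
  rewrite addnS => em; apply: le_trans (IH (ltnW em)).
  have e0 : 0 <= d (k + e)%N by apply: dge; apply: ltnW.
  have np : 0 < n%:R :> R by rewrite ltr0n.
  rewrite -(ler_pM2l np); apply: le_trans (dS _ em) _.
  by rewrite ler_wpM2r // ler_nat leq_pred.
rewrite leqNgt; apply/negP => bm.
(* Sample every 2n-th point. Flipping the coordinates where [z0] is 1 turns the differences into 0/1
   vectors, with the signs moved into the functional. *)
have := @geometric_length R n (4 * n ^ 2) (fun k j => z (k * (2 * n))%N j (+) z0 j)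
  (fun j => c j * (1 - 2 * (z0 j)%:R)).
have E t : \sum_j c j * (1 - 2 * (z0 j)%:R) * (z t j (+) z0 j)%:R = d t.
  by apply: eq_bigr => j _; case: (z t j) (z0 j) => [] [] /=; ring.
have lem k : (k < 4 * n ^ 2)%N -> (k * (2 * n) + 2 * n <= m)%N.
  move=> kn; apply: leq_trans (ltnW bm); rewrite /step_bound -mulSnr mulnC.
  by rewrite leq_mul2l kn orbT.
move=> H; suff : (4 * n ^ 2 < 4 * n ^ 2)%N by rewrite ltnn.
apply: H => // [k kn|k l kl ln]; rewrite ?E.
  by apply: dpos; have := lem k kn; lia.
apply: le_trans (third (k * (2 * n))%N _); last first.
  by apply: lem; apply: ltn_trans ln.
rewrite ler_pM2l // dmono //; last by have := lem l ln; lia.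
by rewrite -mulSnr leq_mul2r kl orbT.
Qed.

(** * Faces and vertices of the feasible region *)

(** Also applied inside the feasible cone at a vertex, with [D] the set of tight inequalities; hence
    the predicate. *)
Lemma ratio_test (R : realFieldType) (I : finType) (D : pred I) (a b : I -> R) :
  (forall i, D i -> 0 <= a i) -> (exists2 i, D i & 0 < b i) ->
  exists t j, [/\ D j /\ 0 < b j, t = a j / b j, 0 <= t,
    forall i, D i -> 0 < b i -> t <= a i / b i & forall i, D i -> t * b i <= a i].
Proof.
move=> a_ge0 [i0 Di0 bi0].
have P0 : (fun i => D i && (0 < b i)) i0 by rewrite /= Di0.
case: (@arg_minP _ _ _ i0 (fun i => D i && (0 < b i)) (fun i => a i / b i) P0).
move=> j /andP[Dj bj] jmin; exists (a j / b j), j.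
have t_ge0 : 0 <= a j / b j by rewrite divr_ge0 // ?a_ge0 // ltW.
split=> // i Di; first by move=> bi; apply: jmin; rewrite Di.
have [bi|bi] := ltP 0 (b i); first by rewrite -ler_pdivlMr //; apply: jmin; rewrite Di.
by apply: le_trans (a_ge0 i Di); rewrite mulr_ge0_le0.
Qed.

(** [P] may be infinite and undecidable, as for the edge-directions at a vertex, but [f] takes only
    one value per key; the keys are examined one after the other. *)
Lemma exists_min_key (R : realFieldType) (T : Type) (K : finType) (P : T -> Prop) (f : T -> R) (key : T -> K) :
  (forall x y, P x -> P y -> key x = key y -> f x = f y) -> (exists x, P x) ->
  exists2 x, P x & forall y, P y -> f x <= f y.
Proof.
move=> fk [x0 Px0].
suff [x [Px _ xmin]] : exists x, [/\ P x, key x \in enum K &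
    forall y, P y -> key y \in enum K -> f x <= f y].
  by exists x => // y Py; apply: xmin; rewrite // mem_enum.
have : exists2 x, P x & key x \in enum K by exists x0; rewrite // mem_enum.
elim: (enum K) => [[x _] //|k s IH exk].
case: (classic (exists2 x, P x & key x \in s)) => [/IH [x [Px xs xmin]]|ns].
  case: (classic (exists2 y, P y & key y = k /\ f y < f x)) => [[y Py [yk yx]]|ny].
    exists y; split=> //; first by rewrite yk mem_head.
    move=> z Pz; rewrite inE => /orP[/eqP zk|zs]; last by rewrite (le_trans (ltW yx)) ?xmin.
    by rewrite (fk z y) // zk yk.
  exists x; split=> //; first by rewrite inE xs orbT.
  move=> z Pz; rewrite inE => /orP[/eqP zk|zs]; last exact: xmin.
  by rewrite leNgt; apply/negP => zx; apply: ny; exists z.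
case: (classic (exists2 x, P x & key x = k)) => [[x Px xk]|nk]; last first.
  case: exk => x Px; rewrite inE => /orP[/eqP xk|xs]; first by case: nk; exists x.
  by case: ns; exists x.
exists x; split=> //; first by rewrite xk mem_head.
move=> z Pz; rewrite inE => /orP[/eqP zk|zs]; last by case: ns; exists z.
by rewrite (fk z x) // zk xk.
Qed.

Section LinearMaps.
Variables (R : realFieldType) (mA mB n : nat) (lp : LP mA mB n).
Implicit Types (u v w x y h z : 'cV[R]_n) (a : R).

Lemma dotvE u v : dotv u v = \sum_j u j 0 * v j 0.
Proof. by rewrite /dotv mxE; apply: eq_bigr => j _; rewrite mxE. Qed.

Lemma dotvDr w u v : dotv w (u + v) = dotv w u + dotv w v.
Proof. by rewrite /dotv mulmxDr mxE. Qed.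

Lemma dotvZr w a u : dotv w (a *: u) = a * dotv w u.
Proof. by rewrite /dotv -scalemxAr mxE. Qed.

Lemma dotvNr w u : dotv w (- u) = - dotv w u.
Proof. by rewrite /dotv mulmxN mxE. Qed.

Lemma objD u v : objective lp (u + v) = objective lp u + objective lp v.
Proof. exact: dotvDr. Qed.

Lemma objZ a u : objective lp (a *: u) = a * objective lp u.
Proof. exact: dotvZr. Qed.

Lemma objN u : objective lp (- u) = - objective lp u.
Proof. exact: dotvNr. Qed.

Lemma AmulD u v : Amul lp (u + v) = Amul lp u + Amul lp v.
Proof. exact: mulmxDr. Qed.

Lemma AmulZ a u : Amul lp (a *: u) = a *: Amul lp u.
Proof. by rewrite /Amul -scalemxAr. Qed.

Lemma AmulN u : Amul lp (- u) = - Amul lp u.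
Proof. exact: mulmxN. Qed.

Lemma BmulD u v i : Bmul lp (u + v) i 0 = Bmul lp u i 0 + Bmul lp v i 0.
Proof. by rewrite /Bmul mulmxDr mxE. Qed.

Lemma BmulZ a u i : Bmul lp (a *: u) i 0 = a * Bmul lp u i 0.
Proof. by rewrite /Bmul -scalemxAr mxE. Qed.

Lemma BmulN u i : Bmul lp (- u) i 0 = - Bmul lp u i 0.
Proof. by rewrite /Bmul mulmxN mxE. Qed.

Lemma tightP x i : reflect (Bmul lp x i 0 = rhs R lp i) (i \in tight lp x).
Proof. by rewrite inE; apply: eqP. Qed.

Lemma norm1_ge0 u : 0 <= norm1 u.
Proof. by apply: sumr_ge0 => j _; apply: normr_ge0. Qed.

Lemma norm1_eq0 u : norm1 u = 0 -> u = 0.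
Proof.
move/eqP; rewrite psumr_eq0 => [/allP u0|j _]; last exact: normr_ge0.
apply/colP => j; rewrite mxE; apply/eqP; rewrite -normr_eq0.
by apply: u0; rewrite mem_index_enum.
Qed.

Lemma norm1_gt0 u : u <> 0 -> 0 < norm1 u.
Proof. by move=> u0; rewrite lt_def norm1_ge0 andbT; apply/eqP => /norm1_eq0. Qed.

Lemma norm1Z a u : norm1 (a *: u) = `|a| * norm1 u.
Proof. by rewrite /norm1 mulr_sumr; apply: eq_bigr => j _; rewrite mxE normrM. Qed.

Lemma steepnessZ a u : 0 < a -> steepness lp (a *: u) = steepness lp u.
Proof.
move=> a0; rewrite /steepness objZ norm1Z gtr0_norm //.
by rewrite -mulf_div divff ?gt_eqF // mul1r.
Qed.

Definition slack x i := rhs R lp i - Bmul lp x i 0.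

Lemma feasible_slack x i : feasible lp x -> 0 <= slack x i.
Proof. by case=> _ /(_ i); rewrite subr_ge0. Qed.

(** The step is positive because a direction of the feasible cone increases no tight inequality; the
    blocking [j] was therefore slack at [x]. *)
Lemma max_step x h : feasible lp x -> feasible_cone lp x h ->
  (exists i, 0 < Bmul lp h i 0) ->
  exists t j, [/\ 0 < t, 0 < Bmul lp h j 0, t = slack x j / Bmul lp h j 0,
    forall i, 0 < Bmul lp h i 0 -> t <= slack x i / Bmul lp h i 0 &
    feasible lp (x + t *: h) /\ j \in tight lp (x + t *: h)].
Proof.
move=> fx [Ah Bh] [i0 Bi0].
have [||t [j [[_ bj] tE t0 tmin tle]]] :=
  @ratio_test R 'I_mB xpredT (slack x) (fun i => Bmul lp h i 0).
- by move=> i _; apply: feasible_slack.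
- by exists i0.
exists t, j; split=> //.
- rewrite tE divr_gt0 // lt_def feasible_slack // andbT.
  rewrite subr_eq0 eq_sym; apply/negP => tj.
  by have := Bh j; rewrite inE tj leNgt bj => /(_ isT).
- by move=> i; apply: tmin.
split; first split.
- by case: fx => fA _; rewrite AmulD AmulZ Ah scaler0 addr0.
- by move=> i; rewrite BmulD BmulZ; have := tle i isT; rewrite /slack; lra.
apply/tightP; rewrite BmulD BmulZ tE divfK ?gt_eqF // /slack; ring.
Qed.

Lemma small_step x h : feasible lp x -> feasible_cone lp x h ->
  exists2 t, 0 < t & feasible lp (x + t *: h).
Proof.
move=> fx hh; case: (classic (exists i, 0 < Bmul lp h i 0)) => [ex|nex].
  by have [t [j [t0 _ _ _ [fy _]]]] := max_step fx hh ex; exists t.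
exists 1 => //; rewrite scale1r; split.
  by case: fx hh => fA _ [Ah _]; rewrite AmulD Ah addr0.
move=> i; rewrite BmulD; case: fx => _ /(_ i) xi.
have : Bmul lp h i 0 <= 0 by rewrite leNgt; apply/negP => hi; apply: nex; exists i.
lra.
Qed.

Lemma feasible_diff x y : feasible lp x -> feasible lp y -> feasible_cone lp x (y - x).
Proof.
move=> [Ax _] [Ay By]; split; first by rewrite AmulD AmulN Ax Ay subrr.
by move=> i /tightP xi; rewrite BmulD BmulN xi subr_le0.
Qed.

(** On the feasible region, minus the sum of the rows of [S] is minimal exactly where each of these
    inequalities is tight; [x] shows that such points exist. *)
Lemma tight_face x (S : {set 'I_mB}) : feasible lp x -> S \subset tight lp x ->
  face (feasible lp) (fun z : 'cV[R]_n => feasible lp z /\ S \subset tight lp z).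
Proof.
move=> fx Sx; exists (- \sum_(i in S) (row i (map_mx intr (lpB lp)))^T).
have E z : dotv (- \sum_(i in S) (row i (map_mx intr (lpB lp) : 'M[R]_(_, _)))^T) z
    = - \sum_(i in S) Bmul lp z i 0.
  rewrite /dotv linearN /= mulNmx mxE; congr (- _).
  rewrite linear_sum /= mulmx_suml summxE; apply: eq_bigr => i _.
  by rewrite trmxK -row_mul mxE.
have Sub z : S \subset tight lp z ->
    \sum_(i in S) Bmul lp z i 0 = \sum_(i in S) rhs R lp i.
  by move=> Sz; apply: eq_bigr => i iS; apply/tightP/(subsetP Sz).
move=> z; split=> [[fz Sz]|[fz zmin]]; split=> //.
  by move=> y [_ fy]; rewrite !E lerN2 (Sub z) //; apply: ler_sum => i _; apply: fy.
have := zmin x fx; rewrite !E lerN2 (Sub x) // => le.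
apply/subsetP => i iS; apply/tightP.
have /eqP : \sum_(i in S) slack z i = 0.
  apply/eqP; rewrite eq_le sumr_ge0 ?andbT => [|k _]; last exact: feasible_slack.
  by rewrite /slack sumrB subr_le0.
rewrite psumr_eq0 => [/allP /(_ i)|k _]; last exact: feasible_slack.
by rewrite mem_index_enum iS /= => /(_ isT) /eqP /subr0_eq ->.
Qed.

Lemma face_ext (P F G : 'cV[R]_n -> Prop) :
  (forall z, F z <-> G z) -> face P F -> face P G.
Proof. by move=> FG [w Fw]; exists w => z; rewrite -FG. Qed.

Lemma vertex_feasible x : vertex lp x -> feasible lp x.
Proof. by case=> w /(_ x) [/(_ erefl) []]. Qed.

(** Small steps along h and -h both stay feasible, so the functional exposing [x] vanishes on [h];
    then [x + t *: h] is a minimizer too and must be [x]. *)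
Lemma vertex_kernel x h : vertex lp x -> Amul lp h = 0 ->
  (forall i, i \in tight lp x -> Bmul lp h i 0 = 0) -> h = 0.
Proof.
move=> vx Ah Bh; have fx := vertex_feasible vx; case: vx => w wP.
have [t t0 ft] : exists2 t, 0 < t & feasible lp (x + t *: h).
  by apply: small_step => //; split=> // i /Bh ->.
have [s s0 fs] : exists2 t, 0 < t & feasible lp (x + t *: - h).
  by apply: small_step => //; split=> [|i /Bh]; rewrite ?AmulN ?Ah ?oppr0 // BmulN => ->;
  rewrite oppr0.
have [_ xmin] := (wP x).1 erefl.
have := xmin _ ft; have := xmin _ fs; rewrite !dotvDr !dotvZr dotvNr.
rewrite !lerDl => h1 h2.
have wh : dotv w h = 0.
  apply/eqP; rewrite eq_le -(pmulr_rge0 _ t0) h2 andbT.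
  by rewrite -oppr_ge0 -(pmulr_rge0 _ s0).
have /wP : feasible lp (x + t *: h) /\ forall y, feasible lp y ->
    dotv w (x + t *: h) <= dotv w y.
  by split=> // y; rewrite dotvDr dotvZr wh mulr0 addr0; apply: xmin.
rewrite -[RHS]addr0 => /addrI /eqP; rewrite scaler_eq0 gt_eqF //=.
by move/eqP.
Qed.

Lemma kernel_vertex x : feasible lp x ->
  (forall h, Amul lp h = 0 -> (forall i, i \in tight lp x -> Bmul lp h i 0 = 0) -> h = 0) ->
  vertex lp x.
Proof.
move=> fx ker; apply: face_ext (tight_face fx (subxx _)) => z; split=> [[fz Sz]|->] //.
apply/eqP; rewrite -subr_eq0; apply/eqP; apply: ker.
  by case: (feasible_diff fx fz).
move=> i xi; rewrite BmulD BmulN (tightP _ _ xi).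
by rewrite (tightP _ _ (subsetP Sz _ xi)) subrr.
Qed.

End LinearMaps.

(** * The feasible cone of a 0/1 polytope *)

Section ZeroOne.
Variables (R : realFieldType) (mA mB n : nat) (lp : LP mA mB n).
Hypothesis zo : zero_one_polytope R lp.
Implicit Types (u v w x y g h : 'cV[R]_n) (a : R).

Lemma bounded_direction x h : feasible lp x -> Amul lp h = 0 -> h <> 0 ->
  exists i, 0 < Bmul lp h i 0.
Proof.
move=> fx Ah h0; apply: NNPP => nex; case: zo => -[M xM] _.
have hle i : Bmul lp h i 0 <= 0.
  by rewrite leNgt; apply/negP => hi; apply: nex; exists i.
have [j hj] : exists j, h j 0 != 0.
  apply: NNPP => nj; apply: h0; apply/colP => j; rewrite mxE; apply/eqP.
  by apply: NNPP => hj; apply: nj; exists j; apply/negP.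
have nh : 0 < `|h j 0| by rewrite normr_gt0.
(* A step after which the coordinate [j] alone exceeds the bound [M]. *)
pose t := (M + `|x j 0| + 1) / `|h j 0|.
have M0 : 0 <= M by apply: le_trans (normr_ge0 _) (xM x fx j).
have t0 : 0 <= t by rewrite divr_ge0 // !addr_ge0.
have ft : feasible lp (x + t *: h).
  case: fx => fA fB; split; first by rewrite AmulD AmulZ Ah scaler0 addr0.
  move=> i; rewrite BmulD BmulZ; have := mulr_ge0_le0 t0 (hle i).
  by have := fB i; lra.
have := xM _ ft j; rewrite !mxE.
have := lerB_normD (t * h j 0) (x j 0); rewrite normrM (ger0_norm t0) divfK ?gt_eqF //.
rewrite [t * _ + _]addrC; lra.
Qed.

(** Unless [y] is a vertex, some line through it keeps the tight inequalities tight. Following it in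
    a direction that does not increase [w] must, by boundedness, hit a new one; induct on the number
    of inequalities not yet tight. *)
Lemma vertex_below w y : feasible lp y ->
  exists2 v : 'cV[R]_n, vertex lp v & dotv w v <= dotv w y.
Proof.
have [k] := ubnP (mB - #|tight lp y|); elim: k => // k IH in y * => kP fy.
case: (classic (vertex lp y)) => [vy|nvy]; first by exists y.
have [h h0 [Ah Bh wh]] : exists2 h, h <> 0 & [/\ Amul lp h = 0,
    forall i, i \in tight lp y -> Bmul lp h i 0 = 0 & dotv w h <= 0].
  apply: NNPP => nex; apply: nvy; apply: kernel_vertex => // h Ah Bh.
  apply: NNPP => h0; apply: nex.
  have [wh|wh] := leP (dotv w h) 0; first by exists h.
  exists (- h); first by move/eqP; rewrite oppr_eq0 => /eqP.
  split; rewrite ?AmulN ?Ah ?oppr0 ?dotvNr ?oppr_le0 ?ltW //.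
  by move=> i /Bh e; rewrite BmulN e oppr0.
have hc : feasible_cone lp y h by split=> // i /Bh ->.
have [t [j [t0 hj _ _ [ft jt]]]] := max_step fy hc (bounded_direction fy Ah h0).
have [|v vv wv] := IH (y + t *: h) _ ft; last first.
- exists v => //; apply: le_trans wv _; rewrite dotvDr dotvZr gerDl.
  by rewrite mulr_ge0_le0 // ltW.
have lt : (#|tight lp y| < #|tight lp (y + t *: h)|)%N.
  apply: proper_card; apply/properP; split.
    apply/subsetP => i yi; apply/tightP; rewrite BmulD BmulZ Bh // mulr0 addr0.
    exact/tightP.
  by exists j => //; apply/negP => /Bh e; rewrite e ltxx in hj.
have := subset_leq_card (subsetT (tight lp (y + t *: h))).
by rewrite cardsT card_ord; move: kP lt; lia.
Qed.

Lemma dotv_delta j u : dotv (delta_mx j 0) u = u j 0.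
Proof.
rewrite dotvE (bigD1 j) //= mxE !eqxx mul1r big1 ?addr0 // => i /negPf ij.
by rewrite mxE ij mul0r.
Qed.

(** A coordinate and its opposite are bounded below by their values at vertices, which replaces
    writing [y] as a convex combination. *)
Lemma feasible_box y j : feasible lp y -> 0 <= y j 0 <= 1.
Proof.
move=> fy; case: zo => _ z01; apply/andP; split.
  have [v vv] := vertex_below (delta_mx j 0) fy; rewrite !dotv_delta.
  by apply: le_trans; case: (z01 v vv j) => ->.
have [v vv] := vertex_below (- delta_mx j 0) fy.
have E u : dotv (- delta_mx j 0) u = - u j 0.
  by rewrite -(dotv_delta j u) /dotv linearN /= mulNmx mxE.
by rewrite !E lerN2 => /le_trans; apply; case: (z01 v vv j) => ->.
Qed.

(* On the feasible cone at a 0/1 point x, which lies in an orthant, norm1 is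
   this linear functional. *)
Definition signed_sum x u := \sum_j (1 - 2 * x j 0) * u j 0.

Lemma signed_sumD x u v : signed_sum x (u + v) = signed_sum x u + signed_sum x v.
Proof.
by rewrite /signed_sum -big_split; apply: eq_bigr => j _; rewrite mxE mulrDr.
Qed.

Lemma signed_sumZ x a u : signed_sum x (a *: u) = a * signed_sum x u.
Proof.
rewrite /signed_sum mulr_sumr; apply: eq_bigr => j _; rewrite mxE; ring.
Qed.

Lemma norm1_cone x u : vertex lp x -> feasible_cone lp x u -> norm1 u = signed_sum x u.
Proof.
(* The point [x + t *: u] stays in the unit cube, so each [x j 0] dictates the sign of [u j 0]. *)
move=> vx uc; have [t t0 ft] := small_step (vertex_feasible vx) uc.
apply: eq_bigr => j _; have := feasible_box j ft; rewrite !mxE => /andP[l1 l2].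
case: zo => _ /(_ x vx j) [] e; rewrite e in l1 l2 *.
  rewrite mulr0 subr0 mul1r ger0_norm //.
  by rewrite add0r pmulr_rge0 in l1.
have u0 : u j 0 <= 0 by rewrite -(pmulr_rle0 _ t0); lra.
rewrite ler0_norm //; ring.
Qed.

Lemma coneZ x a u : 0 <= a -> feasible_cone lp x u -> feasible_cone lp x (a *: u).
Proof.
move=> a0 [Au Bu]; split; first by rewrite AmulZ Au scaler0.
by move=> i ti; rewrite BmulZ mulr_ge0_le0 ?Bu.
Qed.

Lemma cone_pointed x u : vertex lp x -> feasible_cone lp x u ->
  signed_sum x u = 0 -> u = 0.
Proof. by move=> vx uc s0; apply: norm1_eq0; rewrite (norm1_cone vx uc). Qed.

Lemma cone_opp x u : vertex lp x -> feasible_cone lp x u ->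
  feasible_cone lp x (- u) -> u = 0.
Proof.
move=> vx uc nuc; apply: vertex_kernel vx _ _; first by case: uc.
move=> i ti; apply/eqP; rewrite eq_le; case: uc nuc => _ /(_ i ti) -> [_ /(_ i ti)].
by rewrite BmulN oppr_le0.
Qed.

Definition cone_zeros x u : {set 'I_mB} :=
  [set i in tight lp x | Bmul lp u i 0 == 0].

(** The analogue of [vertex_below] on the slice of the cone where [signed_sum] is constant: there
    the norm is constant, so lowering the objective lowers the steepness. *)
Lemma edge_below x u : vertex lp x -> feasible_cone lp x u -> u <> 0 ->
  exists2 g, edge_direction lp x g & steepness lp g <= steepness lp u.
Proof.
move=> vx; have [k] := ubnP (mB - #|cone_zeros x u|); elim: k => // k IH in u *.
move=> kP uc u0; case: (classic (edge_direction lp x u)) => [eu|neu]; first by exists u.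
have [v [w [vc wc uE nv]]] : exists v w, [/\ feasible_cone lp x v,
    feasible_cone lp x w, v + w = u & forall a, 0 <= a -> v <> a *: u].
  apply: NNPP => nex; apply: neu; split=> // v w vc wc uE.
  by apply: NNPP => na; apply: nex; exists v, w; split=> // a a0 e; apply: na; exists a.
have su : 0 < signed_sum x u by rewrite -(norm1_cone vx uc) norm1_gt0.
(* A splitting of a non-extreme [u] gives a direction [h] inside the slice. On tight rows both
   summands vanish where [u] does, hence so does [h]. *)
pose h := signed_sum x u *: v - signed_sum x v *: u.
have sh : signed_sum x h = 0.
  by rewrite /h -scaleNr signed_sumD !signed_sumZ; ring.
have h0 : h <> 0.
  move/eqP; rewrite subr_eq0 => /eqP e.
  apply: (nv (signed_sum x v / signed_sum x u)).
    by apply: divr_ge0; [rewrite -(norm1_cone vx vc) norm1_ge0 | apply: ltW].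
  by rewrite mulrC -scalerA -e scalerA mulVf ?gt_eqF // scale1r.
have Ah : Amul lp h = 0.
  by case: vc uc => Av _ [Au _]; rewrite AmulD AmulN !AmulZ Av Au !scaler0 subrr.
have Bh i : i \in cone_zeros x u -> Bmul lp h i 0 = 0.
  rewrite inE => /andP[ti /eqP ui]; rewrite BmulD BmulN !BmulZ ui.
  have : Bmul lp v i 0 = 0.
    case: vc wc => _ /(_ i ti) vi [_ /(_ i ti) wi].
    by move: ui; rewrite -uE BmulD; lra.
  by move->; rewrite !mulr0 subrr.
have {sh h0 Ah Bh}[{}h [h0 [sh Ah Bh ch]]] : exists h, h <> 0 /\ [/\ signed_sum x h = 0,
   Amul lp h = 0, forall i, i \in cone_zeros x u -> Bmul lp h i 0 = 0 &
   objective lp h <= 0].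
  have [ch|ch] := leP (objective lp h) 0; first by exists h.
  exists (- h); split; first by move/eqP; rewrite oppr_eq0 => /eqP.
  split; rewrite ?AmulN ?Ah ?objN ?oppr0 ?oppr_le0 ?ltW //.
    by rewrite -scaleN1r signed_sumZ sh mulr0.
  by move=> i /Bh e; rewrite BmulN e oppr0.
have [||t [j [[tj hj] tE t0 _ tle]]] := @ratio_test R 'I_mB (mem (tight lp x))
   (fun i => - Bmul lp u i 0) (fun i => Bmul lp h i 0).
- by move=> i ti; rewrite oppr_ge0; case: uc => _; apply.
- apply: NNPP => nex; apply: h0; apply: (cone_pointed vx) => //; split=> // i ti.
  by rewrite leNgt; apply/negP => hi; apply: nex; exists i.
pose u' := u + t *: h.
have u'c : feasible_cone lp x u'.
  split; first by case: uc => Au _; rewrite AmulD AmulZ Au Ah scaler0 addr0.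
  by move=> i ti; rewrite BmulD BmulZ; have := tle i ti; lra.
have su' : signed_sum x u' = signed_sum x u by rewrite signed_sumD signed_sumZ sh mulr0 addr0.
have u'0 : u' <> 0.
  move=> e; move: su; rewrite -su' e -(scale0r u) signed_sumZ mul0r ltxx //.
have lt : (#|cone_zeros x u| < #|cone_zeros x u'|)%N.
  apply: proper_card; apply/properP; split.
    apply/subsetP => i zi; have := zi; rewrite !inE => /andP[-> /eqP ui] /=.
    by rewrite BmulD BmulZ ui Bh // mulr0 addr0.
  have e : t * Bmul lp h j 0 = - Bmul lp u j 0 by rewrite tE /= divfK ?gt_eqF.
  exists j; first by rewrite inE (tj : j \in tight lp x) BmulD BmulZ e addrN eqxx.
  by apply/negP => /Bh e0; rewrite e0 ltxx in hj.
have [|g eg gu] := IH u' _ u'c u'0.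
  have := subset_leq_card (subsetT (cone_zeros x u')).
  by rewrite cardsT card_ord; move: kP lt; lia.
exists g => //; apply: le_trans gu _.
rewrite /steepness (norm1_cone vx u'c) (norm1_cone vx uc) su' ler_pM2r ?invr_gt0 //.
by rewrite objD objZ gerDl mulr_ge0_le0.
Qed.

(** Subtract from [g] the largest multiple of [h] that leaves it in the cone; the inclusion of zeros
    makes this multiple positive, and extremality of [g] applies to the splitting. So an
    edge-direction is determined by its zeros up to scaling. *)
Lemma edge_parallel x g h : vertex lp x -> edge_direction lp x g ->
  feasible_cone lp x h -> h <> 0 -> cone_zeros x g \subset cone_zeros x h ->
  exists2 a, 0 < a & h = a *: g.
Proof.
move=> vx [g0 gc gex] hc h0 gh.
have [||t [j [[tj hj] tE t0 _ tle]]] := @ratio_test R 'I_mB (mem (tight lp x))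
   (fun i => - Bmul lp g i 0) (fun i => - Bmul lp h i 0).
- by move=> i ti; rewrite oppr_ge0; case: gc => _; apply.
- apply: NNPP => nex; apply: h0; apply: (cone_opp vx) => //; case: hc => Ah Bh.
  split=> [|i ti]; first by rewrite AmulN Ah oppr0.
  by rewrite BmulN leNgt; apply/negP => hi; apply: nex; exists i.
have gj : Bmul lp g j 0 <> 0.
  move=> e; have : j \in cone_zeros x h.
    by apply: (subsetP gh); rewrite inE (tj : j \in tight lp x) e eqxx.
  by rewrite inE => /andP[_ /eqP e']; rewrite e' oppr0 ltxx in hj.
have {}t0 : 0 < t.
  rewrite lt_def t0 andbT tE /=; apply: mulf_neq0; last by rewrite invr_eq0 gt_eqF.
  by rewrite oppr_eq0; apply/eqP.
have [|||a a0 e] := gex (t *: h) (g - t *: h).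
- by apply: coneZ => //; apply: ltW.
- split; first by case: gc hc => Ag _ [Ah _]; rewrite AmulD AmulN AmulZ Ag Ah scaler0 subrr.
  by move=> i ti; rewrite BmulD BmulN BmulZ; have := tle i ti; lra.
- by rewrite addrC subrK.
have hE : h = (t^-1 * a) *: g by rewrite -scalerA -e scalerA mulVf ?gt_eqF // scale1r.
exists (t^-1 * a) => //.
have : 0 <= t^-1 * a by rewrite mulr_ge0 // invr_ge0 ltW.
rewrite lt_def => ->; rewrite andbT.
by apply/eqP => e0; apply: h0; rewrite hE e0 scale0r.
Qed.

Lemma edge_scale x g a : 0 < a -> edge_direction lp x g -> edge_direction lp x (a *: g).
Proof.
move=> a0 [g0 gc gex]; split.
- by move/eqP; rewrite scaler_eq0 gt_eqF //= => /eqP.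
- by apply: coneZ => //; apply: ltW.
move=> u v uc vc uv; have [|||b b0 e] := gex (a^-1 *: u) (a^-1 *: v).
- by apply: coneZ => //; rewrite invr_ge0 ltW.
- by apply: coneZ => //; rewrite invr_ge0 ltW.
- by rewrite -scalerDr uv scalerA mulVf ?gt_eqF // scale1r.
exists b => //; rewrite scalerA [b * a]mulrC -scalerA -e scalerA mulfV ?gt_eqF //.
by rewrite scale1r.
Qed.

Lemma steepest_scale x g a : 0 < a -> steepest_edge lp x g -> steepest_edge lp x (a *: g).
Proof.
by move=> a0 [eg gs]; split=> [|h /gs]; [apply: edge_scale | rewrite steepnessZ].
Qed.

Lemma steepest_cone x g u : vertex lp x -> steepest_edge lp x g ->
  feasible_cone lp x u -> steepness lp g * norm1 u <= objective lp u.
Proof.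
move=> vx [eg gs] uc; case: (classic (u = 0)) => [->|u0].
  have -> : norm1 (0 : 'cV[R]_n) = 0 by apply: big1 => j _; rewrite mxE normr0.
  by rewrite mulr0 -(scale0r (0 : 'cV[R]_n)) objZ mul0r.
have [h eh hu] := edge_below vx uc u0.
by rewrite -ler_pdivlMr ?norm1_gt0 //; apply: le_trans (gs h eh) hu.
Qed.

Lemma steepest_exists x u : vertex lp x -> feasible_cone lp x u -> objective lp u < 0 ->
  exists2 g, steepest_edge lp x g & objective lp g < 0.
Proof.
move=> vx uc cu.
have u0 : u <> 0 by move=> e; move: cu; rewrite e -(scale0r u) objZ mul0r ltxx.
(* By [edge_parallel] the steepness of an edge-direction depends only on the finite datum
   [cone_zeros], so a minimum exists. *)
have [||g eg gmin] := @exists_min_key R _ _ (edge_direction lp x) (steepness lp) (cone_zeros x).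
- move=> g h eg [h0 hc _] gh.
  have [|a a0 ->] := edge_parallel vx eg hc h0; first by rewrite gh.
  by rewrite steepnessZ.
- by have [g eg _] := edge_below vx uc u0; exists g.
have sg : steepest_edge lp x g by [].
exists g => //; have := steepest_cone vx sg uc => h.
have : steepness lp g < 0.
  rewrite ltNge; apply/negP => sg0; move: cu; rewrite ltNge => /negP; apply.
  by apply: le_trans h; rewrite mulr_ge0 ?norm1_ge0.
by rewrite /steepness pmulr_llt0 // invr_gt0 norm1_gt0 //; case: eg.
Qed.

Lemma edge_step x g : vertex lp x -> edge_direction lp x g ->
  exists t j, [/\ 0 < t, 0 < Bmul lp g j 0 /\ t = slack lp x j / Bmul lp g j 0,
    forall i, 0 < Bmul lp g i 0 -> t <= slack lp x i / Bmul lp g i 0,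
    j \in tight lp (x + t *: g) &
    adjacent lp x (x + t *: g)].
Proof.
move=> vx eg; have fx := vertex_feasible vx; have [g0 gc _] := eg; have [Ag Bg] := gc.
have [t [j [t0 gj tE tmin [fy yj]]]] := max_step fx gc (bounded_direction fx Ag g0).
exists t, j; split=> //.
(* The face where the inequalities of [cone_zeros x g] are tight lies on the ray from [x] along
   [g]. *)
have parallel z : feasible lp z -> cone_zeros x g \subset tight lp z ->
    exists2 a, 0 <= a & z = x + a *: g.
  move=> fz Sz; have zc := feasible_diff fx fz.
  case: (classic (z - x = 0)) => [/eqP|zx].
    by rewrite subr_eq0 => /eqP ->; exists 0 => //; rewrite scale0r addr0.
  have [|a a0 e] := edge_parallel vx eg zc zx.
    apply/subsetP => i iz; have := iz; rewrite !inE => /andP[/eqP ti _].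
    rewrite ti eqxx BmulD BmulN ti (tightP _ _ _ (subsetP Sz _ iz)) subrr eqxx //.
  by exists a; rewrite ?ltW // -e addrC subrK.
have sub : cone_zeros x g \subset tight lp x by apply/subsetP => i; rewrite inE => /andP[].
have zy : cone_zeros x g \subset tight lp (x + t *: g).
  apply/subsetP => i; rewrite inE => /andP[/tightP ti /eqP gi]; apply/tightP.
  by rewrite BmulD BmulZ gi mulr0 addr0.
have amax a : feasible lp (x + a *: g) -> a <= t.
  move=> [_ /(_ j)]; rewrite BmulD BmulZ tE ler_pdivlMr // /slack; lra.
split=> //.
- apply: kernel_vertex => // h Ah Bh.
  have fS := tight_face fy (subxx _).
  (* Requiring [j] to be tight as well leaves a single point of that ray, since [g] increases row
     [j] strictly. *)
  have : vertex lp (x + t *: g).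
    apply: face_ext fS => z; split=> [[fz Sz]|->] //.
    have [a a0 zE] := parallel z fz (subset_trans zy Sz).
    have /tightP := subsetP Sz _ yj; rewrite zE BmulD BmulZ => e.
    have /tightP := yj; rewrite BmulD BmulZ -e => /addrI /mulIf -> //.
    by rewrite gt_eqF.
  by move=> vy; apply: (vertex_kernel vy).
- move=> e; move: e; rewrite -[LHS]addr0 => /addrI /esym /eqP.
  by rewrite scaler_eq0 gt_eqF //= => /eqP.
apply: face_ext (tight_face fx sub) => z; split.
  move=> [fz Sz]; have [a a0 zE] := parallel z fz Sz.
  exists (a / t); first by rewrite divr_ge0 // ?(ltW t0) // ler_pdivrMr // mul1r amax -?zE.
  rewrite scalerBl scale1r scalerDr scalerA divfK ?gt_eqF // zE.
  by rewrite addrA subrK.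
move=> [s /andP[s0 s1] zE].
have {}zE : z = x + (s * t) *: g.
  by rewrite zE scalerBl scale1r scalerDr scalerA addrA subrK.
rewrite zE; split; last first.
  apply/subsetP => i; rewrite inE => /andP[/tightP ti /eqP gi]; apply/tightP.
  by rewrite BmulD BmulZ gi mulr0 addr0.
split; first by case: fx => fA _; rewrite AmulD AmulZ Ag scaler0 addr0.
move=> i; case: fx fy => _ /(_ i) h1 [_ /(_ i)]; rewrite !BmulD !BmulZ => h2.
rewrite -mulrA; move: h1 h2; set X := Bmul _ _ _ _; set Y := t * _; set Z := rhs _ _ _.
move=> h1 h2; have : s * (X + Y) <= s * Z by rewrite ler_wpM2l.
have : (1 - s) * X <= (1 - s) * Z by rewrite ler_wpM2l // subr_ge0.
lra.
Qed.

(** A 0/1 vertex is known from its pattern of ones, so the objective takes finitely many values on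
    vertices; [vertex_below] compares them with all other points. *)
Lemma optimal_vertex_exists x : feasible lp x ->
  exists2 x0 : 'cV[R]_n, vertex lp x0 & optimal lp x0.
Proof.
move=> fx.
have [||x0 v0 min0] := @exists_min_key R _ {ffun 'I_n -> bool} (vertex (R := R) lp)
  (objective lp) (fun x => [ffun j => x j 0 == 1]).
- move=> y z vy vz /ffunP e; congr (objective lp _); apply/colP => j.
  have := e j; rewrite !ffunE; case: zo => _ z01.
  by case: (z01 y vy j) (z01 z vz j) => -> [] -> //; rewrite eqxx eq_sym oner_eq0.
- by have [v vv _] := vertex_below 0 fx; exists v.
exists x0 => //; split; first exact: vertex_feasible.
move=> y fy; have [v vv] := vertex_below (map_mx intr (lpc lp)) fy.
by apply: le_trans; apply: min0.
Qed.

Lemma nonoptimal_steepest x : vertex lp x -> ~ optimal lp x ->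
  exists2 g, steepest_edge lp x g & objective lp g < 0.
Proof.
move=> vx nopt; have fx := vertex_feasible vx.
have [y fy yx] : exists2 y, feasible lp y & objective lp y < objective lp x.
  apply: NNPP => ny; apply: nopt; split=> // y fy.
  by rewrite leNgt; apply/negP => yx; apply: ny; exists y.
apply: (steepest_exists vx (feasible_diff fx fy)).
by rewrite objD objN subr_lt0.
Qed.

(** * Length of steepest-descent paths *)

(** A common weakening of [steepest_edge_step] and of a simplex pivot, so that one length bound
    serves both. *)
Definition descent_step x y :=
  [/\ vertex lp x, vertex lp y, objective lp y < objective lp x &
      exists2 g, steepest_edge lp x g & exists2 a, 0 < a & y = x + a *: g].

Lemma vertex_norm1_le x y : vertex lp x -> vertex lp y -> norm1 (y - x) <= n%:R.
Proof.
move=> vx vy; apply: (@le_trans _ _ (\sum_(j < n) 1)); last by rewrite sumr_const card_ord.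
apply: ler_sum => j _; rewrite !mxE; case: zo => _ z01.
by case: (z01 x vx j) (z01 y vy j) => -> [] ->;
  rewrite ?subrr ?subr0 ?sub0r ?normrN ?normr0 ?normr1.
Qed.

Lemma vertex_norm1_ge x y : vertex lp x -> vertex lp y -> x <> y -> 1 <= norm1 (y - x).
Proof.
move=> vx vy xy; case: zo => _ z01.
have [j xyj] : exists j, x j 0 <> y j 0.
  by apply: NNPP => nj; apply: xy; apply/colP => j; apply: NNPP => h; apply: nj; exists j.
rewrite /norm1 (bigD1 j) //= -[X in X <= _]addr0; apply: lerD.
  rewrite !mxE; move: xyj.
  by case: (z01 x vx j) (z01 y vy j) => -> [] -> // _;
    rewrite ?subr0 ?sub0r ?normrN ?normr1.
by apply: sumr_ge0 => i _; apply: normr_ge0.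
Qed.

Lemma descent_contraction x y x0 : descent_step x y -> vertex lp x0 ->
  n%:R * (objective lp y - objective lp x0) <= n.-1%:R * (objective lp x - objective lp x0).
Proof.
move=> [vx vy cyx [g sg [a a0 yE]]] v0.
have s0 : steepness lp g < 0.
  rewrite /steepness pmulr_llt0 ?invr_gt0 ?norm1_gt0 //; last by case: sg => -[].
  by move: cyx; rewrite yE objD objZ gtrDl pmulr_rlt0.
have h1 : objective lp y - objective lp x <= steepness lp g.
  have -> : objective lp y - objective lp x = steepness lp g * norm1 (y - x).
    rewrite -objN -objD yE addrAC subrr add0r -(steepnessZ lp g a0) /steepness divfK //.
    by rewrite gt_eqF // norm1_gt0 //; have /(edge_scale a0) [] := sg.1.
  have xy : x <> y by move=> e; rewrite e ltxx in cyx.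
  by have := ler_wnM2l (ltW s0) (vertex_norm1_ge vx vy xy); rewrite mulr1.
(* The direction to [x0] lies in the cone and has norm at most n; together with [h1], the step
   closes at least 1/n of the gap. *)
have h2 : steepness lp g * n%:R <= objective lp x0 - objective lp x.
  have := steepest_cone vx sg (feasible_diff (vertex_feasible vx) (vertex_feasible v0)).
  rewrite objD objN; apply: le_trans.
  exact: ler_wnM2l (ltW s0) _ _ (vertex_norm1_le vx v0).
have np : (0 < n)%N.
  rewrite lt0n; apply/eqP => n0; move: cyx; suff -> : x = y by rewrite ltxx.
  by apply/colP => j; have := ltn_ord j; rewrite {2}n0.
have : n%:R * (objective lp y - objective lp x) <= n%:R * steepness lp g.
  by rewrite ler_pM2l ?ltr0n.
have -> : n.-1%:R = n%:R - 1 :> R by rewrite -subn1 natrB.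
move: h2; set X := objective lp x; set Y := objective lp y; set Z := objective lp x0.
by set s := steepness _ _; move: (n%:R : R) => N; lra.
Qed.

Lemma descent_length m (z : nat -> 'cV[R]_n) :
  (forall t, (t < m)%N -> descent_step (z t) (z t.+1)) -> (m <= step_bound n)%N.
Proof.
case: m => // m zS.
have vz t : (t <= m.+1)%N -> vertex lp (z t).
  by case: t => [|t] tm; [have [] := zS 0%N isT | have [] := zS t tm].
have [x0 v0 [_ o0]] := optimal_vertex_exists (vertex_feasible (vz 0%N isT)).
case: zo => _ z01.
pose b (x : 'cV[R]_n) j := x j 0 == 1.
have bE x j : vertex lp x -> (b x j)%:R = x j 0.
  by move=> vx; rewrite /b; case: (z01 x vx j) => ->; rewrite ?eqxx // eq_sym oner_eq0.
have E t : (t <= m.+1)%N ->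
   \sum_j (lpc lp j 0)%:~R * ((b (z t) j)%:R - (b x0 j)%:R) = objective lp (z t) - objective lp x0.
  move=> tm; rewrite -objN -objD /objective dotvE.
  by apply: eq_bigr => j _; rewrite !mxE !bE //; apply: vz.
apply: (@zero_one_contraction R n m.+1 (fun t j => b (z t) j) (fun j => b x0 j)
   (fun j => (lpc lp j 0)%:~R)) => [t tm||t tm]; rewrite !E ?subr_ge0 ?o0 //; try exact: ltnW.
- have [_ vy lt _] := zS t tm; rewrite subr_gt0; apply: le_lt_trans lt.
  by apply: o0; apply: vertex_feasible.
- by apply/vertex_feasible/vz.
- exact: descent_contraction (zS t tm) v0.
Qed.

End ZeroOne.

Lemma chain_nth (V : Type) (E : V -> V -> Prop) (x0 x : V) (p : seq V) t :
  chain E x p -> (t < size p)%N -> E (nth x0 (x :: p) t) (nth x0 p t).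
Proof. by elim: p x t => // y p IH x [|t] [xy yp] //= tp; apply: IH. Qed.

Lemma sub_chain (V : Type) (E F : V -> V -> Prop) (x : V) (p : seq V) :
  (forall x y, E x y -> F x y) -> chain E x p -> chain F x p.
Proof. by move=> EF; elim: p x => //= y p IH x [/EF xy /IH]. Qed.

Section Paths.
Variables (R : realFieldType) (mA mB n : nat) (lp : LP mA mB n).
Hypothesis zo : zero_one_polytope R lp.
Implicit Types (x y z : 'cV[R]_n) (p : seq 'cV[R]_n).

Lemma descent_chain x p : chain (descent_step lp) x p -> (size p <= step_bound n)%N.
Proof.
move=> cp; apply: (descent_length zo (z := nth x (x :: p))) => t tp.
exact: chain_nth cp tp.
Qed.

Lemma steepest_step_descent x y : steepest_edge_step lp x y -> descent_step lp x y.
Proof.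
move=> [[vx vy _ _] lt st]; split=> //; exists (y - x) => //; exists 1 => //.
by rewrite scale1r addrC subrK.
Qed.

Lemma steepest_step_exists x : vertex lp x -> ~ optimal lp x ->
  exists y, steepest_edge_step lp x y.
Proof.
move=> vx nopt; have [g sg cg] := nonoptimal_steepest zo vx nopt.
have [t [j [t0 _ _ _ adj]]] := edge_step zo vx sg.1.
exists (x + t *: g); split=> //; first by rewrite objD objZ gtrDl pmulr_rlt0.
by rewrite addrAC subrr add0r; apply: steepest_scale.
Qed.

Lemma steepest_path x : vertex lp x -> exists p,
  [/\ chain (steepest_edge_step lp) x p, vertex lp (last x p), optimal lp (last x p) &
      (size p <= step_bound n)%N].
Proof.
move=> vx.
(* A greedy path stops at an optimum or reaches any prescribed length; asking for one step more than
   the bound excludes the second case. *)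
suff path k : forall x, vertex lp x -> exists p, [/\ chain (steepest_edge_step lp) x p,
    vertex lp (last x p) & optimal lp (last x p) \/ size p = k].
  have [p [cp vp op]] := path (step_bound n).+1 x vx.
  have sp : (size p <= step_bound n)%N.
    exact: descent_chain (sub_chain steepest_step_descent cp).
  by exists p; split=> //; case: op => // e; rewrite e ltnn in sp.
elim: k => [|k IH] {vx}{}x vx; first by exists [::]; split=> //; right.
case: (classic (optimal lp x)) => [opt|nopt]; first by exists [::]; split=> //; left.
have [y xy] := steepest_step_exists vx nopt; have [[_ vy _ _] _ _] := xy.
have [p [cp vp op]] := IH y vy; exists (y :: p); split=> //=.
by case: op => [|->]; [left | right].
Qed.

End Paths.

(** * Bases of non-degenerate linear programs *)

Section Bases.
Variables (mA mB n : nat) (lp : LP mA mB n).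
Implicit Types (T : {set 'I_mB}).

Definition basis_matrix T : 'M[int]_(mA + #|T|, n) :=
  col_mx (lpA lp) (rowsub (enum_val : 'I_#|T| -> 'I_mB) (lpB lp)).

Lemma map_ratr_intr (R : realFieldType) p q (M : 'M[int]_(p, q)) :
  map_mx (ratr : rat -> R) (map_mx intr M) = map_mx intr M.
Proof. by apply/matrixP => i j; rewrite !mxE ratr_int. Qed.

Lemma basis_matrix_mul (R : realFieldType) T (h : 'cV[R]_n) :
  map_mx intr (basis_matrix T) *m h = 0 <->
  Amul lp h = 0 /\ forall i, i \in T -> Bmul lp h i 0 = 0.
Proof.
rewrite /basis_matrix map_col_mx mul_col_mx -[0]vsubmxK.
have -> : map_mx intr (rowsub enum_val (lpB lp)) *m h =
    rowsub (enum_val : 'I_#|T| -> 'I_mB) (Bmul lp h).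
  by rewrite /Bmul -mul_rowsub_mx map_mxsub.
rewrite !linear0; split=> [/eq_col_mx [A0 B0]|[A0 B0]].
  split=> // i iT; have := congr1 (fun M : 'cV__ => M (enum_rank_in iT i) 0) B0.
  by rewrite !mxE enum_rankK_in.
congr col_mx; first exact: A0.
by apply/colP => k; rewrite mxE B0 ?enum_valP // mxE.
Qed.

(** The rank in [basis] is taken over [rat]; embedding the rationals into [R] preserves it, and full
    rank provides a left inverse. *)
Lemma basis_kernel (R : realFieldType) T (h : 'cV[R]_n) : basis lp T -> Amul lp h = 0 ->
  (forall i, i \in T -> Bmul lp h i 0 = 0) -> h = 0.
Proof.
move=> [_ rk] Ah Bh.
have /row_fullP [C CM] : row_full (map_mx intr (basis_matrix T) : 'M[R]_(_, _)).
  by rewrite -map_ratr_intr /row_full mxrank_map rk.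
have /(congr1 (mulmx C)) := (basis_matrix_mul T h).2 (conj Ah Bh).
by rewrite mulmxA CM mul1mx mulmx0.
Qed.

Lemma kernel_basis (R : realFieldType) T : (mA + #|T|)%N = n ->
  (forall h : 'cV[R]_n, Amul lp h = 0 -> (forall i, i \in T -> Bmul lp h i 0 = 0) -> h = 0) ->
  basis lp T.
Proof.
move=> cT ker; split=> //; rewrite -[LHS](mxrank_map (ratr : rat -> R)) map_ratr_intr.
rewrite -mxrank_tr; apply/eqP/inj_row_free => v v0; apply: trmx_inj; rewrite trmx0.
have [|Ah Bh] := (basis_matrix_mul T v^T).1; last exact: ker.
by rewrite -[map_mx _ _]trmxK -trmx_mul v0 trmx0.
Qed.

Variable (R : realFieldType).
Hypotheses (zo : zero_one_polytope R lp) (nd : nondegenerate_polytope R lp).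
Implicit Types (x y g h : 'cV[R]_n).

Definition basic_feasible T x := [/\ basis lp T, basic_solution lp T x & feasible lp x].

Lemma basic_tight T x : basic_feasible T x -> T \subset tight lp x.
Proof. by move=> [_ [_ bx] _]; apply/subsetP => i /bx e; apply/tightP. Qed.

Lemma basic_vertex T x : basic_feasible T x -> vertex lp x.
Proof.
move=> bx; have [bT _ fx] := bx; apply: kernel_vertex => // h Ah Bh.
by apply: (basis_kernel bT) => // i iT; apply/Bh/(subsetP (basic_tight bx)).
Qed.

(** Non-degeneracy enters here: a basis contained in the tight set has the same cardinality, so
    vertices and feasible bases correspond one to one. *)
Lemma basic_tightE T x : basic_feasible T x -> tight lp x = T.
Proof.
move=> bx; apply/esym/eqP; rewrite eqEcard basic_tight //=.
have [[cT _] _ _] := bx; have := nd (basic_vertex bx).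
by rewrite -{2}cT => /addnI ->.
Qed.

Lemma vertex_basic x : vertex lp x -> basic_feasible (tight lp x) x.
Proof.
move=> vx; have fx := vertex_feasible vx; split=> //.
  by apply: (@kernel_basis R) (nd vx) _ => h; apply: vertex_kernel.
by split=> [|i /tightP]; first by case: fx.
Qed.

Lemma basic_unique T x y : basis lp T -> basic_solution lp T x -> basic_solution lp T y ->
  x = y.
Proof.
move=> bT [Ax Bx] [Ay By]; apply/eqP; rewrite -subr_eq0; apply/eqP.
apply: (basis_kernel bT); first by rewrite AmulD AmulN Ax Ay subrr.
by move=> i iT; rewrite BmulD BmulN Bx ?By ?subrr.
Qed.

(** At a non-degenerate vertex the feasible cone is simplicial; these are its rays, indexed by the
    inequality that is left. *)
Definition basis_direction T i g :=
  [/\ i \in T, Amul lp g = 0, Bmul lp g i 0 < 0 &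
      forall k, k \in T -> k != i -> Bmul lp g k 0 = 0].

(** On the rows of [T] other than [i] both summands are nonpositive with sum 0, hence vanish, so row
    [i] alone determines them. *)
Lemma basis_direction_edge T x i g : basic_feasible T x -> basis_direction T i g ->
  edge_direction lp x g.
Proof.
move=> bx [iT Ag gi gk]; have tx := basic_tightE bx; have [bT _ _] := bx.
split.
- by move=> g0; move: gi; rewrite g0 -(scale0r (0 : 'cV[R]_n)) BmulZ mul0r ltxx.
- split=> // k; rewrite tx => kT; case: (eqVneq k i) => [->|ki]; first exact: ltW.
  by rewrite (gk k kT ki).
move=> u v [Au Bu] [Av Bv] uv; exists (Bmul lp u i 0 / Bmul lp g i 0).
  by apply: mulr_le0; [apply: Bu; rewrite tx | rewrite invr_le0 ltW].
apply/eqP; rewrite -subr_eq0; apply/eqP; apply: (basis_kernel bT).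
  by rewrite AmulD AmulN AmulZ Au Ag scaler0 subrr.
move=> k kT; rewrite BmulD BmulN BmulZ; case: (eqVneq k i) => [->|ki].
  by rewrite divfK ?lt_eqF // subrr.
rewrite (gk k kT ki) mulr0 subr0; move: (gk k kT ki); rewrite -uv BmulD.
by have := Bu k; have := Bv k; rewrite tx kT => /(_ isT) h1 /(_ isT) h2; lra.
Qed.

Lemma basis_direction_unique T i g h : basis lp T ->
  basis_direction T i g -> basis_direction T i h -> exists2 a, 0 < a & h = a *: g.
Proof.
move=> bT [iT Ag gi gk] [_ Ah hi hk]; exists (Bmul lp h i 0 / Bmul lp g i 0).
  by rewrite nmulr_rgt0 // invr_lt0.
apply/eqP; rewrite -subr_eq0; apply/eqP; apply: (basis_kernel bT).
  by rewrite AmulD AmulN AmulZ Ah Ag scaler0 subrr.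
move=> k kT; rewrite BmulD BmulN BmulZ; case: (eqVneq k i) => [->|ki].
  by rewrite divfK ?lt_eqF // subrr.
by rewrite (gk k kT ki) (hk k kT ki) mulr0 subrr.
Qed.

Lemma basis_direction_scale T i g a : 0 < a -> basis_direction T i g ->
  basis_direction T i (a *: g).
Proof.
move=> a0 [iT Ag gi gk]; split=> //; first by rewrite AmulZ Ag scaler0.
  by rewrite BmulZ pmulr_rlt0.
by move=> k kT ki; rewrite BmulZ (gk k kT ki) mulr0.
Qed.

(** Some row [i] is strictly decreased by [g]. The ray leaving [i], scaled to agree with [g] there,
    can be subtracted within the cone, and extremality makes it parallel to [g]. *)
Lemma edge_basis_direction T x g : basic_feasible T x ->
  (forall i, i \in T -> exists h, basis_direction T i h) ->
  edge_direction lp x g -> exists i, basis_direction T i g.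
Proof.
move=> bx ex [g0 [Ag Bg] gex]; have tx := basic_tightE bx; have [bT _ _] := bx.
have [i iT gi] : exists2 i, i \in T & Bmul lp g i 0 < 0.
  apply: NNPP => ni; apply: g0; apply: (basis_kernel bT) => // i iT.
  apply/eqP; rewrite eq_le Bg ?tx //= leNgt; apply/negP => gi; apply: ni; by exists i.
have [h0 h0d] := ex i iT; have [_ _ h0i _] := h0d.
pose h := (Bmul lp g i 0 / Bmul lp h0 i 0) *: h0.
have hd : basis_direction T i h.
  by apply: basis_direction_scale => //; rewrite nmulr_rgt0 // invr_lt0.
have hi : Bmul lp h i 0 = Bmul lp g i 0 by rewrite BmulZ divfK ?lt_eqF.
have [_ Ah _ hk] := hd.
have [|||a a0 e] := gex h (g - h).
- by have [] := basis_direction_edge bx hd.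
- split=> [|k]; first by rewrite AmulD AmulN Ag Ah subrr.
  rewrite tx => kT; rewrite BmulD BmulN; case: (eqVneq k i) => [->|ki].
    by rewrite hi subrr.
  by rewrite (hk k kT ki) subr0 Bg // tx.
- by rewrite addrC subrK.
have a_neq0 : a != 0.
  by apply/eqP => a00; move: gi; rewrite -hi e a00 BmulZ mul0r ltxx.
exists i; have -> : g = a^-1 *: h by rewrite e scalerA mulVf // scale1r.
by apply: basis_direction_scale => //; rewrite invr_gt0 lt_def a_neq0.
Qed.

(* An edge of a 0/1 polytope is a 0/±1 vector, so the signs of g determine the
   vertex at the other end of the edge leaving x in the direction g. *)
Definition next_vertex x g : 'cV[R]_n :=
  \col_j (if 0 < g j 0 then 1 else if g j 0 < 0 then 0 else x j 0).

(** Both ends of the step are 0/1, so a coordinate that increases ends at 1 and one that decreases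
    ends at 0. *)
Lemma next_vertexE x g t : vertex lp x -> 0 < t -> vertex lp (x + t *: g) ->
  x + t *: g = next_vertex x g.
Proof.
move=> vx t0 vy; apply/colP => j; case: zo => _ z01.
have := z01 _ vy j; rewrite !mxE.
have [gj|gj|->] := ltgtP (g j 0) 0; last by rewrite mulr0 addr0.
  have : t * g j 0 < 0 by rewrite pmulr_rlt0.
  by case: (z01 x vx j) => ->; move: (t * _) => s; lra.
have : 0 < t * g j 0 by rewrite pmulr_rgt0.
by case: (z01 x vx j) => ->; move: (t * _) => s; lra.
Qed.

(** Every blocking inequality [j'] is tight at the new vertex, together with the rest of [T], and
    non-degeneracy leaves room for just these. So the ratio test has no real ties. *)
Lemma pivot_step T x i g : basic_feasible T x -> basis_direction T i g ->
  exists j, [/\ basic_feasible (tight lp (next_vertex x g)) (next_vertex x g),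
    (exists2 t, 0 < t & next_vertex x g = x + t *: g),
    0 < Bmul lp g j 0,
    forall k, 0 < Bmul lp g k 0 -> slack lp x j / Bmul lp g j 0 <= slack lp x k / Bmul lp g k 0 &
    forall j', 0 < Bmul lp g j' 0 ->
      slack lp x j' / Bmul lp g j' 0 <= slack lp x j / Bmul lp g j 0 ->
      tight lp (next_vertex x g) = j' |: (T :\ i)].
Proof.
move=> bx gd; have eg := basis_direction_edge bx gd; have vx := basic_vertex bx.
have [t [j [t0 [gj tE] tmin yj adj]]] := edge_step zo vx eg.
have vy : vertex lp (x + t *: g) by case: adj.
rewrite -(next_vertexE vx t0 vy); exists j; split=> //; rewrite -?tE //.
- exact: vertex_basic.
- by exists t.
move=> j' gj' j't; apply/esym/eqP; rewrite eqEcard; apply/andP; split.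
  apply/subsetP => k; rewrite !inE => /orP[/eqP->|/andP[ki kT]].
    have {j't}e : slack lp x j' / Bmul lp g j' 0 = t by apply/eqP; rewrite eq_le j't tmin.
    by rewrite BmulD BmulZ -e (divfK (lt0r_neq0 gj')) /slack addrC subrK.
  case: gd => _ _ _ gk; rewrite BmulD BmulZ (gk k kT ki) mulr0 addr0.
  by case: bx => _ [_ /(_ k kT) ->].
case: gd => iT _ gi gk; have j'T : j' \notin T.
  apply/negP => jT; move: gj'; case: (eqVneq j' i) => [->|ji].
    by rewrite ltNge ltW.
  by rewrite (gk j' jT ji) ltxx.
have [[cT _] _ _] := bx.
have /addnI -> : (mA + #|tight lp (x + t *: g)| = mA + #|T|)%N by rewrite (nd vy) cT.
rewrite cardsU1 !inE (negPf j'T) andbF /=.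
by rewrite (cardsD1 i T) iT.
Qed.

(** The entering inequality disappears: the new basis is the tight set of a vertex computed from
    signs alone. *)
Lemma pivotP T T' x : basic_feasible T x ->
  steepest_descent_pivot R lp T T' <->
  exists i g, [/\ basis_direction T i g, steepest_edge lp x g, objective lp g < 0 &
    T' = tight lp (next_vertex x g)].
Proof.
move=> bx; split.
  move=> [x' [g [i [j [[bx' fx'] gd [sg cg] [gj jmin] ->]]]]].
  have [bT bx0 _] := bx; have {bx'}ex := basic_unique bT bx' bx0; rewrite {}ex in fx' sg jmin *.
  exists i, g; split=> //; have [j0 [_ _ gj0 _ j0U]] := pivot_step bx gd.
  by rewrite -(j0U j) //; apply: jmin.
move=> [i [g [gd sg cg ->]]]; have [j [_ _ gj jmin jU]] := pivot_step bx gd.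
have [_ bx0 fx] := bx; exists x, g, i, j; split=> //.
by apply: jU.
Qed.

Lemma pivot_descent T T' x : basic_feasible T x -> steepest_descent_pivot R lp T T' ->
  exists2 y, basic_feasible T' y & descent_step lp x y.
Proof.
move=> bx /(pivotP _ bx) [i [g [gd sg cg ->]]].
have [j [by' [t t0 yE] _ _ _]] := pivot_step bx gd.
exists (next_vertex x g) => //; split; first exact: basic_vertex bx.
- exact: basic_vertex by'.
- by rewrite yE objD objZ gtrDl pmulr_rlt0.
by exists g => //; exists t.
Qed.

Lemma pivot_chain T p x : basic_feasible T x -> chain (steepest_descent_pivot R lp) T p ->
  exists y, basic_feasible (last T p) y /\
    exists2 q, size q = size p & chain (descent_step lp) x q.
Proof.
elim: p T x => [|T' p IH] T x bx /=; first by move=> _; exists x; split=> //; exists [::].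
move=> [TT' cp]; have [y by' xy] := pivot_descent bx TT'.
have [z [bz [q sq cq]]] := IH T' y by' cp.
by exists z; split=> //; exists (y :: q); rewrite /= ?sq.
Qed.

Lemma pivot_chain_length T p x : basic_feasible T x ->
  chain (steepest_descent_pivot R lp) T p -> (size p <= step_bound n)%N.
Proof.
by move=> bx cp; have [y [_ [q <- cq]]] := pivot_chain bx cp; apply: descent_chain cq.
Qed.

Lemma no_pivot_optimal T x : basic_feasible T x ->
  (forall i, i \in T -> exists h : 'cV[R]_n, basis_direction T i h) ->
  (forall T', ~ steepest_descent_pivot R lp T T') -> optimal lp x.
Proof.
move=> bx ex np; apply: NNPP => nopt.
have [g sg cg] := nonoptimal_steepest zo (basic_vertex bx) nopt.
have [i gd] := edge_basis_direction bx ex sg.1.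
apply: (np (tight lp (next_vertex x g))); apply/(pivotP _ bx).
by exists i, g.
Qed.

End Bases.

(** * The Faddeev-LeVerrier recursion *)

Section FaddeevLeVerrier.
Variables (R : comNzRingType) (n : nat) (N : 'M[R]_n).

Lemma deriv_prod (I : finType) (F : I -> {poly R}) :
  (\prod_i F i)^`() = \sum_i (F i)^`() * \prod_(j | i != j) F j.
Proof.
have E (s : seq I) : uniq s -> (\prod_(i <- s) F i)^`() =
    \sum_(i <- s) (F i)^`() * \prod_(j <- s | i != j) F j.
  elim: s => [|i s IH] /=; first by rewrite !big_nil derivC.
  move=> /andP[si us]; rewrite !big_cons derivM IH // eqxx /=; congr (_ * _ + _).
    rewrite big_seq_cond [RHS]big_seq_cond; apply: eq_bigl => j.
    by rewrite andbT; case: (boolP (j \in s)) => //= js; apply/esym; apply: contraNneq si => ->.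
  rewrite mulr_sumr big_seq [RHS]big_seq; apply: eq_bigr => j js.
  rewrite big_cons ifT; first by rewrite mulrCA.
  by apply: contraNneq si => <-.
by have := E (index_enum I) (index_enum_uniq I).
Qed.

(** Jacobi's formula. In each Leibniz term the factor of index [i] has derivative 1 if [s] fixes [i]
    and 0 otherwise, and what remains expands a principal cofactor. *)
Lemma trace_adj_char_poly (A : 'M[R]_n) : \tr (\adj (char_poly_mx A)) = (char_poly A)^`().
Proof.
rewrite /char_poly /mxtrace /determinant linear_sum /=.
transitivity (\sum_i \sum_(s : 'S_n | s i == i)
   (-1) ^+ s * \prod_(k | i != k) char_poly_mx A k (s k)).
  by apply: eq_bigr => i _; rewrite mxE expand_cofactor.
have E (s : 'S_n) : ((-1) ^+ s * \prod_i char_poly_mx A i (s i))^`() =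
    \sum_(i | s i == i) (-1) ^+ s * \prod_(k | i != k) char_poly_mx A k (s k).
  have sC : ((-1) ^+ s : {poly R}) = ((-1) ^+ s)%:P by rewrite rmorphXn rmorphN1.
  rewrite sC mul_polyC derivZ -mul_polyC -sC deriv_prod mulr_sumr [RHS]big_mkcond.
  apply: eq_bigr => i _; rewrite !mxE derivB derivC subr0 derivMn derivX.
  by rewrite [i == _]eq_sym; case: eqP => // _; rewrite ?mul1r // mul0r mulr0.
under [RHS]eq_bigr do rewrite E.
by rewrite (exchange_big_dep xpredT).
Qed.

(* [fl_mx k] and [fl_coef k] are the coefficients of degree [n - k] of the adjugate
   and of the determinant of [X + N]. *)
Definition fl_mx k : 'M[R]_n := \matrix_(i, j) (\adj (char_poly_mx (- N)) i j)`_(n - k).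
Definition fl_coef k : R := (char_poly (- N))`_(n - k).

Let cmx (P : 'M[{poly R}]_n) k : 'M[R]_n := \matrix_(i, j) (P i j)`_k.

(** The coefficient of degree [k] in the two products of a matrix with its adjugate. The adjugate is
    passed through an equation so that it remains folded. *)
Lemma adj_coef (X : 'M[{poly R}]_n) k : X = \adj (char_poly_mx (- N)) ->
  (if k is k'.+1 then cmx X k' else 0) + N *m cmx X k = ((char_poly (- N))`_k)%:M /\
  (if k is k'.+1 then cmx X k' else 0) + cmx X k *m N = ((char_poly (- N))`_k)%:M.
Proof.
move=> XE.
have E : char_poly_mx (- N) = 'X%:M + map_mx polyC N.
  by rewrite /char_poly_mx; congr (_ + _); apply/matrixP => i j; rewrite !mxE rmorphN opprK.
have /(congr1 (fun P => cmx P k)) := mul_mx_adj (char_poly_mx (- N)).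
have /(congr1 (fun P => cmx P k)) := mul_adj_mx (char_poly_mx (- N)).
rewrite -XE -/(char_poly _) E mulmxDl mulmxDr mul_scalar_mx mul_mx_scalar.
move=> h1 h2; split; [move: h2 {h1} | move: h1 {h2}] => h.
  transitivity (cmx (char_poly (- N))%:M k); last first.
    by apply/matrixP => i j; rewrite !mxE coefMn.
  rewrite -h; apply/matrixP => i j; rewrite !mxE coefD coef_sum coefXM; congr (_ + _).
    by case: k {h} => [|k]; rewrite mxE.
  by apply: eq_bigr => l _; rewrite !mxE coefCM.
transitivity (cmx (char_poly (- N))%:M k); last first.
  by apply/matrixP => i j; rewrite !mxE coefMn.
rewrite -h; apply/matrixP => i j; rewrite !mxE coefD coef_sum coefXM; congr (_ + _).
  by case: k {h} => [|k]; rewrite mxE.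
by apply: eq_bigr => l _; rewrite !mxE coefMC.
Qed.

(** Downward induction from a degree beyond every entry: in degrees above n the characteristic
    polynomial has no coefficient, so [adj_coef] expresses each coefficient by the next one. *)
Lemma adj_coef_ge k : (n <= k)%N -> cmx (\adj (char_poly_mx (- N))) k = 0.
Proof.
set X := \adj _ => nk.
have [d dX] : exists d, forall k, (d <= k)%N -> cmx X k = 0.
  exists (\max_i \max_j size (X i j))%N => l dl; apply/matrixP => i j.
  rewrite [LHS]mxE [RHS]mxE.
  apply: nth_default; apply: leq_trans dl.
  apply: leq_trans (@leq_bigmax _ (fun i => \max_j size (X i j))%N i).
  exact: (@leq_bigmax _ (fun j => size (X i j)) j).
suff H e : forall k, (n <= k)%N -> (d - k <= e)%N -> cmx X k = 0 by apply: (H _ k nk (leqnn _)).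
elim: e => [|e IH] {nk}{}k nk; first by rewrite leqn0 subn_eq0; apply: dX.
move=> dk; have kS : cmx X k.+1 = 0 by apply: IH; move: nk dk; lia.
have [] := @adj_coef X k.+1 erefl; rewrite kS mulmx0 mul0mx !addr0.
move=> -> _; rewrite nth_default ?size_char_poly //.
by apply/matrixP => i j; rewrite !mxE mul0rn.
Qed.

Lemma fl_mx0 : fl_mx 0 = 0.
Proof. by rewrite /fl_mx subn0; apply: adj_coef_ge. Qed.

Lemma fl_coef0 : fl_coef 0 = 1.
Proof.
have := char_poly_monic (- N); rewrite monicE /lead_coef size_char_poly /fl_coef subn0.
by move/eqP.
Qed.

Lemma fl_mxS k : (k < n)%N -> fl_mx k.+1 = (fl_coef k)%:M - N *m fl_mx k.
Proof.
move=> kn; have e : (n - k = (n - k.+1).+1)%N by rewrite subnSK.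
have [h _] := @adj_coef _ (n - k.+1).+1 erefl; rewrite -e in h.
exact: (canRL (addrK _) h).
Qed.

(** The trace of the coefficient identity. The scalar matrix contributes n times the coefficient
    and, by Jacobi's formula, the adjugate takes away n-k-1 times. Working with [- N] avoids
    alternating signs. *)
Lemma fl_coefS k : (k < n)%N -> \tr (N *m fl_mx k.+1) = (fl_coef k.+1) *+ k.+1.
Proof.
move=> kn; have [/(congr1 mxtrace)+ _] := @adj_coef _ (n - k.+1) erefl.
rewrite mxtraceD mxtrace_scalar -/(fl_coef k.+1) -/(fl_mx k.+1) => h.
have {h}-> : \tr (N *m fl_mx k.+1) = fl_coef k.+1 *+ n -
    \tr (if (n - k.+1)%N is k'.+1 then cmx (\adj (char_poly_mx (- N))) k' else 0).
  by rewrite -h [X in X - _]addrC addrK.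
have -> : \tr (if (n - k.+1)%N is k'.+1 then cmx (\adj (char_poly_mx (- N))) k' else 0)
    = fl_coef k.+1 *+ (n - k.+1).
  rewrite /fl_coef; case: (n - k.+1)%N => [|m]; first by rewrite mxtrace0.
  rewrite -coef_deriv -trace_adj_char_poly /mxtrace coef_sum.
  by apply: eq_bigr => i _; rewrite mxE.
by rewrite -mulrnBr ?leq_subr // subKn.
Qed.

Lemma fl_inverse : N *m fl_mx n = (fl_coef n)%:M /\ fl_mx n *m N = (fl_coef n)%:M.
Proof.
have [] := @adj_coef _ 0 erefl; rewrite !add0r /fl_mx /fl_coef !subnn; by split.
Qed.

Lemma fl_det : fl_coef n = \det N.
Proof.
rewrite /fl_coef subnn char_poly_det -scaleN1r detZ mulrA -expr2 -exprM mulnC exprM.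
by rewrite sqrrN expr1n expr1n mul1r.
Qed.

End FaddeevLeVerrier.

(** * Size of the integers in the recursion *)

Section FLBounds.
Variables (n : nat) (N : 'M[int]_n) (B : nat).
Hypothesis NB : forall i j, (`|N i j| <= B)%N.

(** One round doubles a bound, multiplies it by nB in the product with [N] and by n in the trace;
    the successor keeps the rate positive. *)
Definition fl_rate : nat := (2 * n * n * B).+1.

Let absD (a b : int) : (`|(a + b)%R| <= `|a| + `|b|)%N.
Proof. by rewrite -lez_nat PoszD !abszE ler_normD. Qed.

Lemma absz_sum (I : finType) (F : I -> int) (C : nat) :
  (forall i, (`|F i| <= C)%N) -> (`|(\sum_i F i)%R| <= #|I| * C)%N.
Proof.
move=> FC; apply: leq_trans (_ : \sum_(i : I) C <= _)%N; last by rewrite sum_nat_const.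
elim/big_ind2: _ => // a b c d ab cd; apply: leq_trans (absD _ _) _; exact: leq_add.
Qed.

Lemma fl_bounds k : (k <= n)%N ->
  [/\ forall i j, (`|(N *m fl_mx N k) i j| <= fl_rate ^ k)%N,
      (`|fl_coef N k| <= fl_rate ^ k)%N &
      forall i j, (`|fl_mx N k i j| <= 2 * fl_rate ^ k)%N].
Proof.
elim: k => [|k IH] kn.
  by rewrite fl_coef0 fl_mx0 mulmx0; split=> // i j; rewrite mxE.
have [P_le c_le _] := IH (ltnW kn); set Y := (fl_rate ^ k)%N in P_le c_le.
have M_le i j : (`|fl_mx N k.+1 i j| <= 2 * Y)%N.
  rewrite fl_mxS // mxE [X in X + _]mxE [X in _ + X]mxE.
  apply: leq_trans (absD _ _) _; rewrite abszN mul2n -addnn leq_add //.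
  by case: eqP => _; rewrite ?mulr1n ?mulr0n.
have P'_le i j : (`|(N *m fl_mx N k.+1) i j| <= n * (B * (2 * Y)))%N.
  rewrite mxE; have := @absz_sum _ (fun l => N i l * fl_mx N k.+1 l j) (B * (2 * Y))%N.
  by rewrite card_ord; apply=> l; rewrite abszM leq_mul.
have n0 : (0 < n)%N by apply: leq_trans kn.
have Y0 : (0 < Y)%N by rewrite expn_gt0.
have rateY : (n * (n * (B * (2 * Y))) <= fl_rate ^ k.+1)%N.
  by rewrite expnS -/Y /fl_rate; nia.
have YY : (Y <= fl_rate ^ k.+1)%N by rewrite expnS leq_pmull.
split.
- by move=> i j; apply: leq_trans (P'_le i j) _; apply: leq_trans rateY; rewrite leq_pmull.
- apply: leq_trans rateY; have /(congr1 absz) := fl_coefS N kn.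
  rewrite -mulr_natr abszM natz absz_nat => h.
  (* The exact division by k+1 can only make the trace smaller. *)
  apply: leq_trans (_ : `|fl_coef N k.+1| * k.+1 <= _)%N; first by rewrite leq_pmulr.
  rewrite -h; have := @absz_sum _ (fun i => (N *m fl_mx N k.+1) i i) _ (fun i => P'_le i i).
  by rewrite card_ord.
by move=> i j; apply: leq_trans (M_le i j) _; rewrite leq_mul2l YY orbT.
Qed.

End FLBounds.

(** * Bit sizes *)

(** Lowest terms only shrink both parts: the reduced denominator divides [b], and
    cross-multiplication then bounds the numerator. *)
Lemma rat_bits_frac (a b : int) : b != 0 ->
  (rat_bits (a%:~R / b%:~R) <= nat_bits `|a| + nat_bits `|b|)%N.
Proof.
move=> b0; set q : rat := _ / _.
have E : numq q * b = a * denq q.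
  apply: (@intr_inj rat); rewrite !intrM numqE mulrAC /q divfK // intr_eq0 //.
have cop := coprime_num_den q.
have E' : (`|numq q| * `|b| = `|a| * `|denq q|)%N by rewrite -!abszM E.
have bpos : (0 < `|b|)%N by rewrite absz_gt0.
have db : (`|denq q| %| `|b|)%N.
  have : (`|denq q| %| `|numq q| * `|b|)%N by rewrite E' dvdn_mull.
  by rewrite Gauss_dvdr // coprime_sym.
apply: leq_add; apply: nat_bits_le; last exact: dvdn_leq.
have dpos : (0 < `|denq q|)%N by rewrite absz_gt0 denq_neq0.
have h := dvdn_leq bpos db; rewrite -(leq_pmul2r bpos) E'.
by rewrite leq_mul2l h orbT.
Qed.

Lemma rat_bits_int (a : int) : (rat_bits a%:~R <= nat_bits `|a| + 1)%N.
Proof. by have := @rat_bits_frac a 1 isT; rewrite divr1. Qed.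

(** * Rules for loops *)

Section Rules.
Variables S V : nat.

(** Read off the syntax, this spares every assertion the list of what a program leaves unchanged. *)
Definition frame (p : hprog) (s t : hstate) : Prop :=
  [/\ forall v, v \notin modv p -> hv t v = hv s v,
      forall a, a \notin moda p -> hm t a = hm s a &
      choice_free p -> hc t = hc s].

Lemma frame_hsem p s : frame p s (hsem p s).
Proof.
by split=> *; [apply: hsem_modv | apply: hsem_moda | apply: hsem_choice].
Qed.

(** The semantics being a function, a triple is about one start state; it includes the safety
    condition [hok]. *)
Definition hoare (p : hprog) (s : hstate) (Q : hstate -> Prop) : Prop :=
  hok S V p s /\ (frame p s (hsem p s) -> Q (hsem p s)).

Lemma hoare_ok p s Q : hoare p s Q -> hok S V p s. Proof. by case. Qed.
Lemma hoare_post p s Q : hoare p s Q -> Q (hsem p s).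
Proof. by case=> _; apply; apply: frame_hsem. Qed.

Lemma hoare_seq p q s (Q Q' : hstate -> Prop) : hoare p s Q ->
  (forall t, frame p s t -> Q t -> hoare q t Q') -> hoare (HSeq p q) s Q'.
Proof.
move=> hp hq; have := hq (hsem p s) (frame_hsem p s) (hoare_post hp) => h.
by split=> [|_] /=; [split; [apply: hoare_ok hp | apply: hoare_ok h] | apply: hoare_post h].
Qed.

Lemma hoare_weaken p s (Q Q' : hstate -> Prop) : hoare p s Q ->
  (forall t, frame p s t -> Q t -> Q' t) -> hoare p s Q'.
Proof. by move=> hp QQ; split=> [|f]; [case: hp | apply: QQ f (hoare_post hp)]. Qed.

Lemma hoare_for q v w s (I : nat -> hstate -> Prop) :
  I 0%N (hsetv s v 0) ->
  (forall k t, (k < hv s w)%N -> hv t v = k -> frame (HFor v w q) s t -> I k t ->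
     hoare q t (fun t' => I k.+1 (hsetv t' v k.+1))) ->
  hoare (HFor v w q) s (I (hv s w)).
Proof.
move=> I0 IS; set it := fun k => iteri k (fun k t => hsetv (hsem q t) v k.+1) (hsetv s v 0).
have fr k : frame (HFor v w q) s (it k).
  elim: k => [|k [f1 f2 f3]]; split=> //=.
  - by move=> u; rewrite inE negb_or /upd => /andP[/negPf ->].
  - move=> u uq; have := uq; rewrite /= inE negb_or /upd => /andP[/negPf -> u'].
    by rewrite hsem_modv // f1.
  - by move=> a aq; rewrite hsem_moda // f2.
  - by move=> c; rewrite hsem_choice // f3.
have vk k : hv (it k) v = k by case: k => [|k] /=; rewrite /upd eqxx.
have inv k : (k <= hv s w)%N -> I k (it k).
  elim: k => [|k IH] kw //; have := IS k (it k) kw (vk k) (fr k) (IH (ltnW kw)).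
  exact: hoare_post.
split=> [|_] /=; last exact: inv (leqnn _).
move=> k kw; exact: hoare_ok (IS k (it k) kw (vk k) (fr k) (inv k (ltnW kw))).
Qed.

(** [Val] does not depend on the round, so overlapping writes agree and no invariant is left to the
    caller. *)
Lemma hoare_fill q v w s Z (D : nat -> nat -> nat -> bool) (Val : nat -> nat -> rat) :
  (forall k t, (k < hv s w)%N -> hv t v = k -> frame (HFor v w q) s t ->
     hoare q t (fun t' => forall i j,
       hm t' Z i j = if D k i j then Val i j else hm t Z i j)) ->
  hoare (HFor v w q) s (fun t => forall i j,
    hm t Z i j = if has (fun k => D k i j) (iota 0 (hv s w)) then Val i j else hm s Z i j).
Proof.
move=> body.
apply: (@hoare_for q v w s (fun k t => forall i j,
  hm t Z i j = if has (fun k => D k i j) (iota 0 k) then Val i j else hm s Z i j)) => //.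
move=> k t kw tv tf tI; apply: hoare_weaken (body k t kw tv tf) _ => t' _ h i j.
transitivity (hm t' Z i j) => //; rewrite h tI -addn1 iotaD has_cat add0n /= orbF.
by case: (D k i j); rewrite ?orbT ?orbF.
Qed.

Lemma has_iota_row (N i : nat) (b : bool) : has (fun k => (i == k) && b) (iota 0 N) = (i < N)%N && b.
Proof.
apply/hasP/andP => [[k]|[iN bT]]; rewrite ?mem_iota /= ?add0n.
  by move=> kN /andP[/eqP-> ->].
by exists i; rewrite ?mem_iota //= eqxx.
Qed.

Lemma has_iota_col (N j : nat) (b : bool) : has (fun k => b && (j == k)) (iota 0 N) = b && (j < N)%N.
Proof. by rewrite andbC -has_iota_row; apply: eq_has => k; rewrite andbC. Qed.

(** [frame] speaks of whole arrays, so the cells of the array [c.1.1] other than [c] need the second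
    clause. *)
Lemma hoare_acc q v w s c (F : nat -> rat) :
  v != c.1.2 -> v != c.2 -> c.1.2 \notin modv q -> c.2 \notin modv q ->
  (forall k t, (k < hv s w)%N -> hv t v = k -> frame (HFor v w q) s t ->
     hget t c = hget s c + \sum_(l < k) F l ->
     (forall i j, ~~ ((i == hv s c.1.2) && (j == hv s c.2)) -> hm t c.1.1 i j = hm s c.1.1 i j) ->
     hoare q t (fun t' => hget t' c = hget t c + F k /\
       forall i j, ~~ ((i == hv s c.1.2) && (j == hv s c.2)) -> hm t' c.1.1 i j = hm t c.1.1 i j)) ->
  hoare (HFor v w q) s (fun t => hget t c = hget s c + \sum_(l < hv s w) F l /\
    forall i j, ~~ ((i == hv s c.1.2) && (j == hv s c.2)) -> hm t c.1.1 i j = hm s c.1.1 i j).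
Proof.
move=> vc1 vc2 c1q c2q body.
apply: (@hoare_for q v w s (fun k t => hget t c = hget s c + \sum_(l < k) F l /\
    forall i j, ~~ ((i == hv s c.1.2) && (j == hv s c.2)) -> hm t c.1.1 i j = hm s c.1.1 i j)).
  rewrite big_ord0 addr0; split=> //.
  by rewrite /hget /= /upd ![_ == v]eq_sym (negPf vc1) (negPf vc2).
move=> k t kw tv tf [tI to]; apply: hoare_weaken (body k t kw tv tf tI to) _.
move=> t' [f1 _ _] [h1 h2]; split.
  rewrite big_ord_recr /= addrA -tI -h1 /hget /= /upd ![_ == v]eq_sym.
  by rewrite (negPf vc1) (negPf vc2).
by move=> i j ij /=; rewrite h2 // to.
Qed.

Lemma hoare_rat c q s (Q : hstate -> Prop) :
  (rat_bits q <= S)%N -> Q (hsetm s c q) -> hoare (HRat c q) s Q.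
Proof. by split. Qed.

Lemma hoare_op o c d e s (Q : hstate -> Prop) :
  (rat_bits (rop_fun o (hget s d) (hget s e)) <= S)%N ->
  Q (hsetm s c (rop_fun o (hget s d) (hget s e))) -> hoare (HOp o c d e) s Q.
Proof. by split. Qed.

Lemma hoare_skip s (Q : hstate -> Prop) : Q s -> hoare HSkip s Q.
Proof. by split. Qed.

Lemma hoare_nat v c s (Q : hstate -> Prop) :
  (c <= V)%N -> Q (hsetv s v c) -> hoare (HNat v c) s Q.
Proof. by split. Qed.

Lemma hoare_int o v w u s (Q : hstate -> Prop) :
  (iop_fun o (hv s w) (hv s u) <= V)%N ->
  Q (hsetv s v (iop_fun o (hv s w) (hv s u))) -> hoare (HInt o v w u) s Q.
Proof. by split. Qed.

Lemma hoare_iflt v w p q s (Q : hstate -> Prop) :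
  ((hv s v < hv s w)%N -> hoare p s Q) -> ((hv s w <= hv s v)%N -> hoare q s Q) ->
  hoare (HIfLt v w p q) s Q.
Proof.
move=> hp hq; have [lt|le] := ltnP (hv s v) (hv s w).
  by have := hp lt; split=> [|_] /=; rewrite lt; [apply: hoare_ok H | apply: hoare_post H].
by have := hq le; split=> [|_] /=; rewrite ltnNge le; [apply: hoare_ok H | apply: hoare_post H].
Qed.

Lemma hoare_ifle c d p q s (Q : hstate -> Prop) :
  (hget s c <= hget s d -> hoare p s Q) -> (hget s d < hget s c -> hoare q s Q) ->
  hoare (HIfLe c d p q) s Q.
Proof.
move=> hp hq; have [le|lt] := leP (hget s c) (hget s d).
  by have := hp le; split=> [|_] /=; rewrite le; [apply: hoare_ok H | apply: hoare_post H].
by have := hq lt; split=> [|_] /=; rewrite leNgt lt; [apply: hoare_ok H | apply: hoare_post H].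
Qed.

End Rules.

(** * Integer matrices in the arrays *)

(** Extended by 0 outside the matrix, since arrays are indexed by all naturals. *)
Definition mxf (p q : nat) (M : 'M[int]_(p, q)) (i j : nat) : rat :=
  if insub i is Some i' then if insub j is Some j' then (M i' j')%:~R else 0 else 0.

Lemma mxfE p q (M : 'M[int]_(p, q)) i j : mxf M (i : 'I_p) (j : 'I_q) = (M i j)%:~R.
Proof. by rewrite /mxf !valK. Qed.

Definition holds p q (s : hstate) (a : nat) (M : 'M[int]_(p, q)) :=
  forall i j, (i < p)%N -> (j < q)%N -> hm s a i j = mxf M i j.

Definition bounded_by p q (B : nat) (M : 'M[int]_(p, q)) := forall i j, (`|M i j| <= B)%N.

Lemma mxf_int p q B (M : 'M[int]_(p, q)) i j : bounded_by B M ->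
  exists2 z : int, mxf M i j = z%:~R & (`|z| <= B)%N.
Proof.
move=> MB; rewrite /mxf; case: insub => [i'|]; last by exists 0.
by case: insub => [j'|]; [exists (M i' j') | exists 0].
Qed.

Lemma mxf_mul p q r (X : 'M[int]_(p, q)) (Y : 'M[int]_(q, r)) i j : (i < p)%N -> (j < r)%N ->
  mxf (X *m Y) i j = \sum_(l < q) mxf X i l * mxf Y l j.
Proof.
move=> ip jr; have := mxfE (X *m Y) (Ordinal ip) (Ordinal jr) => /= ->.
rewrite mxE rmorph_sum; apply: eq_bigr => l _; rewrite rmorphM /=.
by have := mxfE X (Ordinal ip) l => /= ->; have := mxfE Y l (Ordinal jr) => /= ->.
Qed.

Lemma abszD_le (a b : int) : (`|(a + b)%R| <= `|a| + `|b|)%N.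
Proof. by rewrite -lez_nat PoszD !abszE ler_normD. Qed.

(** Meant for partial sums: every intermediate value of an accumulation has to fit. *)
Lemma sum_int_bound k (F : nat -> rat) (B : nat) :
  (forall l, (l < k)%N -> exists2 z : int, F l = z%:~R & (`|z| <= B)%N) ->
  exists2 z : int, \sum_(l < k) F l = z%:~R & (`|z| <= k * B)%N.
Proof.
elim: k => [|k IH] FB; first by exists 0; rewrite ?big_ord0.
have [z zE zB] := IH (fun l lk => FB l (ltnW lk)); have [y yE yB] := FB k (ltnSn k).
exists (z + y); first by rewrite big_ord_recr /= zE yE rmorphD.
by apply: leq_trans (abszD_le _ _) _; rewrite mulSn addnC leq_add.
Qed.

Lemma mul_int_bound (a b : rat) (A B : nat) :
  (exists2 z : int, a = z%:~R & (`|z| <= A)%N) -> (exists2 z : int, b = z%:~R & (`|z| <= B)%N) ->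
  exists2 z : int, a * b = z%:~R & (`|z| <= A * B)%N.
Proof.
move=> [x -> xA] [y -> yB]; exists (x * y); first by rewrite rmorphM.
by rewrite abszM leq_mul.
Qed.

Lemma mulmx_bounded p q r A B (X : 'M[int]_(p, q)) (Y : 'M[int]_(q, r)) :
  bounded_by A X -> bounded_by B Y -> bounded_by (q * (A * B)) (X *m Y).
Proof.
move=> XA YB i j; rewrite mxE; apply: leq_trans (_ : \sum_(l < q) A * B <= _)%N; last first.
  by rewrite sum_nat_const card_ord.
elim/big_ind2: _ => [//|a b c d ab cd|l _]; last by rewrite abszM leq_mul.
by apply: leq_trans (abszD_le _ _) _; apply: leq_add.
Qed.

Definition vzero := 6%N.
Definition vi := 9%N.
Definition vj := 10%N.
Definition vl := 11%N.

Definition atmp : cell := (1%N, vzero, vzero).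

Definition matmul (Z X Y p q r : nat) :=
  HFor vi p (HFor vj r (HSeq (HRat (Z, vi, vj) 0)
    (HFor vl q (HSeq (HOp RMul atmp (X, vi, vl) (Y, vl, vj))
                     (HOp RAdd (Z, vi, vj) (Z, vi, vj) atmp))))).

Section Matmul.
Variables S V Zb : nat.
(** [Zb] bounds the numerators and denominators, so [S] bits suffice for any fraction of them. *)
Hypothesis SZ : (nat_bits Zb + nat_bits Zb <= S)%N.

Lemma bits_int (x : rat) B : (exists2 z : int, x = z%:~R & (`|z| <= B)%N) -> (B <= Zb)%N ->
  (rat_bits x <= S)%N.
Proof.
move=> [z -> zB] BZ; apply: leq_trans (rat_bits_int z) _; apply: leq_trans SZ.
by apply: leq_add => //; apply: nat_bits_le; apply: leq_trans BZ.
Qed.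

Lemma bits0 : (rat_bits 0 <= S)%N.
Proof. by apply: (@bits_int _ 0); first by exists 0. Qed.

Lemma hoare_matmul s Z X Y vp vq vr p q r A B (MX : 'M[int]_(p, q)) (MY : 'M[int]_(q, r)) :
  [&& Z != 1%N, Z != X, Z != Y, X != 1%N & Y != 1%N] ->
  all (fun v => v \notin [:: vi; vj; vl]) [:: vp; vq; vr] ->
  hv s vp = p -> hv s vq = q -> hv s vr = r -> hv s vzero = 0%N ->
  holds s X MX -> holds s Y MY -> bounded_by A MX -> bounded_by B MY -> (q * (A * B) <= Zb)%N ->
  hoare S V (matmul Z X Y vp vq vr) s (fun t => holds t Z (MX *m MY)).
Proof.
move=> /and5P[Z1 ZX ZY X1 Y1] /and4P[pv qv rv _] sp sq sr s0 hX hY bX bY AB.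
move: pv qv rv; rewrite !inE !negb_or => /and3P[pi pj pl] /and3P[qi qj ql] /and3P[ri rj rl].
apply: (@hoare_weaken _ _ _ _ (fun t => forall i j,
   hm t Z i j = if has (fun k => (i == k) && (j < r)%N) (iota 0 (hv s vp)) then mxf (MX *m MY) i j
   else hm s Z i j)); last first.
  by move=> t _ h i j ip jr; rewrite h has_iota_row sp ip jr.
apply: hoare_fill => k1 t kp tk1 [tv ta _].
rewrite sp in kp; have tr : hv t vr = r by rewrite tv // !inE !negb_or ri rj rl.
apply: (@hoare_weaken _ _ _ _ (fun t' => forall i j,
   hm t' Z i j = if has (fun k => (i == k1) && (j == k)) (iota 0 (hv t vr))
   then mxf (MX *m MY) i j else hm t Z i j)); last first.
  by move=> t' _ h i j; rewrite h has_iota_col tr.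
apply: hoare_fill => k2 t2 kr tk2 [t2v t2a _]; rewrite tr in kr.
have t2i : hv t2 vi = k1 by rewrite t2v.
have t2q : hv t2 vq = q by rewrite t2v ?tv // !inE !negb_or ?qi ?qj ?ql.
have t2z : hv t2 vzero = 0%N by rewrite t2v ?tv.
have aX : X \notin [:: Z; 1%N; Z] by rewrite !inE !negb_or eq_sym ZX X1.
have aY : Y \notin [:: Z; 1%N; Z] by rewrite !inE !negb_or eq_sym ZY Y1.
have t2X : hm t2 X = hm s X by rewrite t2a ?ta.
have t2Y : hm t2 Y = hm s Y by rewrite t2a ?ta.
apply: hoare_seq (fun t' => hget t' (Z, vi, vj) = 0 /\ forall i j,
  ~~ ((i == k1) && (j == k2)) -> hm t' Z i j = hm t2 Z i j) _ _ _.
  apply: hoare_rat; first exact: bits0.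
  rewrite /hget /= !eqxx; split=> // i j; rewrite tk2 t2i.
  by move=> /negPf ->.
move=> t3 [t3v t3a _] [t30 t3o].
have t3i : hv t3 vi = k1 by rewrite t3v.
have t3j : hv t3 vj = k2 by rewrite t3v.
have t3q : hv t3 vq = q by rewrite t3v.
have t3z : hv t3 vzero = 0%N by rewrite t3v.
have t3X : hm t3 X = hm s X by rewrite t3a ?t2X // inE eq_sym.
have t3Y : hm t3 Y = hm s Y by rewrite t3a ?t2Y // inE eq_sym.
pose F l := mxf MX k1 l * mxf MY l k2.
have FB l : exists2 z : int, F l = z%:~R & (`|z| <= A * B)%N.
  by apply: mul_int_bound; apply: mxf_int.
apply: (@hoare_weaken _ _ _ _ (fun t' => hget t' (Z, vi, vj) = hget t3 (Z, vi, vj) +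
    \sum_(l < hv t3 vq) F l /\ forall i j, ~~ ((i == hv t3 vi) && (j == hv t3 vj)) ->
    hm t' Z i j = hm t3 Z i j)); last first.
  move=> t4 [t4v _ _] []; rewrite t30 add0r t3i t3j t3q => h h2 i j.
  case: ifP => [/andP[/eqP-> /eqP->]|/negbT ij]; last by rewrite h2 // t3o.
  by rewrite mxf_mul // -h /hget /= !t4v //= t3i t3j.
apply: (@hoare_acc _ _ _ _ _ _ (Z, vi, vj)) => // k t4 kq t4l [t4v t4a _] t4s t4o.
rewrite t3q in kq.
have t4i : hv t4 vi = k1 by rewrite t4v.
have t4j : hv t4 vj = k2 by rewrite t4v.
have t4z : hv t4 vzero = 0%N by rewrite t4v.
have t4X : hm t4 X = hm s X by rewrite t4a ?t3X // !inE !negb_or X1 eq_sym.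
have t4Y : hm t4 Y = hm s Y by rewrite t4a ?t3Y // !inE !negb_or Y1 eq_sym.
have FE : hget t4 (X, vi, vl) * hget t4 (Y, vl, vj) = F k.
  by rewrite /hget /= t4X t4Y t4i t4j t4l hX ?hY.
have q0 : (0 < q)%N by apply: leq_trans kq.
have AB1 : (A * B <= Zb)%N by apply: leq_trans AB; rewrite leq_pmull.
apply: hoare_seq (fun t' => hget t' atmp = F k) _ _ _.
  apply: hoare_op; first by rewrite /= FE; apply: bits_int (FB k) AB1.
  by rewrite /hget /= t4z !eqxx /= FE.
move=> t5 [t5v t5a _] t5F.
have t5Z : hget t5 (Z, vi, vj) = hget t4 (Z, vi, vj).
  by rewrite /hget /= !t5v // t5a // inE.
apply: hoare_op; rewrite /= t5Z t5F.
  rewrite t4s t30 add0r; have := big_ord_recr k F => /= <-.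
  have [l _|z -> zb] := @sum_int_bound k.+1 F (A * B)%N; first exact: FB.
  apply: (@bits_int _ (k.+1 * (A * B))%N); first by exists z.
  by apply: leq_trans AB; rewrite leq_mul2r kq orbT.
split; first by rewrite /hget /= !eqxx.
move=> i j; rewrite t3i t3j /= !t5v // t4i t4j eqxx /= => /negPf ->.
by rewrite t5a // inE.
Qed.

End Matmul.

(** * The program of one iteration *)

Definition vcnt := 0%N.
Definition vmA := 1%N.
Definition vn := 3%N.
Definition vm := 4%N.
Definition vbound := 5%N.
Definition vone := 7%N.
Definition vo := 8%N.
Definition vk := 12%N.
Definition vt := 13%N.
Definition vbest := 14%N.
Definition vr := 15%N.
Definition vdone := 16%N.

Definition czero : cell := (2%N, vzero, vzero).
Definition cone : cell := (3%N, vzero, vzero).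
Definition aE := 4%N.
Definition ae := 5%N.
Definition ac := 6%N.
Definition aflag := 7%N.
Definition alog := 8%N.
Definition aFT := 9%N.
Definition aN := 10%N.
Definition aP := 11%N.
Definition aM := 12%N.
Definition ccoef : cell := (13%N, vzero, vzero).
Definition ccount : cell := (14%N, vzero, vzero).
Definition ctrace : cell := (15%N, vzero, vzero).
Definition aG := 17%N.
Definition arr := 18%N.
Definition axx := 19%N.
Definition ax := 20%N.
Definition acG := 21%N.
Definition aq := 22%N.
Definition cnorm : cell := (23%N, vzero, vzero).
Definition cbest : cell := (24%N, vzero, vzero).
Definition ay := 25%N.
Definition aEy := 26%N.

Definition weighted_rows : hprog :=
  HFor vj vn (HFor vi vm (HOp RMul (aFT, vj, vi) (aflag, vi, vzero) (aE, vi, vj))).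

(** An index cannot be turned into a rational, so [ccount] repeats the loop counter in the rational
    memory. The scalar matrix is added on the diagonal, which is found by two strict comparisons. *)
Definition faddeev_leverrier : hprog :=
  HSeq (HRat ccoef 1) (HSeq (HRat ccount 0) (HSeq
    (HFor vi vn (HFor vj vn (HRat (aP, vi, vj) 0)))
    (HFor vk vn
      (HSeq (HFor vi vn (HFor vj vn
               (HSeq (HOp RSub (aM, vi, vj) czero (aP, vi, vj))
                     (HIfLt vi vj HSkip (HIfLt vj vi HSkip
                        (HOp RAdd (aM, vi, vj) (aM, vi, vj) ccoef))))))
      (HSeq (matmul aP aN aM vn vn vn)
      (HSeq (HRat ctrace 0)
      (HSeq (HFor vi vn (HOp RAdd ctrace ctrace (aP, vi, vi)))
      (HSeq (HOp RAdd ccount ccount cone)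
            (HOp RDiv ccoef ctrace ccount))))))))).

Section Fill2.
Variables S V : nat.

Lemma frame_trans p q s t u : frame p s t -> frame q t u ->
  {subset modv q <= modv p} -> {subset moda q <= moda p} ->
  (choice_free p -> choice_free q) -> frame p s u.
Proof.
move=> [pv pa pc] [qv qa qc] sv sa sc; split.
- by move=> v vp; rewrite qv ?pv //; apply: contra vp; apply: sv.
- by move=> a ap; rewrite qa ?pa //; apply: contra ap; apply: sa.
- by move=> c; rewrite qc ?pc //; apply: sc.
Qed.

Lemma hoare_fill2 v1 v2 w1 w2 q s Z (Val : nat -> nat -> rat) :
  v1 != v2 -> v1 \notin modv q -> w2 \notin v1 :: v2 :: modv q ->
  (forall k1 k2 t, (k1 < hv s w1)%N -> (k2 < hv s w2)%N -> hv t v1 = k1 -> hv t v2 = k2 ->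
     frame (HFor v1 w1 (HFor v2 w2 q)) s t ->
     hoare S V q t (fun t' => forall i j,
       hm t' Z i j = if (i == k1) && (j == k2) then Val i j else hm t Z i j)) ->
  hoare S V (HFor v1 w1 (HFor v2 w2 q)) s (fun t => forall i j,
    hm t Z i j = if (i < hv s w1)%N && (j < hv s w2)%N then Val i j else hm s Z i j).
Proof.
move=> v12 v1q w2q body.
apply: (@hoare_weaken _ _ _ _ (fun t => forall i j,
   hm t Z i j = if has (fun k => (i == k) && (j < hv s w2)%N) (iota 0 (hv s w1)) then Val i j
   else hm s Z i j)); last by move=> t _ h i j; rewrite h has_iota_row.
apply: hoare_fill => k1 t k1w tv1 ft.
have tw2 : hv t w2 = hv s w2 by case: ft => -> //.
apply: (@hoare_weaken _ _ _ _ (fun t' => forall i j,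
   hm t' Z i j = if has (fun k => (i == k1) && (j == k)) (iota 0 (hv t w2))
   then Val i j else hm t Z i j)); last first.
  by move=> t' _ h i j; rewrite h has_iota_col tw2.
apply: hoare_fill => k2 t2 k2w tv2 ft2; rewrite tw2 in k2w.
have t2v1 : hv t2 v1 = k1.
  by case: ft2 => -> //; rewrite /= inE negb_or v12.
apply: body => //; apply: frame_trans ft ft2 _ _ _ => //.
by move=> v vq; rewrite inE (vq : v \in modv (HFor v2 w2 q)) orbT.
Qed.

End Fill2.

Section FaddeevLeVerrierProgram.
Variables S V Zb : nat.
Hypothesis SZ : (nat_bits Zb + nat_bits Zb <= S)%N.

Lemma bits_frac (x : rat) (a b : int) : x = a%:~R / b%:~R -> b != 0 ->
  (`|a| <= Zb)%N -> (`|b| <= Zb)%N -> (rat_bits x <= S)%N.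
Proof.
move=> -> b0 aZ bZ; apply: leq_trans (rat_bits_frac _ b0) _; apply: leq_trans SZ.
by apply: leq_add; apply: nat_bits_le.
Qed.

Lemma hoare_fl s n (N : 'M[int]_n) B :
  hv s vn = n -> hv s vzero = 0%N -> hm s 2 0%N 0%N = 0 -> hm s 3 0%N 0%N = 1 ->
  holds s aN N -> bounded_by B N -> (2 * n.+1 * fl_rate n B ^ n.+1 <= Zb)%N ->
  hoare S V faddeev_leverrier s (fun t => holds t aM (fl_mx N n) /\
    hm t 13 0%N 0%N = (fl_coef N n)%:~R).
Proof.
move=> sn s0 sz so hN bN rate.
have pow k : (k <= n.+1)%N -> (2 * n.+1 * fl_rate n B ^ k <= Zb)%N.
  by move=> kn; apply: leq_trans rate; rewrite leq_mul2l leq_pexp2l // orbT.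
have Y0 k : (0 < fl_rate n B ^ k)%N by rewrite expn_gt0.
have nZ : (n.+1 <= Zb)%N by apply: leq_trans (pow 0%N isT); rewrite expn0; lia.
have Z0 : (0 < Zb)%N by apply: leq_trans nZ.
apply: hoare_seq (fun t => hget t ccoef = 1) _ _ _.
  apply: hoare_rat; last by rewrite /hget /= !eqxx.
  by apply: (bits_int SZ _ Z0); exists 1.
move=> t1 [t1v t1a _] t1c.
apply: hoare_seq (fun t => hget t ccount = 0) _ _ _.
  by apply: hoare_rat; [apply: bits0 SZ | rewrite /hget /= !eqxx].
move=> t2 [t2v t2a _] t2c.
apply: hoare_seq (fun t => holds t aP (0 : 'M[int]_n)) _ _ _.
  have Z : hv t2 vn = n by rewrite t2v ?t1v.
  apply: hoare_weaken (@hoare_fill2 _ _ vi vj vn vn _ t2 aP (fun _ _ => 0) _ _ _ _) _ => //.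
    move=> k1 k2 t _ _ tk1 tk2 _; apply: hoare_rat; first exact: bits0 SZ.
    by move=> i j; rewrite /= tk1 tk2.
  move=> t _ h i j i_n j_n; rewrite h Z i_n j_n /=.
  by have := mxfE (0 : 'M[int]_n) (Ordinal i_n) (Ordinal j_n) => /= ->; rewrite mxE.
move=> t3 [t3v t3a _] t3P.
have t3n : hv t3 vn = n by rewrite t3v // t2v // t1v.
have t3z : hv t3 vzero = 0%N by rewrite t3v // t2v // t1v.
have t3N : holds t3 aN N by move=> i j *; rewrite t3a // t2a // t1a // hN.
have t3zero : hm t3 2 = hm s 2 by rewrite t3a // t2a // t1a.
have t3one : hm t3 3 = hm s 3 by rewrite t3a // t2a // t1a.
(* [aP] carries the product needed by the next round. Before the first round [aM] is not yet
   written; when n is 0 its contents do not matter. *)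
pose I (k : nat) t := [/\ holds t aP (N *m fl_mx N k), hm t 13 0%N 0%N = (fl_coef N k)%:~R,
   hm t 14 0%N 0%N = k%:R & (0 < k)%N -> holds t aM (fl_mx N k)].
apply: (@hoare_weaken _ _ _ _ (I (hv t3 vn))); last first.
  move=> t _; rewrite t3n => -[_ c _ hM]; split=> // i j i_n j_n.
  by apply: hM => //; apply: leq_trans i_n.
apply: hoare_for.
  have e2 : hv t2 vzero = 0%N by rewrite t2v // t1v.
  have e1 : hv t1 vzero = 0%N by rewrite t1v.
  split=> //; first by rewrite fl_mx0 mulmx0.
    by rewrite /= t3a // t2a // fl_coef0; move: t1c; rewrite /hget /= e1.
  by rewrite /= t3a //; move: t2c; rewrite /hget /= e2.
move=> k t4 kn tk [t4v t4a _] [hP hc hk _]; rewrite t3n in kn.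
have t4n : hv t4 vn = n by rewrite t4v.
have t4z : hv t4 vzero = 0%N by rewrite t4v.
have t4N : holds t4 aN N by move=> i j *; rewrite t4a // t3N.
have t4zero : hm t4 2 0%N 0%N = 0 by rewrite t4a // t3zero.
have t4one : hm t4 3 0%N 0%N = 1 by rewrite t4a // t3one.
have [P_le c_le M_le] := fl_bounds bN (ltnW kn).
have [P'_le c'_le M'_le] := fl_bounds bN kn.
set Y := (fl_rate n B ^ k)%N in P_le c_le M_le.
set Y' := (fl_rate n B ^ k.+1)%N in P'_le c'_le M'_le.
have Y'Z : (2 * n.+1 * Y' <= Zb)%N by apply: pow; apply: ltnW.
have YZ : (2 * n.+1 * Y <= Zb)%N by apply: pow; apply: leq_trans (ltnW kn) _.
have M_le' : bounded_by (2 * Y) (fl_mx N k.+1).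
  move=> i j; rewrite fl_mxS // mxE [X in X + _]mxE [X in _ + X]mxE.
  apply: leq_trans (abszD_le _ _) _; rewrite abszN mul2n -addnn leq_add //.
  by case: eqP => _; rewrite ?mulr1n ?mulr0n.
have prodZ : (n * (B * (2 * Y)) <= Zb)%N.
  have aux (y m b : nat) : (0 < m -> m * (b * (2 * y)) <= (2 * m * m * b).+1 * y)%N by nia.
  have n0 : (0 < n)%N by apply: leq_trans kn.
  apply: leq_trans (aux Y n B n0) _; rewrite -expnS -/Y'.
  by apply: leq_trans Y'Z; rewrite leq_pmull.
apply: hoare_seq (fun t => holds t aM (fl_mx N k.+1)) _ _ _.
  apply: hoare_weaken (@hoare_fill2 _ _ vi vj vn vn _ t4 aM (mxf (fl_mx N k.+1)) _ _ _ _) _ => //;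
    last by move=> t _ h i j i_n j_n; rewrite h t4n i_n j_n.
  move=> k1 k2 t5; rewrite t4n => k1n k2n t5i t5j [t5v t5a _].
  have t5z : hv t5 vzero = 0%N by rewrite t5v.
  have mE : mxf (fl_mx N k.+1) k1 k2 =
      (if k1 == k2 then (fl_coef N k)%:~R else 0) - mxf (N *m fl_mx N k) k1 k2.
    have := mxfE (fl_mx N k.+1) (Ordinal k1n) (Ordinal k2n) => /= ->.
    have := mxfE (N *m fl_mx N k) (Ordinal k1n) (Ordinal k2n) => /= ->.
    rewrite fl_mxS // mxE [X in X + _]mxE [X in _ + X]mxE rmorphB /=.
    by rewrite -val_eqE /=; case: eqP.
  have bP : exists2 z : int, mxf (N *m fl_mx N k) k1 k2 = z%:~R & (`|z| <= Y)%N.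
    exact: mxf_int.
  have YZ1 : (Y <= Zb)%N by apply: leq_trans YZ; rewrite leq_pmull.
  apply: hoare_seq (fun t => hget t (aM, vi, vj) = - mxf (N *m fl_mx N k) k1 k2 /\
     forall i j, ~~ ((i == k1) && (j == k2)) -> hm t aM i j = hm t5 aM i j) _ _ _.
    have E : rop_fun RSub (hget t5 czero) (hget t5 (aP, vi, vj)) = - mxf (N *m fl_mx N k) k1 k2.
      by rewrite /hget /= t5z t5i t5j t5a // t4zero t5a // hP // sub0r.
    apply: hoare_op; rewrite E.
      by case: bP => z -> zY; apply: (bits_int SZ _ YZ1); exists (- z); rewrite ?rmorphN ?abszN.
    by rewrite /hget /= !eqxx; split=> // i j; rewrite t5i t5j => /negPf ->.
  move=> t6 [t6v t6a _] [t6M t6o].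
  have t6i : hv t6 vi = k1 by rewrite t6v.
  have t6j : hv t6 vj = k2 by rewrite t6v.
  have t6z : hv t6 vzero = 0%N by rewrite t6v.
  have skip : k1 != k2 -> hoare S V HSkip t6 (fun t' => forall i j,
      hm t' aM i j = if (i == k1) && (j == k2) then mxf (fl_mx N k.+1) i j else hm t5 aM i j).
    move=> /negPf k12; apply: hoare_skip => i j; case: ifP => [/andP[/eqP-> /eqP->]|/negbT /t6o//].
    by rewrite mE k12 sub0r -t6M /hget /= t6i t6j.
  apply: hoare_iflt; rewrite t6i t6j => h1; first by apply: skip; rewrite neq_ltn h1.
  apply: hoare_iflt; rewrite t6i t6j => h2; first by apply: skip; rewrite neq_ltn h2 orbT.
  have k12 : k1 = k2 by apply/eqP; rewrite eqn_leq h1 h2.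
  have E : rop_fun RAdd (hget t6 (aM, vi, vj)) (hget t6 ccoef) = mxf (fl_mx N k.+1) k1 k2.
    rewrite mE k12 eqxx /= t6M addrC k12; congr (_ - _).
    by rewrite /hget /= t6z t6a // t5a.
  apply: hoare_op; rewrite E.
    have [z zE zb] := mxf_int k1 k2 M_le'.
    apply: (@bits_int _ _ SZ _ (2 * Y)); first by exists z.
    by apply: leq_trans YZ; rewrite mulnAC leq_pmulr.
  move=> i j /=; rewrite t6i t6j; case: ifP => [/andP[/eqP-> /eqP->] //|/negbT /t6o//].
move=> t5 [t5v t5a _] t5M.
have t5n : hv t5 vn = n by rewrite t5v.
have t5z : hv t5 vzero = 0%N by rewrite t5v.
have t5N : holds t5 aN N by move=> i j *; rewrite t5a // t4N.
apply: hoare_seq.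
  exact: (@hoare_matmul S V Zb SZ t5 aP aN aM vn vn vn n n n B (2 * Y) N (fl_mx N k.+1)).
move=> t6 [t6v t6a _] t6P.
apply: hoare_seq (fun t => hget t ctrace = 0) _ _ _.
  by apply: hoare_rat; [apply: bits0 SZ | rewrite /hget /= !eqxx].
move=> t7 [t7v t7a _] t7t.
have t7n : hv t7 vn = n by rewrite t7v // t6v.
have t7z : hv t7 vzero = 0%N by rewrite t7v // t6v.
pose F l := mxf (N *m fl_mx N k.+1) l l.
have FB l : exists2 z : int, F l = z%:~R & (`|z| <= Y')%N by apply: mxf_int.
have sumZ m : (m <= n)%N -> (m * Y' <= Zb)%N.
  by move=> mn; apply: leq_trans Y'Z; rewrite leq_mul2r; apply/orP; right; lia.
apply: hoare_seq (fun t => hget t ctrace = hget t7 ctrace + \sum_(l < hv t7 vn) F l /\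
    forall i j, ~~ ((i == hv t7 vzero) && (j == hv t7 vzero)) -> hm t 15 i j = hm t7 15 i j) _ _ _.
  apply: (@hoare_acc _ _ _ _ _ _ ctrace) => // l t8 ln t8l [t8v t8a _] t8t _.
  have t8z : hv t8 vzero = 0%N by rewrite t8v.
  rewrite t7n in ln.
  have E : hget t8 (aP, vi, vi) = F l.
    by rewrite /hget /= t8l t8a // t7a // t6P.
  apply: hoare_op; rewrite /= E.
    rewrite t8t t7t add0r; have := big_ord_recr l F => /= <-.
    have [m _|z zE zb] := @sum_int_bound l.+1 F Y'; first exact: FB.
    by apply: (@bits_int _ _ SZ _ (l.+1 * Y')%N (ex_intro2 _ _ z zE zb)); apply: sumZ.
  split; first by rewrite /hget /= !eqxx.
  by move=> i j; rewrite t7z t8z => /negPf /= ->.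
move=> t8 [t8v t8a _] [t8t _].
have t8z : hv t8 vzero = 0%N by rewrite t8v.
have trE : hget t8 ctrace = ((fl_coef N k.+1) *+ k.+1)%:~R.
  rewrite t8t t7t add0r t7n -fl_coefS // /mxtrace rmorph_sum.
  by apply: eq_bigr => i _; rewrite /F mxfE.
apply: hoare_seq (fun t => hget t ccount = k.+1%:R) _ _ _.
  have E : rop_fun RAdd (hget t8 ccount) (hget t8 cone) = k.+1%:R.
    rewrite /hget /= t8z t8a // t7a // t6a // t5a // hk t8a // t7a // t6a // t5a // t4one.
    by rewrite natr1.
  apply: hoare_op; rewrite E.
    apply: (@bits_int _ _ SZ _ k.+1); first by exists k.+1%:Z.
    by apply: leq_trans nZ; apply: leqW.
  by rewrite /hget /= !eqxx.
move=> t9 [t9v t9a _] t9k.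
have t9z : hv t9 vzero = 0%N by rewrite t9v.
(* By [trE] the trace is a multiple of k+1, so the quotient is an integer. *)
have E : rop_fun RDiv (hget t9 ctrace) (hget t9 ccount) = (fl_coef N k.+1)%:~R.
  have -> : hget t9 ctrace = hget t8 ctrace by rewrite /hget /= t9a // t9z t8z.
  by rewrite /= trE t9k rmorphMn /= -mulr_natr mulfK // pnatr_eq0.
apply: hoare_op; rewrite E.
  apply: (@bits_int _ _ SZ _ Y'); first by exists (fl_coef N k.+1).
  by apply: leq_trans Y'Z; rewrite leq_pmull.
have P9 : hm t9 aP = hm t6 aP by rewrite t9a // t8a // t7a.
have M9 : hm t9 aM = hm t5 aM by rewrite t9a // t8a // t7a // t6a.
split=> [i j i_n j_n|||_ i j i_n j_n] /=; rewrite ?t9z ?eqxx //.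
- by rewrite P9 t6P.
- by move: t9k; rewrite /hget /= t9z.
- by rewrite M9 t5M.
Qed.

End FaddeevLeVerrierProgram.

(** * Gram matrix of the rows selected by flags *)

Section Gram.
Variables (m n : nat) (M : 'M[int]_(m, n)) (f : 'I_m -> bool).

Definition flag_col : 'cV[int]_m := \col_i (f i)%:R.
(** Rows are weighted by 0 or 1 rather than deleted, so all arrays keep the same dimensions whatever
    the basis. *)
Definition gram_rows : 'M[int]_(n, m) := \matrix_(j, i) ((f i)%:R * M i j).
Definition gram : 'M[int]_n := gram_rows *m M.
Definition gram_adj : 'M[int]_n := fl_mx gram n.
Definition gram_det : int := fl_coef gram n.
(** The columns of flagged inequalities are edge-directions with the opposite sign; whatever reads
    them compensates for it. *)
Definition gram_dirs : 'M[int]_(n, m) := gram_adj *m gram_rows.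
(** Divided by [gram_det], the solution of the normal equations of the flagged rows, as in Cramer's
    rule. *)
Definition gram_sol (e : 'cV[int]_m) : 'cV[int]_n := gram_adj *m (gram_rows *m e).

End Gram.

Definition directions : hprog :=
  HSeq weighted_rows
  (HSeq (matmul aN aFT aE vn vm vn)
  (HSeq faddeev_leverrier
  (HSeq (matmul aG aM aFT vn vn vm)
  (HSeq (matmul arr aFT ae vn vm vone)
  (HSeq (matmul axx aM arr vn vn vone)
  (HSeq (HFor vj vn (HOp RDiv (ax, vj, vzero) (axx, vj, vzero) ccoef))
        (matmul acG ac aG vone vn vm))))))).

(** The ratio of a row is minus the steepness of the edge leaving it, so the steepest edge has the
    largest one. Equations and rows outside the basis get 0 and never count as improving. *)
Definition ratios : hprog :=
  HFor vi vm (HSeq (HRat (aq, vzero, vi) 0)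
    (HIfLt vi vmA HSkip (HIfLe cone (aflag, vi, vzero)
      (HSeq (HRat cnorm 0)
      (HSeq (HFor vj vn (HIfLe (aG, vj, vi) czero (HOp RSub cnorm cnorm (aG, vj, vi))
                                                  (HOp RAdd cnorm cnorm (aG, vj, vi))))
            (HOp RDiv (aq, vzero, vi) (acG, vzero, vi) cnorm)))
      HSkip))).

(** [vbest = vm] means that no ratio is positive. The row drawn by [HChoose] replaces the first
    maximizer only if it attains the maximum too. *)
Definition select : hprog :=
  HSeq (HRat cbest 0)
  (HSeq (HInt IAdd vbest vm vzero)
  (HSeq (HFor vi vm (HIfLe (aq, vzero, vi) cbest HSkip
      (HSeq (HInt IAdd vbest vi vzero) (HOp RAdd cbest (aq, vzero, vi) czero))))
  (HSeq (HChoose vr vm)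
        (HIfLt vbest vm (HIfLe cbest (aq, vzero, vr) (HInt IAdd vbest vr vzero) HSkip)
               HSkip)))).

(** Positive entries of [aG] send a coordinate to 0, because the direction is minus a column. Adding
    [czero] copies a cell. *)
Definition update : hprog :=
  HIfLt vbest vm
    (HSeq (HFor vj vn (HIfLe czero (aG, vj, vbest)
             (HIfLe (aG, vj, vbest) czero (HOp RAdd (ay, vj, vzero) (ax, vj, vzero) czero)
                    (HRat (ay, vj, vzero) 0))
             (HRat (ay, vj, vzero) 1)))
    (HSeq (matmul aEy aE ay vm vn vone)
    (HSeq (HFor vi vm (HIfLe (ae, vi, vzero) (aEy, vi, vzero)
             (HRat (aflag, vi, vzero) 1) (HRat (aflag, vi, vzero) 0)))
    (HSeq (HFor vi vm (HOp RAdd (alog, vcnt, vi) (aflag, vi, vzero) czero))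
          (HInt IAdd vcnt vcnt vone)))))
    (HInt IAdd vdone vone vzero).

Definition iteration : hprog :=
  HSeq directions (HSeq ratios (HSeq select update)).

(** * Correctness of the blocks of an iteration *)

Section Blocks.
Variables (S V Zb mA m n : nat).
Hypothesis SZ : (nat_bits Zb + nat_bits Zb <= S)%N.
Variables (ME : 'M[int]_(m, n)) (Me : 'cV[int]_m) (Mc : 'rV[int]_n) (X : nat).
Hypotheses (bE : bounded_by X ME) (be : bounded_by X Me) (bc : bounded_by X Mc).

Let rate := fl_rate n (m * (X * X)).
Hypothesis Z_large : (4 * (n.+1 ^ 3 * m.+1 * X.+1 ^ 3 * rate ^ n.+1) <= Zb)%N.

(** What an iteration reads and never writes. *)
Definition env s :=
  [/\ hv s vmA = mA, hv s vn = n, hv s vm = m, hv s vzero = 0%N & hv s vone = 1%N] /\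
  [/\ hm s 2 0%N 0%N = 0, hm s 3 0%N 0%N = 1, holds s aE ME, holds s ae Me & holds s ac Mc].

Lemma env_frame p s t : frame p s t ->
  all (fun v => v \notin modv p) [:: vmA; vn; vm; vzero; vone] ->
  all (fun a => a \notin moda p) [:: 2; 3; aE; ae; ac]%N -> env s -> env t.
Proof.
move=> [fv fa _] /and5P[v1 v2 v3 v4 /andP[v5 _]] /and5P[a1 a2 a3 a4 /andP[a5 _]].
by move=> [[h1 h2 h3 h4 h5] [g1 g2 g3 g4 g5]]; rewrite /env /holds !fv // !fa.
Qed.

(** The magnitudes met in an iteration are bounded by such products, so each block only has to name
    its four factors. *)
Lemma Z_bound a b c d : (a <= n.+1 ^ 3)%N -> (b <= m.+1)%N -> (c <= X.+1 ^ 3)%N ->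
  (d <= rate ^ n.+1)%N -> (4 * (a * b * c * d) <= Zb)%N.
Proof.
by move=> ha hb hc hd; apply: leq_trans Z_large; rewrite leq_mul2l !leq_mul ?orbT.
Qed.

Lemma rate_pow k : (k <= n.+1)%N -> (rate ^ k <= rate ^ n.+1)%N.
Proof. by move=> kn; rewrite leq_pexp2l. Qed.

Section Directions.
Variable f : 'I_m -> bool.
Let FT := gram_rows ME f.

Lemma gram_rows_bound : bounded_by X FT.
Proof.
move=> i j; rewrite mxE; case: (f j); rewrite ?mul1r ?mul0r //; exact: bE.
Qed.

Lemma gram_bound : bounded_by (m * (X * X)) (gram ME f).
Proof. by apply: mulmx_bounded => //; apply: gram_rows_bound. Qed.

Lemma gram_adj_bound : bounded_by (2 * rate ^ n) (gram_adj ME f).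
Proof. by have [_ _] := fl_bounds gram_bound (leqnn n). Qed.

Lemma gram_dirs_bound : bounded_by (n * (2 * rate ^ n * X)) (gram_dirs ME f).
Proof. by apply: mulmx_bounded; [apply: gram_adj_bound | apply: gram_rows_bound]. Qed.

Definition gram_x j : rat := (gram_sol ME f Me j 0)%:~R / (gram_det ME f)%:~R.

Definition directions_post t :=
  [/\ holds t aG (gram_dirs ME f), forall j : 'I_n, hm t ax j 0%N = gram_x j &
      holds t acG (Mc *m gram_dirs ME f)].

(** The 0/1 hypothesis bounds the size of the quotients stored in [ax]. *)
Lemma hoare_directions s : env s -> holds s aflag (flag_col f) ->
  (forall j, gram_x j = 0 \/ gram_x j = 1) ->
  hoare S V directions s directions_post.
Proof.
move=> es hf x01.
have n3 : (n * n <= n.+1 ^ 3)%N by nia.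
have n1 : (n <= n.+1 ^ 3)%N by nia.
have X3 : (X * X * X <= X.+1 ^ 3)%N by nia.
have X1 : (X <= X.+1 ^ 3)%N by nia.
have X2 : (X * X <= X.+1 ^ 3)%N by nia.
have rn := rate_pow (leqnSn n).
have one a : (1 <= a.+1 ^ 3)%N by rewrite expn_gt0.
have one_r : (1 <= rate ^ n.+1)%N by rewrite expn_gt0.
have m1 : (m <= m.+1)%N by [].
apply: hoare_seq (fun t => holds t aFT FT) _ _ _.
  have [[_ sn sm s0 _] [_ _ hE _ _]] := es.
  apply: hoare_weaken (@hoare_fill2 _ _ vj vi vn vm _ s aFT (mxf FT) _ _ _ _) _ => //;
    last by move=> t _ h i j i_n j_n; rewrite h sn sm i_n j_n.
  move=> k1 k2 t; rewrite sn sm => k1n k2m tj ti [tv ta _].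
  have E : rop_fun RMul (hget t (aflag, vi, vzero)) (hget t (aE, vi, vj)) = mxf FT k1 k2.
    have t0 : hv t vzero = 0%N by rewrite tv.
    have tf : hm t aflag = hm s aflag by rewrite ta.
    have tE : hm t aE = hm s aE by rewrite ta.
    rewrite /hget /= t0 ti tj tf tE hf // hE //.
    have := mxfE (flag_col f) (Ordinal k2m) ord0 => /= ->.
    have := mxfE ME (Ordinal k2m) (Ordinal k1n) => /= ->.
    have := mxfE FT (Ordinal k1n) (Ordinal k2m) => /= ->.
    by rewrite !mxE rmorphM.
  apply: hoare_op; rewrite E; last first.
    by move=> i j; rewrite /= ti tj; case: ifP => // /andP[/eqP-> /eqP->].
  apply: (bits_int SZ (mxf_int k1 k2 gram_rows_bound)).
  have := @Z_bound 1 1 X 1 (one _) isT X1 one_r; lia.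
move=> t1 f1 hFT; have e1 := env_frame f1 isT isT es.
have [[_ sn sm s0 so] [_ _ hE he hc]] := e1.
apply: hoare_seq.
  apply: (hoare_matmul V SZ (A := X) (B := X) (MX := FT) (MY := ME)) => //.
    exact: gram_rows_bound.
  by have := @Z_bound 1 m (X * X)%N 1 (one _) m1 X2 one_r; lia.
move=> t2 f2 hN; have e2 := env_frame f2 isT isT e1.
have {}hFT : holds t2 aFT FT by case: f2 => _ fa _ i j *; rewrite fa // hFT.
have [[_ sn2 _ s02 _] [z2 o2 _ _ _]] := e2.
apply: hoare_seq.
  apply: (hoare_fl V SZ (N := gram ME f) (B := (m * (X * X))%N)) => //.
    exact: gram_bound.
  have h : (n.+1 <= n.+1 ^ 3)%N by rewrite -{1}(expn1 n.+1) leq_pexp2l.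
  have := @Z_bound n.+1 1 1 (rate ^ n.+1) h isT (one _) (leqnn _).
  rewrite /rate; lia.
move=> t3 f3 [hM hcc]; have e3 := env_frame f3 isT isT e2.
have {}hFT : holds t3 aFT FT by case: f3 => _ fa _ i j *; rewrite fa // hFT.
have [[_ sn3 sm3 s03 so3] [_ _ _ he3 _]] := e3.
apply: hoare_seq.
  apply: (hoare_matmul V SZ (MX := gram_adj ME f) (MY := FT)) => //.
  - exact: gram_adj_bound.
  - exact: gram_rows_bound.
  by have := @Z_bound n 1 X (rate ^ n) n1 isT X1 rn; lia.
move=> t4 f4 hG; have e4 := env_frame f4 isT isT e3.
have {}hFT : holds t4 aFT FT by case: f4 => _ fa _ i j *; rewrite fa // hFT.
have {}hM : holds t4 aM (gram_adj ME f) by case: f4 => _ fa _ i j *; rewrite fa // hM.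
have {}hcc : hm t4 13 0%N 0%N = (gram_det ME f)%:~R by case: f4 => _ fa _; rewrite fa.
have [[_ sn4 sm4 s04 so4] [_ _ _ he4 _]] := e4.
apply: hoare_seq.
  apply: (hoare_matmul V SZ (A := X) (B := X) (MX := FT) (MY := Me)) => //.
    exact: gram_rows_bound.
  by have := @Z_bound 1 m (X * X)%N 1 (one _) m1 X2 one_r; lia.
move=> t5 f5 hr; have e5 := env_frame f5 isT isT e4.
have {}hM : holds t5 aM (gram_adj ME f) by case: f5 => _ fa _ i j *; rewrite fa // hM.
have {}hcc : hm t5 13 0%N 0%N = (gram_det ME f)%:~R by case: f5 => _ fa _; rewrite fa.
have {}hG : holds t5 aG (gram_dirs ME f) by case: f5 => _ fa _ i j *; rewrite fa // hG.
have [[_ sn5 sm5 s05 so5] [_ _ _ _ _]] := e5.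
apply: hoare_seq.
  apply: (hoare_matmul V SZ (MX := gram_adj ME f) (MY := FT *m Me)) => //.
  - exact: gram_adj_bound.
  - by apply: mulmx_bounded; [apply: gram_rows_bound | apply: be].
  by have := @Z_bound n m (X * X)%N (rate ^ n) n1 m1 X2 rn; lia.
move=> t6 f6 hx; have e6 := env_frame f6 isT isT e5.
have {}hcc : hm t6 13 0%N 0%N = (gram_det ME f)%:~R by case: f6 => _ fa _; rewrite fa.
have {}hG : holds t6 aG (gram_dirs ME f) by case: f6 => _ fa _ i j *; rewrite fa // hG.
have [[_ sn6 sm6 s06 so6] [_ _ _ _ _]] := e6.
pose xv j := oapp gram_x 0 (insub j).
apply: hoare_seq (fun t => forall j : 'I_n, hm t ax j 0%N = gram_x j) _ _ _.
  apply: hoare_weaken (@hoare_fill _ _ _ vj vn t6 ax (fun k i j => (j == 0%N) && (i == k))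
    (fun i _ => xv i) _) _.
    move=> k t7 kn tj [tv ta _]; rewrite sn6 in kn.
    have E : rop_fun RDiv (hget t7 (axx, vj, vzero)) (hget t7 ccoef) = gram_x (Ordinal kn).
      have t0 : hv t7 vzero = 0%N by rewrite tv.
      have t1x : hm t7 axx = hm t6 axx by rewrite ta.
      have t1c : hm t7 13 = hm t6 13 by rewrite ta.
      rewrite /hget /= t0 tj t1x t1c hx // hcc.
      by have := mxfE (gram_adj ME f *m (FT *m Me)) (Ordinal kn) ord0 => /= ->.
    apply: hoare_op; rewrite E.
      have [] := x01 (Ordinal kn) => ->; first exact: bits0 SZ.
      apply: (@bits_int _ _ SZ _ 1); first by exists 1.
      have := @Z_bound 1 1 1 1 (one _) isT (one _) one_r; lia.
    move=> i j /=; have -> : hv t7 vzero = 0%N by rewrite tv.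
    rewrite tj; rewrite [(i == _) && _]andbC.
    by case: ifP => // /andP[_ /eqP->]; rewrite /xv insubT.
  move=> t7 _ h j; rewrite h /=.
  have -> : has (fun k => (0%N == 0%N) && (j == k :> nat)) (iota 0 (hv t6 vn)).
    by apply/hasP; exists (j : nat); rewrite ?mem_iota ?sn6 /= ?eqxx.
  by rewrite /xv valK.
move=> t7 f7 hx7; have e7 := env_frame f7 isT isT e6.
have {}hG : holds t7 aG (gram_dirs ME f) by case: f7 => _ fa _ i j *; rewrite fa // hG.
have [[_ sn7 sm7 s07 so7] [_ _ _ _ hc7]] := e7.
apply: (@hoare_weaken _ _ _ _ (fun t => holds t acG (Mc *m gram_dirs ME f))).
  apply: (hoare_matmul V SZ (A := X) (MX := Mc) (MY := gram_dirs ME f)) => //.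
    exact: gram_dirs_bound.
  by have := @Z_bound (n * n)%N 1 (X * X)%N (rate ^ n) n3 isT X2 rn; lia.
move=> t8 [_ fa _] hCG; split=> //; first by move=> i j *; rewrite fa // hG.
by move=> j; rewrite fa.
Qed.

Definition ratio (i : 'I_m) : rat :=
  if (mA <= i)%N && f i then
    ((Mc *m gram_dirs ME f) 0 i)%:~R / (\sum_j `|gram_dirs ME f j i|)%:~R
  else 0.

Lemma ratio_bits i : (rat_bits (ratio i) <= S)%N.
Proof.
have n3 : (n * n <= n.+1 ^ 3)%N by nia.
have X2 : (X * X <= X.+1 ^ 3)%N by nia.
have X1 : (X <= X.+1 ^ 3)%N by nia.
have rn := rate_pow (leqnSn n); have GB := gram_dirs_bound.
rewrite /ratio; case: ifP => _; last exact: bits0 SZ.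
(* Division by a zero norm yields 0 in [rat]. *)
have [->|norm0] := eqVneq (\sum_j `|gram_dirs ME f j i|) 0.
  by rewrite invr0 mulr0; apply: bits0 SZ.
apply: (bits_frac SZ erefl norm0).
  apply: leq_trans (mulmx_bounded bc GB ord0 i) _.
  by have := @Z_bound (n * n)%N 1 (X * X)%N (rate ^ n) n3 isT X2 rn; lia.
have := @absz_sum _ (fun j => `|gram_dirs ME f j i|) (n * (2 * rate ^ n * X))%N.
rewrite card_ord => H; apply: leq_trans (H _) _; first by move=> j; rewrite -abszE; apply: GB.
by have := @Z_bound (n * n)%N 1 X (rate ^ n) n3 isT X1 rn; lia.
Qed.

Lemma hoare_ratios s : env s -> holds s aflag (flag_col f) -> holds s aG (gram_dirs ME f) ->
  holds s acG (Mc *m gram_dirs ME f) ->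
  hoare S V ratios s (fun t => forall i : 'I_m, hm t aq 0%N i = ratio i).
Proof.
move=> es hf hG hC; have [[smA sn sm s0 _] [sz so _ _ _]] := es.
have n3 : (n * n <= n.+1 ^ 3)%N by nia.
have X2 : (X * X <= X.+1 ^ 3)%N by nia.
have X1 : (X <= X.+1 ^ 3)%N by nia.
have rn := rate_pow (leqnSn n).
have one a : (1 <= a.+1 ^ 3)%N by rewrite expn_gt0.
pose rv i := oapp ratio 0 (insub i).
apply: (@hoare_weaken _ _ _ _ (fun t => forall i j, hm t aq i j =
   if has (fun k => (i == 0%N) && (j == k)) (iota 0 (hv s vm)) then rv j else hm s aq i j));
  last by move=> t _ h i; rewrite h has_iota_col sm ltn_ord /= /rv valK.
apply: hoare_fill => k t1 km ti [tv ta _]; rewrite sm in km; set i0 := Ordinal km.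
have t10 : hv t1 vzero = 0%N by rewrite tv.
have t1n : hv t1 vn = n by rewrite tv.
have t1mA : hv t1 vmA = mA by rewrite tv.
have t1z : hm t1 2 0%N 0%N = 0 by rewrite ta.
have t1o : hm t1 3 0%N 0%N = 1 by rewrite ta.
have t1f : hm t1 aflag k 0%N = (f i0)%:R.
  rewrite ta // hf //; have := mxfE (flag_col f) i0 ord0 => /= ->.
  by rewrite mxE; case: (f i0).
apply: hoare_seq (fun t => forall i j, hm t aq i j =
   if (i == 0%N) && (j == k) then 0 else hm t1 aq i j) _ _ _.
  by apply: hoare_rat; [apply: bits0 SZ | move=> i j; rewrite /= t10 ti].
move=> t2 [t2v t2a _] t2q.
have t20 : hv t2 vzero = 0%N by rewrite t2v.
have t2i : hv t2 vi = k by rewrite t2v.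
have t2n : hv t2 vn = n by rewrite t2v.
have t2mA : hv t2 vmA = mA by rewrite t2v.
have t2z : hm t2 2 0%N 0%N = 0 by rewrite t2a.
have t2o : hm t2 3 0%N 0%N = 1 by rewrite t2a.
have t2f : hm t2 aflag k 0%N = (f i0)%:R by rewrite t2a.
have t2G : holds t2 aG (gram_dirs ME f) by move=> i j *; rewrite t2a // ta // hG.
have t2C : holds t2 acG (Mc *m gram_dirs ME f) by move=> i j *; rewrite t2a // ta // hC.
have none : ~~ ((mA <= k)%N && f i0) -> forall i j, hm t2 aq i j =
    if (i == 0%N) && (j == k) then rv j else hm t1 aq i j.
  move=> /negbTE h i j; rewrite t2q; case: ifP => // /andP[_ /eqP->].
  by rewrite /rv insubT /= /ratio /= h.
apply: hoare_iflt; rewrite t2i t2mA => kmA.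
  by apply: hoare_skip; apply: none; rewrite leqNgt kmA.
have E1 : hget t2 (aflag, vi, vzero) = (f i0)%:R by rewrite /hget /= t2i t20.
have E2 : hget t2 cone = 1 by rewrite /hget /= t20.
apply: hoare_ifle; rewrite E1 E2; last first.
  by move=> fi; apply: hoare_skip; apply: none; move: fi; case: (f i0); rewrite ?andbF ?ltxx.
move=> fi; have {fi}f1 : f i0 by move: fi; case: (f i0).
have GB := gram_dirs_bound.
apply: hoare_seq (fun t => hget t cnorm = 0) _ _ _.
  by apply: hoare_rat; [apply: bits0 SZ | rewrite /hget /= !eqxx].
move=> t3 [t3v t3a _] t3c.
have t30 : hv t3 vzero = 0%N by rewrite t3v.
have t3i : hv t3 vi = k by rewrite t3v.
have t3n : hv t3 vn = n by rewrite t3v.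
pose F l := `|mxf (gram_dirs ME f) l k|.
have FB l : exists2 z : int, F l = z%:~R & (`|z| <= n * (2 * rate ^ n * X))%N.
  have [z zE zb] := mxf_int l k GB; exists `|z|; last by rewrite -abszE.
  by rewrite /F zE intr_norm.
have sumZ l : (l <= n)%N -> (l * (n * (2 * rate ^ n * X)) <= Zb)%N.
  move=> ln; apply: leq_trans (_ : n * (n * (2 * rate ^ n * X)) <= _)%N.
    by rewrite leq_mul2r ln orbT.
  by have := @Z_bound (n * n)%N 1 X (rate ^ n) n3 isT X1 rn; lia.
apply: hoare_seq (fun t => hget t cnorm = hget t3 cnorm + \sum_(l < hv t3 vn) F l /\
    forall i j, ~~ ((i == hv t3 vzero) && (j == hv t3 vzero)) -> hm t 23 i j = hm t3 23 i j) _ _ _.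
  apply: (@hoare_acc _ _ _ _ _ _ cnorm) => // l t4 ln t4l [t4v t4a _] t4s _.
  rewrite t3n in ln.
  have t40 : hv t4 vzero = 0%N by rewrite t4v.
  have t4i : hv t4 vi = k by rewrite t4v.
  have G4 : hget t4 (aG, vj, vi) = mxf (gram_dirs ME f) l k.
    by rewrite /hget /= t4l t4i t4a // t3a // t2G.
  have z4 : hget t4 czero = 0 by rewrite /hget /= t40 t4a // t3a.
  have bits : (rat_bits (hget t4 cnorm + F l) <= S)%N.
    rewrite t4s t3c add0r; have := big_ord_recr l F => /= <-.
    have [x _|z zE zb] := @sum_int_bound l.+1 F (n * (2 * rate ^ n * X)); first exact: FB.
    by apply: (bits_int SZ (ex_intro2 _ _ z zE zb)); apply: sumZ.
  have post x : x = hget t4 cnorm + F l -> hget (hsetm t4 cnorm x) cnorm = hget t4 cnorm + F l /\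
      forall i j, ~~ ((i == hv t3 vzero) && (j == hv t3 vzero)) ->
        hm (hsetm t4 cnorm x) 23 i j = hm t4 23 i j.
    move=> ->; split; first by rewrite /hget /= !eqxx.
    by move=> i j; rewrite t30 /= t40 => /negPf /= ->.
  apply: hoare_ifle; rewrite G4 z4 => sgn; apply: hoare_op; rewrite /= G4.
  - by rewrite -[X in _ - X]opprK opprK -[- mxf _ _ _]ler0_norm.
  - by apply: post; rewrite /F ler0_norm.
  - by rewrite -[mxf _ _ _]gtr0_norm.
  - by apply: post; rewrite /F gtr0_norm.
move=> t4 [t4v t4a _] [t4s _].
have t40 : hv t4 vzero = 0%N by rewrite t4v.
have t4i : hv t4 vi = k by rewrite t4v.
have C4 : hget t4 (acG, vzero, vi) = ((Mc *m gram_dirs ME f) 0 i0)%:~R.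
  by rewrite /hget /= t40 t4i t4a // t3a // t2C //; have := mxfE (Mc *m gram_dirs ME f) ord0 i0.
have N4 : hget t4 cnorm = (\sum_j `|gram_dirs ME f j i0|)%:~R.
  rewrite t4s t3c add0r t3n rmorph_sum; apply: eq_bigr => j _ /=.
  by rewrite /F (mxfE _ j i0) intr_norm.
have E : rop_fun RDiv (hget t4 (acG, vzero, vi)) (hget t4 cnorm) = ratio i0.
  by rewrite /= C4 N4 /ratio /= kmA f1.
apply: hoare_op; rewrite E.
  exact: ratio_bits.
move=> i j /=; rewrite t40 t4i; case: ifP => [/andP[_ /eqP->]|ij].
  by rewrite /rv insubT.
by rewrite t4a // t3a // t2q ij.
Qed.

End Directions.

(** The clause on [r] records that a proposed row is taken whenever it is a maximizer. *)
Definition select_post (q : 'I_m -> rat) (r0 : nat) t :=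
  (hv t vbest = m /\ forall i, q i <= 0) \/
  (exists i : 'I_m, [/\ hv t vbest = i, 0 < q i, forall k, q k <= q i &
     forall r : 'I_m, r = (r0 %% m)%N :> nat -> (forall k, q k <= q r) -> i = r]).

Lemma hoare_select s q : env s -> (forall i : 'I_m, hm s aq 0%N i = q i) ->
  (forall i, rat_bits (q i) <= S)%N -> (0 < m <= V)%N ->
  hoare S V select s (fun t => select_post q (hc s 0%N) t /\ hc t = (fun k => hc s k.+1)).
Proof.
move=> es hq qS /andP[m0 mV].
apply: hoare_seq (fun t => hget t cbest = 0) _ _ _.
  by apply: hoare_rat; [apply: bits0 SZ | rewrite /hget /= !eqxx].
move=> t1 f1 t1b; have e1 := env_frame f1 isT isT es.
have [[_ sn1 sm1 s01 _] [z1 _ _ _ _]] := e1; case: f1 => t1v t1a t1c.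
apply: hoare_seq (fun t => hv t vbest = m) _ _ _.
  by apply: hoare_int; rewrite /= sm1 s01 addn0 // /upd eqxx.
move=> t2 f2 t2b; have e2 := env_frame f2 isT isT e1.
have [[_ sn2 sm2 s02 _] [z2 _ _ _ _]] := e2; case: f2 => t2v t2a t2c.
(* The running maximum starts at 0, so only positive ratios ever replace the marker [m]. *)
pose I (k : nat) t := (hv t vbest = m /\ hm t 24 0%N 0%N = 0 /\
     forall i : 'I_m, (i < k)%N -> q i <= 0) \/
  (exists i : 'I_m, [/\ (i < k)%N, hv t vbest = i, hm t 24 0%N 0%N = q i, 0 < q i &
     forall l : 'I_m, (l < k)%N -> q l <= q i]).
apply: hoare_seq (I (hv t2 vm)) _ _ _.
  apply: hoare_for.
    by left; split=> //; split=> //; rewrite /= t2a //; move: t1b; rewrite /hget /= s01.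
  move=> k t3 km t3i [t3v t3a _] inv; rewrite sm2 in km; set i0 := Ordinal km.
  have t30 : hv t3 vzero = 0%N by rewrite t3v.
  have q3 : hget t3 (aq, vzero, vi) = q i0.
    by rewrite /hget /= t30 t3i t3a // t2a // t1a // (hq i0).
  have b3 : hget t3 cbest = hm t3 24 0%N 0%N by rewrite /hget /= t30.
  have ordS (l : 'I_m) : (l < k.+1)%N -> l = i0 \/ (l < k)%N.
    by rewrite ltnS leq_eqVlt => /orP[/eqP e|]; [left; apply: val_inj | right].
  apply: hoare_ifle; rewrite q3 b3 => cmp.
    apply: hoare_skip; case: inv => [[bm [b0 bq]]|[i [ik bi bq qi qmax]]].
      left; split=> //; split=> // l /ordS [->|/bq //]; by rewrite -b0.
    right; exists i; split=> //; first exact: leqW.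
    by move=> l /ordS [->|/qmax //]; rewrite -bq.
  apply: hoare_seq (fun t => hv t vbest = k) _ _ _.
    apply: hoare_int; rewrite /= t30 t3i addn0 ?/upd ?eqxx //.
    by apply: leq_trans mV; apply: ltnW.
  move=> t4 [t4v t4a _] t4b.
  have t40 : hv t4 vzero = 0%N by rewrite t4v.
  have E : rop_fun RAdd (hget t4 (aq, vzero, vi)) (hget t4 czero) = q i0.
    have -> : hget t4 (aq, vzero, vi) = q i0.
      by rewrite -q3 /hget /= !t4v // t4a.
    by rewrite /hget /= t40 t4a // t3a // z2 addr0.
  apply: hoare_op; rewrite E //; right; exists i0; split=> //=.
  - by rewrite t40.
  - case: inv => [[_ [b0 _]]|[i [_ _ bq qi _]]]; first by rewrite -b0.
    by apply: lt_trans qi _; rewrite -bq.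
  move=> l /ordS [->//|lk]; apply: ltW; apply: le_lt_trans cmp.
  case: inv => [[_ [b0 bq]]|[i [_ _ bq _ qmax]]]; first by rewrite b0 bq.
  by rewrite bq qmax.
move=> t3 f3 inv; have e3 := env_frame f3 isT isT e2.
have [[_ sn3 sm3 s03 _] [z3 _ _ _ _]] := e3; case: f3 => t3v t3a t3c; rewrite sm2 in inv.
have c3 : hc t3 = hc s by rewrite t3c // t2c // t1c.
apply: hoare_seq (fun t => hv t vr = (hc s 0 %% m)%N /\ hc t = (fun k => hc s k.+1)) _ _ _.
  split=> [|_] /=; first by rewrite sm3.
  by rewrite /upd eqxx sm3 c3.
move=> t4 [t4v t4a _] [t4r t4c].
have t40 : hv t4 vzero = 0%N by rewrite t4v.
have t4m : hv t4 vm = m by rewrite t4v.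
have t4b : hv t4 vbest = hv t3 vbest by rewrite t4v.
have t4B : hm t4 24 = hm t3 24 by rewrite t4a.
have rm : (hc s 0 %% m < m)%N by rewrite ltn_mod.
have t4q : hget t4 (aq, vzero, vr) = q (Ordinal rm).
  by rewrite /hget /= t40 t4r t4a // t3a // t2a // t1a // (hq (Ordinal rm)).
have B4 : hget t4 cbest = hm t3 24 0%N 0%N by rewrite /hget /= t40 t4B.
apply: hoare_iflt; rewrite t4b t4m => cmp; last first.
  apply: hoare_skip; split=> //; left; case: inv => [[bm [_ bq]]|[i [_ bi _ _ _]]].
    by split=> [|i]; [rewrite t4b | apply: bq].
  by move: cmp; rewrite bi leqNgt ltn_ord.
case: inv => [[bm _]|[i [_ bi bq qi qmax]]]; first by rewrite bm ltnn in cmp.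
apply: hoare_ifle; rewrite B4 t4q bq => le.
  apply: hoare_int; rewrite /= t40 t4r addn0; first by apply: leq_trans (ltnW rm) mV.
  split=> //; right; exists (Ordinal rm); rewrite /= /upd eqxx; split=> //.
  - exact: lt_le_trans qi le.
  - by move=> k; apply: le_trans le; apply: qmax.
  by move=> r rE _; apply: val_inj.
apply: hoare_skip; split=> //; right; exists i; split=> //; first by rewrite t4b.
  by move=> k; apply: qmax.
move=> r rE rmax; have e : r = Ordinal rm by apply: val_inj.
by move: le; rewrite -e ltNge rmax.
Qed.

Section Update.
Variables (G : 'M[int]_(n, m)) (GB : nat) (xb : 'I_n -> bool).

Definition next_bits (i : 'I_m) (j : 'I_n) : bool :=
  if G j i < 0 then true else if 0 < G j i then false else xb j.

Definition next_col i : 'cV[int]_n := \col_j (next_bits i j)%:R.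
(** At a feasible point the opposite inequality holds as well, so one comparison tests tightness. *)
Definition next_flags i (k : 'I_m) : bool := Me k 0 <= (ME *m next_col i) k 0.

Lemma hoare_update_pivot s (i : 'I_m) : env s -> holds s aG G ->
  (forall j : 'I_n, hm s ax j 0%N = (xb j)%:R) -> hv s vbest = i -> (hv s vcnt < V)%N ->
  hoare S V update s (fun t => [/\ holds t aflag (flag_col (next_flags i)),
    forall r k, hm t alog r k = if (r == hv s vcnt) && (k < m)%N
      then mxf (flag_col (next_flags i)) k 0%N else hm s alog r k,
    hv t vcnt = (hv s vcnt).+1 & hv t vdone = hv s vdone]).
Proof.
move=> es hG hx sb scnt; have [[_ sn sm s0 so] [sz so' hE he _]] := es.
have one a : (1 <= a.+1 ^ 3)%N by rewrite expn_gt0.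
have one_r : (1 <= rate ^ n.+1)%N by rewrite expn_gt0.
have Z1 : (1 <= Zb)%N by have := @Z_bound 1 1 1 1 (one _) isT (one _) one_r; lia.
have n1 : (n <= n.+1 ^ 3)%N by nia.
have X1 : (X <= X.+1 ^ 3)%N by nia.
have bits01 (b : bool) : (rat_bits b%:R <= S)%N.
  by apply: (bits_int SZ _ Z1); exists b%:Z; case: b.
apply: hoare_iflt; rewrite sb sm; last by rewrite leqNgt ltn_ord.
move=> _.
apply: hoare_seq (fun t => holds t ay (next_col i)) _ _ _.
  apply: (@hoare_weaken _ _ _ _ (fun t => forall r c, hm t ay r c =
     if has (fun k => (r == k) && (c == 0%N)) (iota 0 (hv s vn)) then mxf (next_col i) r c
     else hm s ay r c)); last first.
    by move=> t _ h r c rn; rewrite h has_iota_row sn rn ltnS leqn0 /= => ->.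
  apply: hoare_fill => k t1 kn tj [tv ta _]; rewrite sn in kn; set j0 := Ordinal kn.
  have t0 : hv t1 vzero = 0%N by rewrite tv.
  have tb : hv t1 vbest = i by rewrite tv.
  have z1 : hget t1 czero = 0 by rewrite /hget /= t0 ta.
  have G1 : hget t1 (aG, vj, vbest) = (G j0 i)%:~R.
    by rewrite /hget /= tj tb ta // hG //; apply: (mxfE G j0 i).
  have x1 : hget t1 (ax, vj, vzero) = (xb j0)%:R.
    by rewrite /hget /= tj t0 ta //; apply: (hx j0).
  have yE : mxf (next_col i) k 0%N = (next_bits i j0)%:R.
    have := mxfE (next_col i) j0 ord0 => /= ->; rewrite mxE.
    by case: (next_bits _ _).
  have post x : x = (next_bits i j0)%:R -> forall r c, hm (hsetm t1 (ay, vj, vzero) x) ay r c =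
      if (r == k) && (c == 0%N) then mxf (next_col i) r c else hm t1 ay r c.
    move=> -> r c /=; rewrite tj t0; case: ifP => // /andP[/eqP-> /eqP->].
    by rewrite yE.
  apply: hoare_ifle; rewrite z1 G1 ?ler0z ?ltrz0 => s1.
    apply: hoare_ifle; rewrite z1 G1 ?lerz0 ?ltr0z => s2.
      apply: hoare_op; rewrite /= x1 z1 addr0 //; apply: post.
      by rewrite /next_bits !ltNge s1 s2.
    apply: hoare_rat; first exact: (bits01 false).
    by apply: post; rewrite /next_bits ltNge s1 s2.
  apply: hoare_rat; first exact: (bits01 true).
  by apply: post; rewrite /next_bits s1.
move=> t1 f1 hy; have e1 := env_frame f1 isT isT es.
have [[_ sn1 sm1 s01 so1] [_ _ hE1 _ _]] := e1; case: f1 => t1v t1a _.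
apply: hoare_seq.
  apply: (hoare_matmul V SZ (A := X) (B := 1) (MX := ME) (MY := next_col i)) => //.
    by move=> k l; rewrite mxE; case: (next_bits _ _).
  by have := @Z_bound n 1 X 1 n1 isT X1 one_r; lia.
move=> t2 f2 hEy; have e2 := env_frame f2 isT isT e1.
have [[_ sn2 sm2 s02 so2] [_ _ _ he2 _]] := e2; case: f2 => t2v t2a _.
apply: hoare_seq (fun t => holds t aflag (flag_col (next_flags i))) _ _ _.
  apply: (@hoare_weaken _ _ _ _ (fun t => forall r c, hm t aflag r c =
     if has (fun k => (r == k) && (c == 0%N)) (iota 0 (hv t2 vm))
     then mxf (flag_col (next_flags i)) r c else hm t2 aflag r c)); last first.
    by move=> t _ h r c rm; rewrite h has_iota_row sm2 rm ltnS leqn0 /= => ->.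
  apply: hoare_fill => k t3 km ti [tv ta _]; rewrite sm2 in km; set k0 := Ordinal km.
  have t0 : hv t3 vzero = 0%N by rewrite tv.
  have E1 : hget t3 (ae, vi, vzero) = (Me k0 0)%:~R.
    by rewrite /hget /= ti t0 ta // he2 //; apply: (mxfE Me k0 ord0).
  have E2 : hget t3 (aEy, vi, vzero) = ((ME *m next_col i) k0 0)%:~R.
    by rewrite /hget /= ti t0 ta // hEy //; apply: (mxfE (ME *m next_col i) k0 ord0).
  have fE : mxf (flag_col (next_flags i)) k 0%N = (next_flags i k0)%:R.
    have := mxfE (flag_col (next_flags i)) k0 ord0 => /= ->; rewrite mxE.
    by case: (next_flags _ _).
  have post x : x = (next_flags i k0)%:R -> forall r c,
      hm (hsetm t3 (aflag, vi, vzero) x) aflag r c =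
      if (r == k) && (c == 0%N) then mxf (flag_col (next_flags i)) r c else hm t3 aflag r c.
    move=> -> r c /=; rewrite ti t0; case: ifP => // /andP[/eqP-> /eqP->].
    by rewrite fE.
  apply: hoare_ifle; rewrite E1 E2 ?ler_int ?ltr_int => cmp.
    by apply: hoare_rat; [apply: (bits01 true) | apply: post; rewrite /next_flags cmp].
  by apply: hoare_rat; [apply: (bits01 false) | apply: post; rewrite /next_flags leNgt cmp].
move=> t3 f3 hf; have e3 := env_frame f3 isT isT e2.
have [[_ sn3 sm3 s03 so3] [z3 _ _ _ _]] := e3; case: f3 => t3v t3a _.
have c3 : hv t3 vcnt = hv s vcnt by rewrite t3v // t2v // t1v.
apply: hoare_seq (fun t => forall r k, hm t alog r k =
   if (r == hv s vcnt) && (k < m)%N then mxf (flag_col (next_flags i)) k 0%N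
   else hm s alog r k) _ _ _.
  apply: (@hoare_weaken _ _ _ _ (fun t => forall r c, hm t alog r c =
     if has (fun k => (r == hv s vcnt) && (c == k)) (iota 0 (hv t3 vm))
     then mxf (flag_col (next_flags i)) c 0%N else hm t3 alog r c)); last first.
    by move=> t _ h r c; rewrite h has_iota_col sm3 t3a // t2a // t1a.
  apply: (@hoare_fill _ _ _ _ _ _ _ (fun k r c => (r == hv s vcnt) && (c == k))
    (fun r c => mxf (flag_col (next_flags i)) c 0%N)).
  move=> k t4 km ti [tv ta _]; rewrite sm3 in km.
  have t0 : hv t4 vzero = 0%N by rewrite tv.
  have tc : hv t4 vcnt = hv s vcnt by rewrite tv.
  have E : rop_fun RAdd (hget t4 (aflag, vi, vzero)) (hget t4 czero) =
      mxf (flag_col (next_flags i)) k 0%N.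
    have -> : hget t4 czero = 0 by rewrite /hget /= t0 ta.
    by rewrite /= addr0 /hget /= ti t0 ta // hf.
  apply: hoare_op; rewrite E.
    have := mxfE (flag_col (next_flags i)) (Ordinal km) ord0 => /= ->; rewrite mxE.
    by have := bits01 (next_flags i (Ordinal km)); case: (next_flags _ _).
  by move=> r c /=; rewrite ti tc; case: ifP => // /andP[_ /eqP->].
move=> t4 f4 hl; have e4 := env_frame f4 isT isT e3.
have [[_ _ _ _ so4] _] := e4; case: f4 => t4v t4a _.
have c4 : hv t4 vcnt = hv s vcnt by rewrite t4v.
apply: hoare_int; rewrite /= c4 so4 addn1 //; split=> //.
- by move=> r c *; rewrite /= t4a // hf.
- by rewrite /= /upd /= t4v // t3v // t2v // t1v.
Qed.

Lemma hoare_update_done s : env s -> hv s vbest = m -> (0 < V)%N ->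
  hoare S V update s (fun t => [/\ hv t vdone = 1%N, hv t vcnt = hv s vcnt &
    hm t = hm s]).
Proof.
move=> [[_ _ sm s0 so] _] sb V0; apply: hoare_iflt; rewrite sb sm ?ltnn // => _.
by apply: hoare_int; rewrite /= s0 so.
Qed.

End Update.
End Blocks.

(** * Input and output *)

(** The window of rows lets [A] and [B], which lie apart in the input, be stacked in one array; the
    cursor [vo] runs through the input. *)
Definition load (Z lo hi w : nat) : hprog :=
  HFor vi hi (HIfLt vi lo HSkip
    (HFor vj w (HSeq (HOp RAdd (Z, vi, vj) (0%N, vzero, vo) czero) (HInt IAdd vo vo vone)))).

(** The window of columns drops the flags of the equations, which are not part of the output. *)
Definition store (Z rows lo hi : nat) : hprog :=
  HFor vi rows (HFor vj hi (HIfLt vj lo HSkip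
    (HSeq (HOp RAdd (0%N, vzero, vo) (Z, vi, vj) czero) (HInt IAdd vo vo vone)))).

Section LoadStore.
Variables S V : nat.

Definition io_env s :=
  [/\ hv s vzero = 0%N, hv s vone = 1%N & hm s 2 0%N 0%N = 0].

Lemma hoare_load s Z lo hi w l h d o :
  Z \notin [:: 0; 2]%N -> all (fun v => v \notin [:: vi; vj; vo]) [:: lo; hi; w] -> io_env s ->
  hv s lo = l -> hv s hi = h -> hv s w = d -> hv s vo = o -> (o + (h - l) * d <= V)%N ->
  (forall k, rat_bits (hm s 0%N 0%N k) <= S)%N ->
  hoare S V (load Z lo hi w) s (fun t => hv t vo = (o + (h - l) * d)%N /\
    forall i j, hm t Z i j = if [&& l <= i, i < h & j < d]%N
      then hm s 0%N 0%N (o + (i - l) * d + j)%N else hm s Z i j).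
Proof.
rewrite inE => /norP[Z0]; rewrite inE => Z2.
move=> /and4P[nlo nhi nw _] [s0 s1 sz] slo shi sw so oV bits.
apply: (@hoare_weaken _ _ _ _ (fun t => hv t vo = (o + (hv s hi - l) * d)%N /\
    forall i j, hm t Z i j = if [&& l <= i, i < hv s hi & j < d]%N
      then hm s 0%N 0%N (o + (i - l) * d + j)%N else hm s Z i j));
  last by rewrite shi.
apply: (@hoare_for _ _ _ _ _ _ (fun k t => hv t vo = (o + (k - l) * d)%N /\
    forall i j, hm t Z i j = if [&& l <= i, i < k & j < d]%N
      then hm s 0%N 0%N (o + (i - l) * d + j)%N else hm s Z i j)).
  by split=> [|i j] /=; rewrite ?sub0n ?addn0 ?ltn0 ?andbF.
move=> k t; rewrite shi => kh ti [tv ta _] [to tZ].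
have tlo : hv t lo = l by rewrite tv.
have tw : hv t w = d by rewrite tv.
have t0 : hv t vzero = 0%N by rewrite tv.
have t1 : hv t vone = 1%N by rewrite tv.
have tz : hm t 2 0%N 0%N = 0 by rewrite ta // !inE ?negb_or eq_sym Z2.
have traw : hm t 0 = hm s 0 by rewrite ta // !inE ?negb_or eq_sym Z0.
apply: hoare_iflt; rewrite ti tlo => kl.
  apply: hoare_skip; split=> [|i j] /=; rewrite /upd /=.
    by rewrite to; congr (_ + _ * _)%N; lia.
  rewrite tZ; case: ifP => [/and3P[h1 h2 h3]|_]; case: ifP => [/and3P[g1 g2 g3]|_] //; lia.
apply: (@hoare_weaken _ _ _ _ (fun t' => hv t' vo = (o + (k - l) * d + hv t w)%N /\
    forall i j, hm t' Z i j = if [&& l <= i, i < k & j < d]%N || (i == k) && (j < hv t w)%N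
      then hm s 0%N 0%N (o + (i - l) * d + j)%N else hm s Z i j)).
  apply: (@hoare_for _ _ _ _ _ _ (fun k2 t' => hv t' vo = (o + (k - l) * d + k2)%N /\
    forall i j, hm t' Z i j = if [&& l <= i, i < k & j < d]%N || (i == k) && (j < k2)%N
      then hm s 0%N 0%N (o + (i - l) * d + j)%N else hm s Z i j)).
    by split=> [|i j] /=; rewrite /upd /= ?addn0 // andbF orbF.
  move=> k2 t2; rewrite tw => k2d tj [t2v t2a _] [t2o t2Z].
  have t2i : hv t2 vi = k by rewrite t2v.
  have t20 : hv t2 vzero = 0%N by rewrite t2v.
  have t21 : hv t2 vone = 1%N by rewrite t2v.
  have t2z : hm t2 2 0%N 0%N = 0 by rewrite t2a // inE eq_sym.
  have t2raw : hm t2 0 = hm s 0 by rewrite t2a // inE eq_sym.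
  have E : rop_fun RAdd (hget t2 (0%N, vzero, vo)) (hget t2 czero) =
      hm s 0%N 0%N (o + (k - l) * d + k2)%N.
    by rewrite /hget /= t20 t2o t2z addr0 t2raw.
  apply: hoare_seq (fun t' => forall i j, hm t' Z i j =
      if (i == k) && (j == k2) then hm s 0%N 0%N (o + (k - l) * d + k2)%N else hm t2 Z i j) _ _ _.
    by apply: hoare_op; rewrite E // => i j /=; rewrite t2i tj eqxx.
  move=> t3 [t3v t3a _] t3Z.
  have t3o : hv t3 vo = (o + (k - l) * d + k2)%N by rewrite t3v.
  have t31 : hv t3 vone = 1%N by rewrite t3v.
  have kV : (o + (k - l) * d + k2 + 1 <= V)%N.
    apply: leq_trans oV; rewrite -!addnA leq_add2l.
    have : ((k - l).+1 * d <= (h - l) * d)%N by rewrite leq_mul2r; apply/orP; right; lia.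
    by rewrite mulSn; lia.
  apply: hoare_int; rewrite /= t3o t31 //; split=> [|i j] /=; rewrite /upd /= ?addn1 ?addnS //.
  rewrite t3Z; case: (eqVneq i k) => [->|ik] /=; last by rewrite t2Z (negPf ik).
  case: (eqVneq j k2) => [->|jk]; first by rewrite ltnSn orbT.
  by rewrite t2Z eqxx /= ltnS [(j <= k2)%N]leq_eqVlt (negPf jk).
move=> t' _ [t'o t'Z]; split=> [|i j] /=; rewrite /upd /=.
  by rewrite t'o tw subSn // mulSn; lia.
rewrite t'Z tw ltnS [(i <= k)%N]leq_eqVlt.
by case: (eqVneq i k) => [->|ik] /=; rewrite ?ltnn ?andbF ?kl ?orbF.
Qed.

(** The clause on [k < o] allows stores to be chained, since all of them write to the same row. *)
Lemma hoare_store s Z rows lo hi p l h o :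
  Z \notin [:: 0; 2]%N -> all (fun v => v \notin [:: vi; vj; vo]) [:: rows; lo; hi] -> io_env s ->
  hv s rows = p -> hv s lo = l -> hv s hi = h -> hv s vo = o -> (o + p * (h - l) <= V)%N ->
  (forall i j, (i < p)%N -> (l <= j < h)%N -> (rat_bits (hm s Z i j) <= S)%N) ->
  hoare S V (store Z rows lo hi) s (fun t => [/\ hv t vo = (o + p * (h - l))%N,
    forall k, (k < o)%N -> hm t 0%N 0%N k = hm s 0%N 0%N k &
    forall i j, (i < p)%N -> (l <= j < h)%N ->
      hm t 0%N 0%N (o + i * (h - l) + (j - l))%N = hm s Z i j]).
Proof.
rewrite inE => /norP[Z0]; rewrite inE => Z2.
move=> /and4P[nr nlo nhi _] [s0 s1 sz] sr slo shi so oV bits.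
set d := (h - l)%N in oV *.
apply: (@hoare_weaken _ _ _ _ (fun t => [/\ hv t vo = (o + hv s rows * d)%N,
    forall k, (k < o)%N -> hm t 0%N 0%N k = hm s 0%N 0%N k &
    forall i j, (i < hv s rows)%N -> (l <= j < h)%N ->
      hm t 0%N 0%N (o + i * d + (j - l))%N = hm s Z i j])); last by rewrite sr.
apply: (@hoare_for _ _ _ _ _ _ (fun r t => [/\ hv t vo = (o + r * d)%N,
    forall k, (k < o)%N -> hm t 0%N 0%N k = hm s 0%N 0%N k &
    forall i j, (i < r)%N -> (l <= j < h)%N ->
      hm t 0%N 0%N (o + i * d + (j - l))%N = hm s Z i j])).
  by split=> //=; rewrite ?mul0n ?addn0.
move=> r t; rewrite sr => rp ti [tv ta _] [to tk tZ].
have tlo : hv t lo = l by rewrite tv.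
have thi : hv t hi = h by rewrite tv.
have t0 : hv t vzero = 0%N by rewrite tv.
have t1 : hv t vone = 1%N by rewrite tv.
have tz : hm t 2 0%N 0%N = 0 by rewrite ta.
have tZs : hm t Z = hm s Z by rewrite ta // !inE ?negb_or Z0.
apply: (@hoare_weaken _ _ _ _ (fun t' => [/\ hv t' vo = (o + r * d + (hv t hi - l))%N,
    forall k, (k < o)%N -> hm t' 0%N 0%N k = hm s 0%N 0%N k &
    forall i j, (i < r)%N && (l <= j < h)%N || (i == r) && (l <= j < hv t hi)%N ->
      hm t' 0%N 0%N (o + i * d + (j - l))%N = hm s Z i j])); last first.
  move=> t' _ []; rewrite thi => t'o t'k t'Z; split=> //=.
    by rewrite /upd /= t'o mulSn; lia.
  move=> i j ir jh; apply: t'Z; rewrite jh !andbT.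
  by move: ir; rewrite ltnS leq_eqVlt orbC.
apply: (@hoare_for _ _ _ _ _ _ (fun c t' => [/\ hv t' vo = (o + r * d + (c - l))%N,
    forall k, (k < o)%N -> hm t' 0%N 0%N k = hm s 0%N 0%N k &
    forall i j, (i < r)%N && (l <= j < h)%N || (i == r) && (l <= j < c)%N ->
      hm t' 0%N 0%N (o + i * d + (j - l))%N = hm s Z i j])).
  split=> //=; rewrite /upd /= ?sub0n ?addn0 // => i j.
  by rewrite ltn0 !andbF orbF => /andP[]; apply: tZ.
move=> c t2; rewrite thi => ch tj [t2v t2a _] [t2o t2k t2Z].
have t2i : hv t2 vi = r by rewrite t2v.
have t20 : hv t2 vzero = 0%N by rewrite t2v.
have t21 : hv t2 vone = 1%N by rewrite t2v.
have t2lo : hv t2 lo = l.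
  by rewrite t2v // !inE ?negb_or; move: nlo; rewrite !inE ?negb_or => /and3P[_ -> ->].
have t2z : hm t2 2 0%N 0%N = 0 by rewrite t2a.
have t2Zs : hm t2 Z = hm s Z by rewrite t2a // !inE ?negb_or Z0.
apply: hoare_iflt; rewrite tj t2lo => cl.
  apply: hoare_skip; split=> //=.
    by rewrite /upd /= t2o; congr (_ + _)%N; lia.
  move=> i j h1; apply: t2Z; case/orP: h1 => [->//|/andP[_ /andP[h1 h2]]]; exfalso; lia.
have lcd : (c - l < d)%N by rewrite /d; lia.
(* Cells already written lie strictly before the cursor. *)
have below i j : (i < r)%N && (l <= j < h)%N || (i == r) && (l <= j < c)%N ->
    (o + i * d + (j - l) < o + r * d + (c - l))%N.
  case/orP => [/andP[ir /andP[lj jh]]|/andP[/eqP-> /andP[lj jc]]]; last by lia.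
  have : (i.+1 * d <= r * d)%N by rewrite leq_mul2r ir orbT.
  by rewrite mulSn; move: (i * d)%N (r * d)%N => a b; rewrite /d in lcd *; lia.
have E : rop_fun RAdd (hget t2 (Z, vi, vj)) (hget t2 czero) = hm s Z r c.
  by rewrite /hget /= t20 t2i tj t2z addr0 t2Zs.
apply: hoare_seq (fun t' => forall k, hm t' 0%N 0%N k =
    if k == (o + r * d + (c - l))%N then hm s Z r c else hm t2 0%N 0%N k) _ _ _.
  by apply: hoare_op; rewrite E; [apply: bits; rewrite // cl | move=> k /=; rewrite t20 t2o].
move=> t3 [t3v t3a _] t3r.
have t3o : hv t3 vo = (o + r * d + (c - l))%N by rewrite t3v.
have t31 : hv t3 vone = 1%N by rewrite t3v.
have cV : (o + r * d + (c - l) + 1 <= V)%N.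
  apply: leq_trans oV; have : (r.+1 * d <= p * d)%N by rewrite leq_mul2r rp orbT.
  by rewrite mulSn; move: (r * d)%N (p * d)%N => a b; lia.
apply: hoare_int; rewrite /= t3o t31 //; split=> [|k ko|i j h1] /=; rewrite ?/upd /=.
- by rewrite addn1; lia.
- by rewrite t3r ifN ?t2k //; apply/eqP; lia.
have [jE|jE] := boolP ((i == r) && (j == c)).
  by case/andP: jE => /eqP -> /eqP ->; rewrite t3r eqxx.
have h2 : (i < r)%N && (l <= j < h)%N || (i == r) && (l <= j < c)%N.
  case/orP: h1 => [->//|/andP[ir /andP[lj jc]]]; move: jE; rewrite ir lj /= => jc'.
  by apply/orP; right; rewrite ltn_neqAle jc' -ltnS.
rewrite t3r ifN ?t2Z // neq_ltn below //.
Qed.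

End LoadStore.

(** * Pivots in terms of the integral Gram data *)

(** The determinant of the Gram matrix is a square, so scaling by it never flips the sign of a
    direction. *)
Lemma square_gram_det_gt0 (q n : nat) (S : 'M[int]_(q, n)) : q = n ->
  row_free (map_mx intr S : 'M[rat]_(q, n)) -> 0 < \det (S^T *m S).
Proof.
move=> e; subst n; rewrite row_free_unit unitmxE det_mulmx det_tr det_map_mx => u.
rewrite lt_def -expr2 sqr_ge0 andbT sqrf_eq0.
by apply: contraTneq u => ->; rewrite rmorph0 unitr0.
Qed.

Lemma col_mulmx (K : pzRingType) p q r i (A : 'M[K]_(p, q)) (C : 'M[K]_(q, r)) :
  col i (A *m C) = A *m col i C.
Proof. by apply/colP => k; rewrite !mxE; apply: eq_bigr => l _; rewrite mxE. Qed.

Section GramBasis.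
Variables (mA mB n : nat) (lp : LP mA mB n).
Implicit Types (T : {set 'I_mB}).

Definition lpM : 'M[int]_(mA + mB, n) := col_mx (lpA lp) (lpB lp).
Definition lpe : 'cV[int]_(mA + mB) := col_mx (lpb lp) (lpd lp).
Definition lprow : 'rV[int]_n := (lpc lp)^T.

Definition row_flags T (i : 'I_(mA + mB)) : bool :=
  match split i with inl _ => true | inr k => k \in T end.

Lemma row_flagsl T a : row_flags T (lshift mB a) = true.
Proof. by rewrite /row_flags (unsplitK (inl a)). Qed.

Lemma row_flagsr T b : row_flags T (rshift mA b) = (b \in T).
Proof. by rewrite /row_flags (unsplitK (inr b)). Qed.

Lemma row_flags_inj T T' : row_flags T =1 row_flags T' -> T = T'.
Proof. by move=> e; apply/setP => b; rewrite -!row_flagsr e. Qed.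

Lemma gram_basis T : gram lpM (row_flags T) = (basis_matrix lp T)^T *m basis_matrix lp T.
Proof.
apply/matrixP => i j; rewrite !mxE !big_split_ord /=; congr (_ + _).
  by apply: eq_bigr => a _; rewrite !mxE row_flagsl !(unsplitK (inl a)) mul1r.
transitivity (\sum_(b in T) lpB lp b i * lpB lp b j).
  rewrite [RHS]big_mkcond; apply: eq_bigr => b _.
  rewrite !mxE row_flagsr !(unsplitK (inr b)); case: (b \in T); rewrite ?mul1r //.
  by rewrite !mul0r.
by rewrite big_enum_val; apply: eq_bigr => k _; rewrite !mxE !(unsplitK (inr k)) !mxE.
Qed.

Variable T : {set 'I_mB}.
Hypothesis bT : basis lp T.

Let f := row_flags T.
Let J := gram_adj lpM f.
Let d := gram_det lpM f.
Let G := gram_dirs lpM f.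
Let Sm := basis_matrix lp T.

Lemma basis_row_free : row_free (map_mx intr Sm : 'M[rat]_(_, _)).
Proof. by case: bT => cT rk; rewrite /row_free rk cT. Qed.

Lemma gram_det_gt0 : 0 < d.
Proof.
rewrite /d /gram_det fl_det gram_basis; apply: square_gram_det_gt0 basis_row_free.
by case: bT.
Qed.

(** The basis matrix is square only through the equation in [basis], so it is not inverted: its
    transpose kills the difference of the two sides, and its rows are independent. *)
Lemma basis_gram_inverse : Sm *m J *m Sm^T = d%:M.
Proof.
have NJ : Sm^T *m Sm *m J = d%:M by rewrite -gram_basis; case: (fl_inverse (gram lpM f)).
apply/eqP; rewrite -subr_eq0; set K := _ - _.
have KS : K^T *m Sm = 0.
  apply: trmx_inj; rewrite trmx_mul trmxK trmx0 /K mulmxBr !mulmxA NJ.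
  by rewrite mul_scalar_mx mul_mx_scalar subrr.
have : map_mx intr (K^T) = 0 :> 'M[rat]_(_, _).
  apply: (row_free_inj basis_row_free).
  by rewrite mul0mx -map_mxM KS map_mx0.
move/matrixP => K0; apply/eqP/matrixP => i j; apply: (@intr_inj rat).
by have := K0 j i; rewrite !mxE.
Qed.

Lemma lpM_rowl a : row (lshift mB a) lpM = row (lshift #|T| a) Sm.
Proof. by apply/rowP => j; rewrite !mxE !(unsplitK (inl a)). Qed.

Lemma lpM_rowr b (hb : b \in T) :
  row (rshift mA b) lpM = row (rshift mA (enum_rank_in hb b)) Sm.
Proof.
by apply/rowP => j; rewrite !mxE (unsplitK (inr b)) (unsplitK (inr _)) !mxE enum_rankK_in.
Qed.

Lemma gram_dirs_col i : f i -> col i G = J *m (row i lpM)^T.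
Proof.
move=> fi; rewrite /G /gram_dirs col_mulmx; congr (_ *m _).
by apply/colP => j; rewrite !mxE fi mul1r.
Qed.

Lemma row_gram p q : row p Sm *m (J *m (row q Sm)^T) = (d *+ (p == q))%:M.
Proof.
rewrite tr_row -!col_mulmx -row_mul mulmxA basis_gram_inverse.
by apply/matrixP => i j; rewrite !ord1 !mxE mulr1n.
Qed.

Lemma gram_dirs_A b : b \in T -> lpA lp *m col (rshift mA b) G = 0.
Proof.
move=> hb; have fb : f (rshift mA b) by rewrite /f row_flagsr.
rewrite (gram_dirs_col fb) (lpM_rowr hb).
apply/row_matrixP => a; rewrite row_mul row0.
have -> : row a (lpA lp) = row (lshift mB a) lpM by rewrite rowKu.
by rewrite lpM_rowl row_gram eq_lrshift mulr0n; apply/matrixP => i j; rewrite !mxE mul0rn.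
Qed.

Lemma gram_dirs_B b k : b \in T -> k \in T ->
  (lpB lp *m col (rshift mA b) G) k 0 = d *+ (k == b).
Proof.
move=> hb hk; have fb : f (rshift mA b) by rewrite /f row_flagsr.
rewrite (gram_dirs_col fb) (lpM_rowr hb).
transitivity ((row k (lpB lp) *m (J *m (row (rshift mA (enum_rank_in hb b)) Sm)^T)) 0 0).
  by rewrite -row_mul [RHS]mxE.
have -> : row k (lpB lp) = row (rshift mA k) lpM by rewrite rowKd.
rewrite (lpM_rowr hk) row_gram mxE eqxx mulr1n (inj_eq (@rshift_inj _ _)).
congr (_ *+ nat_of_bool _); apply/eqP/eqP => [/(congr1 enum_val)|kb].
  by rewrite !enum_rankK_in.
by apply: enum_val_inj; rewrite !enum_rankK_in.
Qed.

Variable (R : realFieldType).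

Definition gram_direction b : 'cV[R]_n := - map_mx intr (col (rshift mA b) G).

Lemma gram_basis_direction b : b \in T -> basis_direction lp T b (gram_direction b).
Proof.
have BE k : Bmul lp (gram_direction b) k 0 = - ((lpB lp *m col (rshift mA b) G) k 0)%:~R.
  by rewrite BmulN /Bmul -map_mxM mxE.
move=> hb; split=> //.
- by rewrite AmulN /Amul -map_mxM gram_dirs_A // map_mx0 oppr0.
- by rewrite BE gram_dirs_B // eqxx mulr1n oppr_lt0 ltr0z gram_det_gt0.
by move=> k kT /negPf kb; rewrite BE gram_dirs_B // kb mulr0n oppr0.
Qed.

Lemma gram_xE (x : 'cV[R]_n) j : basic_solution lp T x ->
  x j 0 = ratr (gram_x lpM lpe f j).
Proof.
move=> [Ax Bx]; have d0 : (d%:~R : R) != 0 by rewrite intr_eq0 gt_eqF // gram_det_gt0.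
rewrite /gram_x fmorph_div /= !ratr_int; apply: (mulIf d0); rewrite divfK //.
have JN : J *m gram lpM f = d%:M by case: (fl_inverse (gram lpM f)).
(* Only flagged rows survive the weights, and on these [x] satisfies its constraints with
   equality. *)
have Mx : map_mx intr (gram_rows lpM f) *m (map_mx intr lpM *m x) =
    map_mx intr (gram_rows lpM f) *m map_mx intr lpe :> 'cV[R]_n.
  apply/matrixP => i k; rewrite !mxE !big_split_ord /= ord1; congr (_ + _).
    apply: eq_bigr => a _; rewrite [X in _ * X]mxE [X in _ = _ * X]mxE col_mxEu; congr (_ * _).
    have /matrixP /(_ a 0) := Ax; rewrite !mxE => <-.
    by apply: eq_bigr => l _; rewrite !mxE (unsplitK (inl a)).
  apply: eq_bigr => b _; rewrite mxE mxE /f row_flagsr.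
  case: (boolP (b \in T)) => hb; last by rewrite mul0r rmorph0 !mul0r.
  congr (_ * _); rewrite [RHS]mxE col_mxEd -/(rhs R lp b) -(Bx b hb) /Bmul !mxE.
  by apply: eq_bigr => l _; rewrite !mxE (unsplitK (inr b)).
have E : d%:~R *: x = map_mx intr (gram_sol lpM f lpe).
  rewrite -mul_scalar_mx -map_scalar_mx -JN /gram_sol !map_mxM -/J.
  by rewrite -!mulmxA Mx.
by rewrite mulrC; have := congr1 (fun u : 'cV_n => u j 0) E; rewrite !mxE.
Qed.

Let rat_ratio := ratio mA lpM lprow f.

Lemma ratio_notin i : (forall b, b \in T -> i != rshift mA b) -> rat_ratio i = 0.
Proof.
move=> ni; rewrite /rat_ratio /ratio; case: ifP => // /andP[mi fi].
case: (split_ordP i) ni fi mi => [a -> _ _|b -> ni]; first by rewrite /= leqNgt ltn_ord.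
by rewrite /f row_flagsr => /ni; rewrite eqxx.
Qed.

Lemma steepness_ratio b : b \in T ->
  steepness lp (gram_direction b) = - ratr (rat_ratio (rshift mA b)).
Proof.
move=> hb; rewrite /rat_ratio /ratio /= leq_addr /f row_flagsr hb /= /steepness.
rewrite fmorph_div /= !ratr_int -mulNr; congr (_ / _).
  rewrite /gram_direction objN /objective /dotv map_trmx -map_mxM mxE.
  congr (- _%:~R); rewrite -/f -/G !mxE; apply: eq_bigr => j _.
  by rewrite !mxE.
rewrite rmorph_sum; apply: eq_bigr => j _ /=.
by rewrite !mxE normrN intr_norm.
Qed.

Lemma objective_ratio b : b \in T ->
  (objective lp (gram_direction b) < 0) = (0 < rat_ratio (rshift mA b)).
Proof.
move=> hb; have [_ _ gb _] := gram_basis_direction hb.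
have g0 : gram_direction b <> 0.
  by move=> e; move: gb; rewrite e -(scale0r (0 : 'cV[R]_n)) BmulZ mul0r ltxx.
have := steepness_ratio hb; rewrite /steepness => e.
rewrite -[LHS](pmulr_llt0 _ (_ : 0 < (norm1 (gram_direction b))^-1)).
  by rewrite e oppr_lt0 ltr0q.
by rewrite invr_gt0 norm1_gt0.
Qed.

End GramBasis.

Arguments row_flags mA {mB} T i.

Section PivotRatio.
Variables (R : realFieldType) (mA mB n : nat) (lp : LP mA mB n).
Hypotheses (zo : zero_one_polytope R lp) (nd : nondegenerate_polytope R lp).
Variables (T : {set 'I_mB}) (x : 'cV[R]_n).
Hypothesis bx : basic_feasible lp T x.

Let f := row_flags mA T.
Let bT : basis lp T. Proof. by case: bx. Qed.

Definition basis_bits (j : 'I_n) : bool := gram_x (lpM lp) (lpe lp) f j == 1.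

(** At a vertex the rational [gram_x] has image 0 or 1 in [R], so it is itself 0 or 1: the vertex is
    known without leaving [rat]. *)
Lemma gram_x01 j : gram_x (lpM lp) (lpe lp) f j = (basis_bits j)%:R /\
  x j 0 = (basis_bits j)%:R.
Proof.
have [_ bs _] := bx; rewrite (gram_xE bT j bs) /basis_bits -/f.
have [_ /(_ x (basic_vertex bx) j)] := zo; rewrite (gram_xE bT j bs) -/f.
move: (gram_x _ _ _ _) => q [] /eqP; rewrite ?fmorph_eq0 ?fmorph_eq1 => /eqP ->.
  by rewrite [0 == 1]eq_sym oner_eq0; split=> //; rewrite rmorph0.
by rewrite eqxx; split=> //; rewrite rmorph1.
Qed.

Definition pivot_flags := next_flags (lpM lp) (lpe lp) (gram_dirs (lpM lp) f) basis_bits.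
Let rat_ratio := ratio mA (lpM lp) (lprow lp) f.

Lemma pivot_flagsE b : b \in T ->
  pivot_flags (rshift mA b) =1 row_flags mA (tight lp (next_vertex x (gram_direction lp T R b))).
Proof.
move=> hb; have gd := gram_basis_direction bT R hb.
have [j [by' _ _ _ _]] := pivot_step zo nd bx gd; have [_ _ [Ay By]] := by'.
set y := next_vertex _ _ in by' Ay By *.
set nc := next_col (gram_dirs (lpM lp) f) basis_bits (rshift mA b).
(* The next vertex is integral, so its constraints can be checked over [int]. *)
have yE : y = map_mx intr nc.
  have gE l : gram_direction lp T R b l 0 = - (gram_dirs (lpM lp) f l (rshift mA b))%:~R.
    by rewrite 3!mxE.
  have ncE l : nc l 0 = (next_bits (gram_dirs (lpM lp) f) basis_bits (rshift mA b) l)%:R.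
    by rewrite mxE.
  apply/colP => l; rewrite [LHS]mxE gE [RHS]mxE ncE /next_bits.
  rewrite oppr_gt0 oppr_lt0 ltrz0 ltr0z.
  by case: ifP => // _; case: ifP => // _; rewrite (gram_x01 l).2; case: (basis_bits l).
have AE : lpA lp *m nc = lpb lp.
  apply/colP => k; apply: (@intr_inj R); have /colP /(_ k) := Ay.
  by rewrite yE /Amul -map_mxM [LHS]mxE [RHS]mxE.
have BE k : Bmul lp y k 0 = ((lpB lp *m nc) k 0)%:~R by rewrite yE /Bmul -map_mxM mxE.
move=> k; rewrite /pivot_flags /next_flags -/nc /lpM mul_col_mx /lpe.
case: (split_ordP k) => [a ->|c ->]; first by rewrite !col_mxEu AE lexx row_flagsl.
rewrite !col_mxEd row_flagsr inE BE eqr_int eq_le -[RHS]andbC.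
by have := By c; rewrite BE ler_int => ->; rewrite andbT.
Qed.

Lemma next_vertex_scale a g : 0 < a -> next_vertex x (a *: g) = next_vertex x g.
Proof. by move=> a0; apply/colP => j; rewrite !mxE pmulr_rgt0 // pmulr_rlt0. Qed.

Lemma ratio_gt0P i : 0 < rat_ratio i -> exists2 b, b \in T & i = rshift mA b.
Proof.
move=> ri; apply: NNPP => nb; have := ri; rewrite /rat_ratio ratio_notin ?ltxx // => b hb.
by apply/eqP => e; apply: nb; exists b.
Qed.

(** Up to positive scaling every edge-direction at [x] is a [gram_direction], so comparing with all
    edges means comparing finitely many ratios. *)
Lemma steepest_ratio b : b \in T -> 0 < rat_ratio (rshift mA b) ->
  steepest_edge lp x (gram_direction lp T R b) <->
  forall k, rat_ratio k <= rat_ratio (rshift mA b).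
Proof.
move=> hb rb; have gd := gram_basis_direction bT R hb.
have le b' : b' \in T ->
  (steepness lp (gram_direction lp T R b) <= steepness lp (gram_direction lp T R b')) =
  (rat_ratio (rshift mA b') <= rat_ratio (rshift mA b)).
  by move=> hb'; rewrite !steepness_ratio // lerN2 ler_rat.
split=> [[_ st] k|rmax].
  case: (classic (exists2 b', b' \in T & k = rshift mA b')) => [[b' hb' ->]|nb].
    by rewrite -le //; apply: st; apply: basis_direction_edge bx _ => //; apply: gram_basis_direction.
  apply: le_trans (ltW rb); rewrite /rat_ratio ratio_notin // => b' hb'.
  by apply/eqP => e; apply: nb; exists b'.
split; first exact: basis_direction_edge bx gd.
move=> h eh; have [|b' hd] := edge_basis_direction nd bx _ eh.
  by move=> b' hb'; exists (gram_direction lp T R b'); apply: gram_basis_direction.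
have [hb' _ _ _] := hd.
have [a a0 ->] := basis_direction_unique bT (gram_basis_direction bT R hb') hd.
by rewrite steepnessZ // le.
Qed.

(** The pivot rule over [R] is turned into comparisons of rationals, which the machine can
    decide. *)
Lemma pivot_ratioP T' : steepest_descent_pivot R lp T T' <->
  exists i, [/\ 0 < rat_ratio i, forall k, rat_ratio k <= rat_ratio i &
    pivot_flags i =1 row_flags mA T'].
Proof.
rewrite (pivotP zo nd _ bx); split=> [[b [g [gd sg cg ->]]]|[i [ri rmax fi]]].
  have [hb _ _ _] := gd.
  have [a a0 gE] := basis_direction_unique bT (gram_basis_direction bT R hb) gd.
  have rb : 0 < rat_ratio (rshift mA b).
    rewrite -(objective_ratio bT R hb); move: cg.
    by rewrite gE objZ pmulr_rlt0.
  exists (rshift mA b); split=> //; last by move=> k; rewrite gE next_vertex_scale // pivot_flagsE.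
  apply/(steepest_ratio hb rb); rewrite -[gram_direction _ _ _ _]scale1r -(mulVf (lt0r_neq0 a0)).
  by rewrite -scalerA -gE; apply: steepest_scale; rewrite ?invr_gt0.
have [b hb iE] := ratio_gt0P ri; rewrite iE in ri rmax fi.
exists b, (gram_direction lp T R b); split.
- exact: gram_basis_direction.
- exact/(steepest_ratio hb ri).
- by rewrite objective_ratio.
by apply: (@row_flags_inj mA) => k; rewrite -fi pivot_flagsE.
Qed.

Lemma pivot_exists i : 0 < rat_ratio i -> (forall k, rat_ratio k <= rat_ratio i) ->
  exists2 T', steepest_descent_pivot R lp T T' & pivot_flags i =1 row_flags mA T'.
Proof.
move=> ri rmax; have [b hb iE] := ratio_gt0P ri.
exists (tight lp (next_vertex x (gram_direction lp T R b))).
  by apply/pivot_ratioP; exists i; split=> //; rewrite iE; apply: pivot_flagsE.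
by rewrite iE; apply: pivot_flagsE.
Qed.

Lemma no_pivot_basis_optimal : (forall T', ~ steepest_descent_pivot R lp T T') -> optimal lp x.
Proof.
apply: (no_pivot_optimal zo nd bx) => b hb.
by exists (gram_direction lp T R b); apply: gram_basis_direction.
Qed.

Lemma rational_solution (y : 'cV[rat]_n) : (forall j, y j 0 = (basis_bits j)%:R) ->
  basic_solution lp T y /\ map_mx ratr y = x.
Proof.
move=> yE; have xE : map_mx ratr y = x.
  by apply/colP => j; rewrite mxE yE ratr_nat (gram_x01 j).2.
split=> //; have [_ [Ax Bx] _] := bx.
have rinj : injective (ratr : rat -> R) := fmorph_inj _.
have mapM p (N : 'M[int]_(p, n)) : map_mx intr N *m x = map_mx ratr (map_mx intr N *m y).
  by rewrite map_mxM map_ratr_intr xE.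
split=> [|i hi].
  apply/colP => k; apply: rinj; have /colP /(_ k) := Ax.
  by rewrite /Amul mapM [LHS]mxE => ->; rewrite !mxE ratr_int.
apply: rinj.
by have := Bx i hi; rewrite /Bmul mapM mxE /rhs ratr_int.
Qed.

End PivotRatio.

(** * Runs of the program *)

Section Picks.
Variables (mA mB n : nat) (lp : LP mA mB n).
Implicit Types (T : {set 'I_mB}) (p : seq {set 'I_mB}) (o : nat -> nat).

Definition basis_ratio T : 'I_(mA + mB) -> rat := ratio mA (lpM lp) (lprow lp) (row_flags mA T).

(* The pivot T -> T' made by the program when Choose answers r: the row r is
   preferred whenever it is a candidate. *)
Definition picks T (r : nat) T' := exists i,
  [/\ 0 < basis_ratio T i, forall k, basis_ratio T k <= basis_ratio T i,
      forall j : 'I_(mA + mB), j = (r %% (mA + mB))%N :> nat ->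
        (forall k, basis_ratio T k <= basis_ratio T j) -> i = j &
      pivot_flags lp T i =1 row_flags mA T'].

Fixpoint follows o T p :=
  if p is T' :: p' then picks T (o 0%N) T' /\ follows (fun k => o k.+1) T' p' else True.

Lemma follows_rcons o T p T' : follows o T p -> picks (last T p) (o (size p)) T' ->
  follows o T (rcons p T').
Proof. by elim: p T o => [|U p IH] T o //= [h1 h2] h3; split=> //; apply: IH. Qed.

Lemma chain_rcons (E : {set 'I_mB} -> {set 'I_mB} -> Prop) T p T' :
  chain E T p -> E (last T p) T' -> chain E T (rcons p T').
Proof. by elim: p T => [|U p IH] T //= [h1 h2] h3; split=> //; apply: IH. Qed.

Variable R : realFieldType.
Hypotheses (zo : zero_one_polytope R lp) (nd : nondegenerate_polytope R lp).

(** Let the choices be the rows on which the given run pivots: each is a maximizer, so it is taken,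
    and it determines the next basis. *)
Lemma run_choices T x p : basic_feasible (R := R) lp T x -> complete_run R lp T p ->
  exists o, forall p', follows o T p' -> complete_run R lp T p' -> p' = p.
Proof.
elim: p T x => [|U p IH] T x bx [/= cp np].
  exists (fun=> 0%N) => -[|U p'] //= _ [[TU _] _]; by case: (np U).
have [TU Up] := cp; have [y by' _] := pivot_descent zo nd bx TU.
have [i [ri rmax fi]] := (pivot_ratioP zo nd bx U).1 TU.
have [o ho] := IH U y by' (conj Up np).
exists (fun k => if k is k'.+1 then o k' else i : nat) => -[|U' p'] /=.
  by move=> _ [_ np']; case: (np' U).
move=> [[j [_ _ jpref fj]] fo] [[TU' cp'] np'].
have ji : j = i by apply: jpref => //; rewrite modn_small.
have UU : U' = U by apply: (@row_flags_inj mA) => k; rewrite -fi -fj ji.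
by subst U'; congr (_ :: _); apply: ho.
Qed.

End Picks.

Section Iteration.
Variables (R : realFieldType) (mA mB n : nat) (lp : LP mA mB n).
Hypotheses (zo : zero_one_polytope R lp) (nd : nondegenerate_polytope R lp).
Variables S V Zb X : nat.
Hypothesis SZ : (nat_bits Zb + nat_bits Zb <= S)%N.
Let m := (mA + mB)%N.
Hypotheses (bE : bounded_by X (lpM lp)) (be : bounded_by X (lpe lp)) (bc : bounded_by X (lprow lp)).
Hypothesis Z_large :
  (4 * (n.+1 ^ 3 * m.+1 * X.+1 ^ 3 * fl_rate n (m * (X * X)) ^ n.+1) <= Zb)%N.
Hypothesis mV : (0 < m <= V)%N.

Let lp_env := env mA (lpM lp) (lpe lp) (lprow lp).

(** Each iteration consumes exactly one choice, so that the choices line up with the pivots in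
    [follows]. *)
Definition iteration_post (T : {set 'I_mB}) s t :=
  [/\ lp_env t, hc t = (fun k => hc s k.+1) &
  (exists T', [/\ steepest_descent_pivot R lp T T', picks lp T (hc s 0%N) T',
     holds t aflag (flag_col (row_flags mA T')),
     forall r k, hm t alog r k = if (r == hv s vcnt) && (k < m)%N
       then mxf (flag_col (row_flags mA T')) k 0%N else hm s alog r k &
     hv t vcnt = (hv s vcnt).+1 /\ hv t vdone = hv s vdone]) \/
  ((forall T', ~ steepest_descent_pivot R lp T T') /\
   [/\ hv t vdone = 1%N, hv t vcnt = hv s vcnt, hm t alog = hm s alog &
    forall j : 'I_n, hm t ax j 0%N = (basis_bits lp T j)%:R])].

Lemma hoare_iteration s T x : basic_feasible (R := R) lp T x -> lp_env s ->
  holds s aflag (flag_col (row_flags mA T)) -> (hv s vcnt < V)%N ->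
  hoare S V iteration s (iteration_post T s).
Proof.
move=> bx es hf scnt; set f := row_flags mA T in hf.
have x01 j : gram_x (lpM lp) (lpe lp) f j = 0 \/ gram_x (lpM lp) (lpe lp) f j = 1.
  by rewrite (gram_x01 zo bx j).1; case: basis_bits; [right | left].
apply: (@hoare_weaken _ _ _ _ (fun t => hc t = (fun k => hc s k.+1) /\
  ((exists T', [/\ steepest_descent_pivot R lp T T', picks lp T (hc s 0%N) T',
     holds t aflag (flag_col (row_flags mA T')),
     forall r k, hm t alog r k = if (r == hv s vcnt) && (k < m)%N
       then mxf (flag_col (row_flags mA T')) k 0%N else hm s alog r k &
     hv t vcnt = (hv s vcnt).+1 /\ hv t vdone = hv s vdone]) \/
  ((forall T', ~ steepest_descent_pivot R lp T T') /\
   [/\ hv t vdone = 1%N, hv t vcnt = hv s vcnt, hm t alog = hm s alog &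
    forall j : 'I_n, hm t ax j 0%N = (basis_bits lp T j)%:R])))); last first.
  move=> t ft [h1 h2]; split=> //; exact: env_frame ft isT isT es.
apply: hoare_seq.
  exact: (hoare_directions V SZ bE be bc Z_large es hf x01).
move=> t1 f1 [hG hx hC]; have e1 := env_frame f1 isT isT es; case: f1 => t1v t1a t1c.
have hf1 : holds t1 aflag (flag_col f) by move=> i j *; rewrite t1a // hf.
apply: hoare_seq.
  exact: (hoare_ratios V SZ bE bc Z_large e1 hf1 hG hC).
move=> t2 f2 hq; have e2 := env_frame f2 isT isT e1; case: f2 => t2v t2a t2c.
apply: hoare_seq.
  apply: (hoare_select SZ e2 hq _ mV) => i.
  exact: (ratio_bits mA SZ bE bc Z_large f i).
move=> t3 f3 [sel hc3]; have e3 := env_frame f3 isT isT e2; case: f3 => t3v t3a _.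
have c2 : hc t2 = hc s by rewrite t2c // t1c.
rewrite c2 in sel hc3.
have cnt3 : hv t3 vcnt = hv s vcnt by rewrite t3v // t2v // t1v.
have done3 : hv t3 vdone = hv s vdone by rewrite t3v // t2v // t1v.
have log3 : hm t3 alog = hm s alog by rewrite t3a // t2a // t1a.
have hG3 : holds t3 aG (gram_dirs (lpM lp) f) by move=> i j *; rewrite t3a // t2a // hG.
have hx3 (j : 'I_n) : hm t3 ax j 0%N = (basis_bits lp T j)%:R.
  by rewrite t3a // t2a // hx (gram_x01 zo bx j).1.
case: sel => [[bm qle]|[i [bi qi qmax qpref]]].
  apply: hoare_weaken (hoare_update_done S e3 bm _) _; first by case/andP: mV; apply: leq_trans.
  move=> t [tv ta tc] [t_done t_cnt t_hm]; rewrite tc // hc3; split=> //; right.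
  split; last by rewrite t_hm -cnt3.
  move=> T' /(pivot_ratioP zo nd bx) [j [rj _ _]].
  by have := qle j; rewrite leNgt rj.
have cV : (hv t3 vcnt < V)%N by rewrite cnt3.
apply: hoare_weaken (hoare_update_pivot SZ bE Z_large e3 hG3 hx3 bi cV) _.
move=> t [tv ta tc] [t_flag t_log t_cnt t_done]; rewrite tc // hc3; split=> //; left.
have [T' TT' fT'] := pivot_exists zo nd bx qi qmax.
have fE : flag_col (next_flags (lpM lp) (lpe lp) (gram_dirs (lpM lp) f) (basis_bits lp T) i) =
    flag_col (row_flags mA T').
  by apply/colP => k; rewrite !mxE -fT'.
exists T'; split=> //.
- by exists i.
- by rewrite -fE.
- by move=> r k; rewrite t_log fE cnt3 log3.
by rewrite t_cnt t_done cnt3 done3.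
Qed.

End Iteration.

(** [init] puts n in register 0, which the output convention reserves for the number of pivots; so n
    is moved before [vcnt] is cleared. *)
Definition setup : hprog :=
  HSeq (HNat vzero 0) (HSeq (HNat vone 1) (HSeq (HInt IAdd vn vcnt vzero)
  (HSeq (HInt IAdd vm vmA 2) (HSeq (HNat vcnt 0) (HSeq (HNat vo 0) (HSeq (HNat vdone 0)
  (HSeq (HRat czero 0) (HRat cone 1)))))))).

(** This is the order of the blocks in [input]. The equations are flagged separately, as [T0] only
    covers inequalities. *)
Definition loads : hprog :=
  HSeq (load aE vzero vmA vn) (HSeq (load ae vzero vmA vone) (HSeq (load aE vmA vm vn)
  (HSeq (load ae vmA vm vone) (HSeq (load ac vzero vone vn) (HSeq (load aflag vmA vm vone)
  (HFor vi vmA (HRat (aflag, vi, vzero) 1))))))).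

(** With bounded loops only, the rounds after the last pivot are idle. The bound in [vbound] will
    exceed [step_bound n], so the loop cannot end too early. *)
Definition pivots : hprog := HFor vt vbound (HIfLt vdone vone iteration HSkip).

Definition report : hprog :=
  HSeq (HNat vo 0) (HSeq (store alog vcnt vmA vm) (store ax vn vzero vone)).

Definition simplex : hprog := HSeq setup (HSeq loads (HSeq pivots report)).

Lemma simplex_wf : hwf simplex. Proof. by vm_compute. Qed.

(** * The encoding of the input and of the output *)

Lemma nth_allpairs_rect (T1 T2 U : Type) (h : T1 -> T2 -> U) (s : seq T1) (t : seq T2)
    x0 y0 z0 i j : (i < size s)%N -> (j < size t)%N ->
  nth z0 [seq h x y | x <- s, y <- t] (i * size t + j)%N = h (nth x0 s i) (nth y0 t j).
Proof.
elim: s i => // x s IH i iS jt.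
have -> : [seq h a b | a <- x :: s, b <- t] = map (h x) t ++ [seq h a b | a <- s, b <- t] by [].
rewrite nth_cat size_map; case: i iS => [|i] /= iS.
  by rewrite mul0n add0n jt (nth_map y0).
rewrite mulSn -addnA ltnNge leq_addr /= addKn; exact: IH.
Qed.

Lemma nth_matrix_entries p q (M : 'M[int]_(p, q)) i j : (i < p)%N -> (j < q)%N ->
  nth 0 (matrix_entries M) (i * q + j)%N = mxf M i j.
Proof.
move=> ip jq; have e := nth_allpairs_rect (fun i j => (M i j)%:~R : rat)
  (Ordinal ip) (Ordinal jq) 0.
have := e (enum 'I_p) (enum 'I_q) i j; rewrite !size_enum_ord => /(_ ip jq) => h.
rewrite /matrix_entries h; have := mxfE M (Ordinal ip) (Ordinal jq) => /= ->.
by rewrite (nth_ord_enum _ (Ordinal ip)) (nth_ord_enum _ (Ordinal jq)).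
Qed.

Lemma size_matrix_entries p q (M : 'M[int]_(p, q)) : size (matrix_entries M) = (p * q)%N.
Proof. by rewrite size_allpairs !size_enum_ord. Qed.

Lemma size_set_code mB (T : {set 'I_mB}) : size (set_code T) = mB.
Proof. by rewrite size_map size_enum_ord. Qed.

Lemma nth_set_code mB (T : {set 'I_mB}) (i : 'I_mB) : nth 0 (set_code T) i = (i \in T)%:R.
Proof. by rewrite (nth_map i) ?size_enum_ord // nth_ord_enum. Qed.

Lemma nth_flatten_rect (U : Type) (z0 : U) (ss : seq (seq U)) d i j :
  all (fun s => size s == d) ss -> (i < size ss)%N -> (j < d)%N ->
  nth z0 (flatten ss) (i * d + j)%N = nth z0 (nth [::] ss i) j.
Proof.
elim: ss i => // s ss IH [|i] /= /andP[/eqP sd all_d] iS jd; rewrite nth_cat sd.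
  by rewrite mul0n add0n jd.
by rewrite mulSn -addnA ltnNge leq_addr /= addKn IH.
Qed.

Lemma size_flatten_rect (U : Type) (ss : seq (seq U)) d :
  all (fun s => size s == d) ss -> size (flatten ss) = (size ss * d)%N.
Proof. by elim: ss => //= s ss IH /andP[/eqP sd /IH e]; rewrite size_cat sd e mulSn. Qed.

Lemma mxf_col_mxu p1 p2 q (A : 'M[int]_(p1, q)) (B : 'M[int]_(p2, q)) i j :
  (i < p1)%N -> (j < q)%N -> mxf (col_mx A B) i j = mxf A i j.
Proof.
move=> ip jq; have := mxfE (col_mx A B) (lshift p2 (Ordinal ip)) (Ordinal jq) => /= ->.
by rewrite col_mxEu; have := mxfE A (Ordinal ip) (Ordinal jq).
Qed.

Lemma mxf_col_mxd p1 p2 q (A : 'M[int]_(p1, q)) (B : 'M[int]_(p2, q)) i j :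
  (p1 <= i)%N -> (i < p1 + p2)%N -> (j < q)%N -> mxf (col_mx A B) i j = mxf B (i - p1) j.
Proof.
move=> pi ip jq; have ip2 : (i - p1 < p2)%N by lia.
have := mxfE (col_mx A B) (rshift p1 (Ordinal ip2)) (Ordinal jq) => /=; rewrite subnKC // => ->.
by rewrite col_mxEd; have := mxfE B (Ordinal ip2) (Ordinal jq).
Qed.

Lemma mxf_flag p (g : 'I_p -> bool) (i : 'I_p) : mxf (flag_col g) i 0 = (g i)%:R.
Proof. by have := mxfE (flag_col g) i ord0 => /= ->; rewrite mxE; case: (g i). Qed.

Section RawInput.
Variables (mA mB n : nat) (lp : LP mA mB n) (T0 : {set 'I_mB}).
Let m := (mA + mB)%N.
Let raw k := nth 0 (input lp T0) k.
Let oA := 0%N.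
Let ob := (mA * n)%N.
Let oB := (ob + mA)%N.
Let od := (oB + mB * n)%N.
Let oc := (od + mB)%N.
Let oT := (oc + n)%N.

Lemma raw_lpM i j : (i < m)%N -> (j < n)%N ->
  mxf (lpM lp) i j = if (i < mA)%N then raw (oA + i * n + j) else raw (oB + (i - mA) * n + j).
Proof.
move=> im jn; rewrite /raw /input; case: ltnP => iA.
  rewrite mxf_col_mxu // nth_cat size_matrix_entries ifT ?nth_matrix_entries //.
  have : (i.+1 * n <= mA * n)%N by rewrite leq_mul2r iA orbT.
  by rewrite mulSn; lia.
rewrite mxf_col_mxd //.
have -> : (oB + (i - mA) * n + j = mA * n + (mA * 1 + ((i - mA) * n + j)))%N.
  by rewrite /oB /ob muln1 !addnA.
rewrite !nth_cat !size_matrix_entries ltnNge leq_addr /= addKn ltnNge leq_addr /= addKn.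
have iB : (i - mA < mB)%N by move: im; rewrite /m; lia.
rewrite ifT ?nth_matrix_entries //.
have : ((i - mA).+1 * n <= mB * n)%N by rewrite leq_mul2r iB orbT.
by rewrite mulSn; lia.
Qed.

Lemma raw_lpe i : (i < m)%N ->
  mxf (lpe lp) i 0 = if (i < mA)%N then raw (ob + i) else raw (od + (i - mA)).
Proof.
move=> im; rewrite /raw /input; case: ltnP => iA.
  rewrite mxf_col_mxu // nth_cat size_matrix_entries ltnNge leq_addr /= addKn.
  rewrite nth_cat size_matrix_entries muln1 iA.
  by have := nth_matrix_entries (lpb lp) iA (isT : (0 < 1)%N); rewrite muln1 addn0.
rewrite mxf_col_mxd //.
have -> : (od + (i - mA) = mA * n + (mA * 1 + (mB * n + (i - mA))))%N.
  by rewrite /od /oB /ob muln1 !addnA.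
have iB : (i - mA < mB)%N by move: im; rewrite /m; lia.
do 3 rewrite nth_cat size_matrix_entries ltnNge leq_addr /= addKn.
rewrite nth_cat size_matrix_entries muln1 iB.
by have := nth_matrix_entries (lpd lp) iB (isT : (0 < 1)%N); rewrite muln1 addn0.
Qed.

Lemma raw_lprow j : (j < n)%N -> mxf (lprow lp) 0 j = raw (oc + j).
Proof.
move=> jn; rewrite /raw /input.
have -> : (oc + j = mA * n + (mA * 1 + (mB * n + (mB * 1 + j))))%N.
  by rewrite /oc /od /oB /ob !muln1 !addnA.
do 4 rewrite nth_cat size_matrix_entries ltnNge leq_addr /= addKn.
rewrite nth_cat size_matrix_entries muln1 jn.
have := nth_matrix_entries (lpc lp) jn (isT : (0 < 1)%N); rewrite muln1 addn0 => ->.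
have := mxfE (lprow lp) ord0 (Ordinal jn) => /= ->.
by have := mxfE (lpc lp) (Ordinal jn) ord0 => /= ->; rewrite mxE.
Qed.

Lemma raw_flags i : (mA <= i < m)%N ->
  mxf (flag_col (row_flags mA T0)) i 0 = raw (oT + (i - mA)).
Proof.
move=> /andP[iA im]; rewrite /raw /input.
have -> : (oT + (i - mA) = mA * n + (mA * 1 + (mB * n + (mB * 1 + (n * 1 + (i - mA))))))%N.
  by rewrite /oT /oc /od /oB /ob !muln1 !addnA.
do 5 rewrite nth_cat size_matrix_entries ltnNge leq_addr /= addKn.
have iB : (i - mA < mB)%N by move: im; rewrite /m; lia.
have := nth_set_code T0 (Ordinal iB) => /= ->.
have := mxf_flag (row_flags mA T0) (rshift mA (Ordinal iB)) => /=; rewrite subnKC // => ->.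
by rewrite row_flagsr.
Qed.

End RawInput.

(** * Correctness of the whole program *)

Section Main.
Variables (R : realFieldType) (mA mB n : nat) (lp : LP mA mB n).
Hypotheses (zo : zero_one_polytope R lp) (nd : nondegenerate_polytope R lp).
Variables S V Zb X : nat.
Hypothesis SZ : (nat_bits Zb + nat_bits Zb <= S)%N.
Let m := (mA + mB)%N.
Hypotheses (bE : bounded_by X (lpM lp)) (be : bounded_by X (lpe lp)) (bc : bounded_by X (lprow lp)).
Hypothesis Z_large :
  (4 * (n.+1 ^ 3 * m.+1 * X.+1 ^ 3 * fl_rate n (m * (X * X)) ^ n.+1) <= Zb)%N.
Hypothesis mB_gt0 : (0 < mB)%N.
Variables (T0 : {set 'I_mB}) (x0 : 'cV[R]_n).
Hypothesis bx0 : basic_feasible lp T0 x0.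
Hypothesis V_input : (mA * n + (mA + (mB * n + (mB + (n + mB)))) <= V)%N.
Hypothesis V_output : ((step_bound n).+1 * mB.+1 + n <= V)%N.
Hypothesis input_bits_le : forall k, (rat_bits (nth 0%R (input lp T0) k) <= S)%N.

Let lp_env := env mA (lpM lp) (lpe lp) (lprow lp).

Lemma bits01 (b : bool) : (rat_bits b%:R <= S)%N.
Proof.
apply: leq_trans SZ; have Z0 : (0 < nat_bits Zb)%N by [].
have -> : rat_bits b%:R = 2%N by case: b.
by rewrite -[2%N]/(1 + 1)%N leq_add.
Qed.

Lemma hoare_setup s : hv s 0 = n -> hv s 1 = mA -> hv s 2 = mB ->
  hoare S V setup s (fun t => [/\ io_env t, hm t 3 0%N 0%N = 1, hm t 0 = hm s 0, hc t = hc s &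
    [/\ hv t vn = n, hv t vm = m, hv t vmA = mA, hv t vbound = hv s vbound &
        [/\ hv t vcnt = 0%N, hv t vo = 0%N & hv t vdone = 0%N]]]).
Proof.
move=> sn sA sB.
have V1 : (1 <= V)%N by move: V_input mB_gt0; lia.
have V2 : (n <= V)%N by move: V_input; lia.
have V3 : (m <= V)%N by move: V_input; rewrite /m; lia.
split=> [|_] /=; rewrite /upd /= sn sA sB ?addn0; last by split.
do ![split=> //]; exact: (bits01 false) || exact: (bits01 true).
Qed.

Let raw k := nth 0 (input lp T0) k.
Let oA := 0%N.
Let ob := (mA * n)%N.
Let oB := (ob + mA)%N.
Let od := (oB + mB * n)%N.
Let oc := (od + mB)%N.
Let oT := (oc + n)%N.

Lemma io_env_frame p s t : frame p s t -> vzero \notin modv p -> vone \notin modv p ->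
  2 \notin moda p -> io_env s -> io_env t.
Proof. by move=> [fv fa _] h1 h2 h3 [g1 g2 g3]; split; rewrite ?fv ?fa. Qed.

Lemma hoare_loads s : io_env s -> hm s 3 0%N 0%N = 1 -> (forall k, hm s 0%N 0%N k = raw k) ->
  hv s vn = n -> hv s vm = m -> hv s vmA = mA -> hv s vo = 0%N ->
  hoare S V loads s (fun t => lp_env t /\ holds t aflag (flag_col (row_flags mA T0))).
Proof.
move=> io s3 sraw sn sm sA so; have [s0 s1 _] := io.
have sB : (m - mA = mB)%N by rewrite /m addKn.
apply: hoare_seq.
  apply: (hoare_load (S := S) (V := V) (Z := aE) (lo := vzero) (hi := vmA) (w := vn)
    isT isT io s0 sA sn so); last by move=> k; rewrite sraw.
  by move: V_input; rewrite subn0; lia.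
move=> t1 f1 []; rewrite subn0 add0n => t1o t1E.
have io1 := io_env_frame f1 isT isT isT io; have [t10 t11 _] := io1; case: f1 => t1v t1a _.
have t1n : hv t1 vn = n by rewrite t1v.
have t1m : hv t1 vm = m by rewrite t1v.
have t1A : hv t1 vmA = mA by rewrite t1v.
have raw1 k : hm t1 0%N 0%N k = raw k by rewrite t1a.
have t13 : hm t1 3 0%N 0%N = 1 by rewrite t1a.
apply: hoare_seq.
  apply: (hoare_load (S := S) (V := V) (Z := ae) (lo := vzero) (hi := vmA) (w := vone)
    isT isT io1 t10 t1A t11 t1o); last by move=> k; rewrite raw1.
  by move: V_input; rewrite subn0; lia.
move=> t2 f2 []; rewrite subn0 muln1 => t2o t2e.
have io2 := io_env_frame f2 isT isT isT io1; have [t20 t21 _] := io2; case: f2 => t2v t2a _.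
have t2n : hv t2 vn = n by rewrite t2v.
have t2m : hv t2 vm = m by rewrite t2v.
have t2A : hv t2 vmA = mA by rewrite t2v.
have raw2 k : hm t2 0%N 0%N k = raw k by rewrite t2a.
have t23 : hm t2 3 0%N 0%N = 1 by rewrite t2a.
apply: hoare_seq.
  apply: (hoare_load (S := S) (V := V) (Z := aE) (lo := vmA) (hi := vm) (w := vn)
    isT isT io2 t2A t2m t2n t2o); last by move=> k; rewrite raw2.
  by move: V_input; rewrite sB; lia.
move=> t3 f3 []; rewrite sB => t3o t3E.
have io3 := io_env_frame f3 isT isT isT io2; have [t30 t31 _] := io3; case: f3 => t3v t3a _.
have t3n : hv t3 vn = n by rewrite t3v.
have t3m : hv t3 vm = m by rewrite t3v.
have t3A : hv t3 vmA = mA by rewrite t3v.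
have raw3 k : hm t3 0%N 0%N k = raw k by rewrite t3a.
have t33 : hm t3 3 0%N 0%N = 1 by rewrite t3a.
apply: hoare_seq.
  apply: (hoare_load (S := S) (V := V) (Z := ae) (lo := vmA) (hi := vm) (w := vone)
    isT isT io3 t3A t3m t31 t3o); last by move=> k; rewrite raw3.
  by move: V_input; rewrite sB; lia.
move=> t4 f4 []; rewrite sB muln1 => t4o t4e.
have io4 := io_env_frame f4 isT isT isT io3; have [t40 t41 _] := io4; case: f4 => t4v t4a _.
have t4n : hv t4 vn = n by rewrite t4v.
have t4m : hv t4 vm = m by rewrite t4v.
have t4A : hv t4 vmA = mA by rewrite t4v.
have raw4 k : hm t4 0%N 0%N k = raw k by rewrite t4a.
have t43 : hm t4 3 0%N 0%N = 1 by rewrite t4a.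
apply: hoare_seq.
  apply: (hoare_load (S := S) (V := V) (Z := ac) (lo := vzero) (hi := vone) (w := vn)
    isT isT io4 t40 t41 t4n t4o); last by move=> k; rewrite raw4.
  by move: V_input; rewrite subn0; lia.
move=> t5 f5 []; rewrite subn0 mul1n => t5o t5c.
have io5 := io_env_frame f5 isT isT isT io4; have [t50 t51 _] := io5; case: f5 => t5v t5a _.
have t5n : hv t5 vn = n by rewrite t5v.
have t5m : hv t5 vm = m by rewrite t5v.
have t5A : hv t5 vmA = mA by rewrite t5v.
have raw5 k : hm t5 0%N 0%N k = raw k by rewrite t5a.
have t53 : hm t5 3 0%N 0%N = 1 by rewrite t5a.
apply: hoare_seq.
  apply: (hoare_load (S := S) (V := V) (Z := aflag) (lo := vmA) (hi := vm) (w := vone)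
    isT isT io5 t5A t5m t51 t5o); last by move=> k; rewrite raw5.
  by move: V_input; rewrite sB; lia.
move=> t6 f6 []; rewrite sB muln1 => t6o t6f.
have io6 := io_env_frame f6 isT isT isT io5; have [t60 t61 t6z] := io6; case: f6 => t6v t6a _.
apply: (@hoare_weaken _ _ _ _ (fun t => forall i j, hm t aflag i j =
  if has (fun k => (i == k) && (j == 0%N)) (iota 0 (hv t6 vmA)) then 1 else hm t6 aflag i j)).
  apply: (@hoare_fill _ _ _ _ _ _ _ (fun k i j => (i == k) && (j == 0%N)) (fun _ _ => 1)).
  move=> k t _ ti [tv _ _]; apply: hoare_rat; first exact: (bits01 true).
  by move=> i j; rewrite /= ti tv // t60.
move=> t [tv ta _] tf.
have t6A : hv t6 vmA = mA by rewrite t6v.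
have tE : hm t aE = hm t3 aE by rewrite ta // t6a // t5a // t4a.
have te : hm t ae = hm t4 ae by rewrite ta // t6a // t5a.
have tc : hm t ac = hm t5 ac by rewrite ta // t6a.
split; last first.
  move=> i j im; rewrite ltnS leqn0 => /eqP ->.
  rewrite tf has_iota_row t6A /=; case: ltnP => iA /=.
    have := mxf_flag (row_flags mA T0) (lshift mB (Ordinal iA)) => /= ->.
    by rewrite row_flagsl.
  by rewrite t6f iA im /= raw5 (raw_flags lp) ?iA // muln1 addn0 /oT /oc /od /oB /ob.
split.
  by split; rewrite ?tv // t6v.
split.
- by rewrite ta // t6z.
- by rewrite ta // t6a.
- move=> i j im jn; rewrite tE t3E im jn (raw_lpM lp T0) // andbT raw2; case: ltnP => iA.
    by rewrite t2a // t1E iA jn /= sraw subn0 /oA !add0n.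
  by [].
- move=> i j im; rewrite ltnS leqn0 => /eqP ->.
  rewrite te t4e im (raw_lpe lp T0) // andbT raw3; case: ltnP => iA /=.
    by rewrite t3a // t2e iA /= raw1 subn0 muln1 addn0.
  by rewrite muln1 addn0.
- move=> i j; rewrite ltnS leqn0 => /eqP -> jn.
  by rewrite tc t5c jn /= raw4 (raw_lprow lp T0) // mul0n addn0.
Qed.

Definition pivots_post (o : nat -> nat) t :=
  exists p, [/\ follows lp o T0 p, complete_run R lp T0 p, hv t vcnt = size p,
    forall r i, (r < size p)%N -> (i < m)%N ->
      hm t alog r i = mxf (flag_col (row_flags mA (nth T0 p r))) i 0%N &
    forall j : 'I_n, hm t ax j 0%N = (basis_bits lp (last T0 p) j)%:R].

Lemma hoare_pivots s : lp_env s -> holds s aflag (flag_col (row_flags mA T0)) ->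
  hv s vcnt = 0%N -> hv s vdone = 0%N -> hv s vbound = V ->
  hoare S V pivots s (pivots_post (hc s)).
Proof.
move=> es hf scnt sdone sV.
have stepV : (step_bound n < V)%N.
  by apply: leq_trans V_output; rewrite mulnS; lia.
have mV : (0 < m <= V)%N by move: V_input mB_gt0; rewrite /m; lia.
(* Either the run is still going, with one pivot per round and the choices shifted accordingly, or
   it is complete and the later rounds change nothing. *)
pose I (k : nat) t := lp_env t /\ exists p x, [/\ chain (steepest_descent_pivot R lp) T0 p,
  basic_feasible (R := R) lp (last T0 p) x, follows lp (hc s) T0 p, hv t vcnt = size p /\
    (forall r i, (r < size p)%N -> (i < m)%N ->
      hm t alog r i = mxf (flag_col (row_flags mA (nth T0 p r))) i 0%N) &
    [/\ hv t vdone = 0%N, size p = k, holds t aflag (flag_col (row_flags mA (last T0 p))) &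
      forall q, hc t q = hc s (size p + q)%N] \/
    [/\ hv t vdone = 1%N, forall T', ~ steepest_descent_pivot R lp (last T0 p) T' &
      forall j : 'I_n, hm t ax j 0%N = (basis_bits lp (last T0 p) j)%:R]].
apply: (@hoare_weaken _ _ _ _ (I (hv s vbound))); last first.
  (* A run still going after [V] rounds would contradict the length bound. *)
  rewrite sV => t _ [_ [p [x [cp bx fp [pc pl] [[_ pk _ _]|[td np tx]]]]]].
    by have := pivot_chain_length zo nd bx0 cp; rewrite pk leqNgt stepV.
  by exists p.
apply: hoare_for.
  split.
    have [[h1 h2 h3 h4 h5] h] := es; by split.
  by exists [::], x0; split=> //; left; split.
move=> k t _ tk [_ _ _] [et [p [x [cp bx fp [pc pl] st]]]].
have env_setv t' : lp_env t' -> lp_env (hsetv t' vt k.+1) by move=> [[h1 h2 h3 h4 h5] h]; split.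
have [_ _ _ t0 t1] := et.1.
apply: hoare_iflt; rewrite t1 => td; last first.
  apply: hoare_skip; split; first exact: env_setv.
  case: st => [[td' _ _ _]|st]; first by rewrite td' in td.
  by exists p, x; split=> //; right.
case: st => [[td' sk tf tc]|[td' _ _]]; last by rewrite td' in td.
have pV : (hv t vcnt < V)%N.
  by rewrite pc; apply: leq_ltn_trans (pivot_chain_length zo nd bx0 cp) stepV.
apply: hoare_weaken (hoare_iteration zo nd SZ bE be bc Z_large mV bx et tf pV) _.
move=> t' _ [et' tc' [[T' [TT' pT' tf' tl' [tcnt' td1]]]|[np [td1 tcnt' tl' tx']]]].
  split; first exact: env_setv.
  have [y by' _] := pivot_descent zo nd bx TT'.
  exists (rcons p T'), y; rewrite last_rcons size_rcons; split=> //.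
  - exact: chain_rcons.
  - by apply: follows_rcons => //; rewrite -[size p]addn0 -tc.
  - split; first by rewrite /= /upd /= tcnt' pc.
    move=> r i; rewrite ltnS leq_eqVlt nth_rcons => /orP[/eqP ->|rp] im /=.
      by rewrite tl' pc eqxx im ltnn.
    by rewrite tl' pc (ltn_eqF rp) /= rp pl.
  left; split=> //=; first by rewrite /upd /= td1 td'.
    by rewrite sk.
  by move=> q; rewrite tc' tc addSnnS.
split; first exact: env_setv.
exists p, x; split=> //.
  split; first by rewrite /= /upd /= tcnt' pc.
  by move=> r i rp im /=; rewrite tl' pl.
by right; split.
Qed.

Definition output_list (p : seq {set 'I_mB}) : seq rat :=
  flatten [seq set_code T | T <- p] ++ [seq (basis_bits lp (last T0 p) j)%:R | j <- enum 'I_n].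

Definition simplex_post (o : nat -> nat) t :=
  exists p, [/\ follows lp o T0 p, complete_run R lp T0 p, hv t vcnt = size p &
    forall k, (k < size (output_list p))%N -> hm t 0%N 0%N k = nth 0 (output_list p) k].

Lemma hoare_report s o : lp_env s -> pivots_post o s ->
  hoare S V report s (simplex_post o).
Proof.
move=> [[sA sn sm s0 s1] [sz _ _ _ _]] [p [fp cp sc sl sx]].
have pV : (size p <= step_bound n)%N by have [cp' _] := cp; exact: (pivot_chain_length zo nd bx0 cp').
have pB : (size p * mB + n <= V)%N.
  apply: leq_trans V_output; rewrite leq_add2r; apply: leq_mul => //; exact: leqW.
have mE : (m - mA = mB)%N by rewrite /m addKn.
apply: hoare_seq (fun t => hv t vo = 0%N) _ _ _; first exact: hoare_nat.
move=> t1 [t1v t1a _] t1o.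
have io1 : io_env t1 by split; rewrite ?t1v ?t1a.
have t1A : hv t1 vmA = mA by rewrite t1v.
have t1m : hv t1 vm = m by rewrite t1v.
have t1c : hv t1 vcnt = size p by rewrite t1v.
apply: hoare_seq.
  apply: (hoare_store (S := S) (V := V) (Z := alog) (rows := vcnt) (lo := vmA) (hi := vm) isT isT io1 t1c t1A t1m t1o).
    by rewrite mE add0n; apply: leq_trans pB; apply: leq_addr.
  move=> i j ip /andP[jA jm]; rewrite t1a // sl //.
  by have := mxf_flag (row_flags mA (nth T0 p i)) (Ordinal jm) => /= ->; apply: bits01.
move=> t2 f2 [t2o _ t2l]; have io2 := io_env_frame f2 isT isT isT io1.
have [t20 t21 _] := io2; case: f2 => t2v t2a _.
have t2n : hv t2 vn = n by rewrite t2v // t1v.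
rewrite mE add0n in t2o t2l.
apply: hoare_weaken.
  apply: (hoare_store (S := S) (V := V) (Z := ax) (rows := vn) (lo := vzero) (hi := vone) isT isT io2 t2n t20 t21 t2o).
    by rewrite subn0 muln1.
  move=> i j i_n; rewrite leq0n ltnS leqn0 /= => /eqP ->; rewrite t2a // t1a //.
  by have := sx (Ordinal i_n) => /= ->; apply: bits01.
move=> t [tv ta _] [_ tk tx]; exists p; split=> //; first by rewrite tv // t2v // t1v.
have all_d : all (fun s => size s == mB) [seq set_code T | T <- p].
  by apply/allP => _ /mapP[T _ ->]; rewrite size_set_code.
have sz1 : size (flatten [seq set_code T | T <- p]) = (size p * mB)%N.
  by rewrite (size_flatten_rect all_d) size_map.
have sz2 : size [seq (basis_bits lp (last T0 p) j)%:R : rat | j <- enum 'I_n] = n.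
  by rewrite size_map size_enum_ord.
move=> k; rewrite /output_list size_cat nth_cat sz1 sz2.
move=> ks; case: ltnP => kp.
  (* The flattened log is a table with rows of length mB, so quotient and remainder give row and
     column. *)
  rewrite tk // (divn_eq k mB); set r := (k %/ mB)%N; set c := (k %% mB)%N.
  have rp : (r < size p)%N by rewrite ltn_divLR.
  have cB : (c < mB)%N by rewrite ltn_mod.
  rewrite (nth_flatten_rect 0 all_d) ?size_map // (nth_map T0) //.
  have := t2l r (mA + c)%N rp; rewrite leq_addr ltn_add2l addKn => -> //.
  rewrite t1a // sl //; last by rewrite /m ltn_add2l.
  have := mxf_flag (row_flags mA (nth T0 p r)) (rshift mA (Ordinal cB)) => /= ->.
  by rewrite row_flagsr; have := nth_set_code (nth T0 p r) (Ordinal cB).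
have kn : (k - size p * mB < n)%N by lia.
rewrite (nth_map (Ordinal kn)) ?size_enum_ord // (nth_ord_enum _ (Ordinal kn)).
have := tx (k - size p * mB)%N 0%N kn isT; rewrite subn0 muln1 addn0 subnKC // => ->.
by rewrite t2a // t1a //; apply: (sx (Ordinal kn)).
Qed.

Lemma hoare_simplex s : hv s 0 = n -> hv s 1 = mA -> hv s 2 = mB -> hv s vbound = V ->
  (forall k, hm s 0%N 0%N k = raw k) -> hoare S V simplex s (simplex_post (hc s)).
Proof.
move=> sn sA sB sV sraw; apply: hoare_seq; first exact: hoare_setup.
move=> t1 _ [io1 t13 t1raw t1c [t1n t1m t1A t1V [t1cnt t1o t1d]]].
apply: hoare_seq.
  by apply: hoare_loads => // k; rewrite t1raw.
move=> t2 [t2v t2a t2c] [e2 hf2].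
apply: hoare_seq.
  by apply: hoare_pivots => //; rewrite t2v // t1V.
move=> t3 f3; rewrite t2c // t1c => h3.
exact: hoare_report (env_frame f3 isT isT e2) h3.
Qed.

End Main.

(** * Time and space bounds *)

(* With w = n + mA + mB in ireg 4, leaves the bound V = 20 w^4 on all indices in
   ireg 5 and the row length V + 1 of the arrays in rW. *)
Definition prologue : seq instr :=
  [:: IOp IAdd 4 0 1; IOp IAdd 4 4 2; IOp IMul 5 4 4; IOp IMul 5 5 5; IConst 6 20;
      IOp IMul 5 5 6; IConst 6 1; IOp IAdd rW 5 6; IConst rK num_arrays].

Definition simplex_program : program := Seq (code prologue) (compile simplex).

(** The prologue runs before [rW] and [rK] are set, hence outside the reach of [sim]; its
    instructions are checked directly. *)
Fixpoint index_code_fits (S : nat) (l : seq instr) (s : state) : Prop :=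
  if l is a :: l' then
    match a with
    | IConst _ x => (nat_bits x <= S)%N
    | IOp o _ j k => (nat_bits (iop_fun o (ireg s j) (ireg s k)) <= S)%N
    | _ => False
    end /\ index_code_fits S l' (step a s)
  else True.

Lemma exec_index_code S l s : fits S s -> index_code_fits S l s ->
  exec S (code l) s (size l) (foldl (fun s a => step a s) s l) /\
  fits S (foldl (fun s a => step a s) s l).
Proof.
elim: l s => [|a l IH] s fs /=; first by split=> //; apply: exec_skip.
move=> [ha hl]; have fa : fits S (step a s).
  by case: a ha hl => //= [i x|o i j k] h _; apply: fits_ireg.
by have [e f] := IH _ fa hl; split=> //; apply: exec_code.
Qed.

Lemma rat_bits_ge2 q : (2 <= rat_bits q)%N.
Proof. by rewrite /rat_bits /nat_bits addnS addSn. Qed.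

Lemma absz_lt_bits (z : int) L : (rat_bits z%:~R <= L)%N -> (`|z| < 2 ^ L)%N.
Proof.
rewrite /rat_bits numq_int denq_int /nat_bits => h.
apply: leq_trans (trunc_log_ltn `|z| (isT : 1 < 2)%N) _.
by rewrite leq_pexp2l //; apply: leq_trans h; apply: leq_addr.
Qed.

Section IndexBounds.
Variables mA mB n : nat.
Hypothesis mB_gt0 : (0 < mB)%N.
Let w := (n + mA + mB)%N.
Let V := (20 * w ^ 4)%N.

Lemma w_gt0 : (0 < w)%N. Proof. by rewrite /w; lia. Qed.

(** The exponent 4 is dictated by the log of the run, with O(n^3) bases of mB flags each; it takes
    at most 18 w^4 cells, besides the n of the solution. *)
Lemma index_bounds :
  [/\ (mA * n + (mA + (mB * n + (mB + (n + mB)))) <= V)%N,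
      ((step_bound n).+1 * mB.+1 + n <= V)%N & (V.+1 <= 21 * w ^ 4)%N].
Proof.
have w0 := w_gt0.
have w2 : (0 < w * w)%N by rewrite muln_gt0 w0.
have e4 : (w ^ 4 = (w * w) * (w * w))%N by rewrite !expnS expn0; lia.
have w24 : (w * w <= w ^ 4)%N by rewrite e4 leq_pmulr.
split.
- rewrite /V; apply: leq_trans (_ : 20 * (w * w) <= _)%N; last by rewrite leq_mul2l.
  by rewrite /w; nia.
- have wle : (n <= w)%N by rewrite /w; lia.
  have mle : (mB <= w)%N by rewrite /w; lia.
  have sb : (step_bound n <= 8 * (w * w * w))%N.
    have -> : (step_bound n = 8 * (n * n * n))%N by rewrite /step_bound -mulnn; lia.
    by rewrite leq_mul2l !leq_mul.
  have w3 : (0 < w * w * w)%N by rewrite !muln_gt0 w0.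
  have h1 : ((step_bound n).+1 <= 9 * (w * w * w))%N by lia.
  have h2 : (mB.+1 <= 2 * w)%N by lia.
  have h3 : ((step_bound n).+1 * mB.+1 <= 9 * (w * w * w) * (2 * w))%N by rewrite leq_mul.
  have h4 : (9 * (w * w * w) * (2 * w) = 18 * w ^ 4)%N by rewrite e4; lia.
  have h5 : (w <= w * w)%N by rewrite leq_pmulr.
  by rewrite /V; lia.
by rewrite /V; have : (0 < w ^ 4)%N; [rewrite expn_gt0 w0 | lia].
Qed.

End IndexBounds.

Section Bounds.
Variables (mA mB n : nat) (lp : LP mA mB n) (T0 : {set 'I_mB}).
Hypothesis mB_gt0 : (0 < mB)%N.
Let L := input_bits lp T0.

Lemma size_input : size (input lp T0) =
  (mA * n + (mA + (mB * n + (mB + (n + mB)))))%N.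
Proof. by rewrite !size_cat !size_matrix_entries size_set_code !muln1. Qed.

Lemma input_bits_ge : (2 * size (input lp T0) <= L)%N.
Proof.
rewrite /L /input_bits -sum1_size big_distrr /=; apply: leq_sum => q _.
exact: rat_bits_ge2.
Qed.

Lemma input_entry_bits k : (rat_bits (nth 0%R (input lp T0) k) <= L)%N.
Proof.
have [ks|ks] := ltnP k (size (input lp T0)).
  rewrite /L /input_bits (big_rem (nth 0%R (input lp T0) k)) ?mem_nth //=.
  exact: leq_addr.
rewrite nth_default //; apply: leq_trans input_bits_ge.
have -> : rat_bits 0 = 2%N by [].
by rewrite size_input; lia.
Qed.

(** Every entry, even 0, takes at least two bits, so the dimensions are below [L] and the space
    bound can be stated in terms of [L] alone. *)
Lemma dims_lt_bits : (n + mA + mB < L)%N /\ (4 <= L)%N.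
Proof. by have := input_bits_ge; rewrite size_input; lia. Qed.

Lemma lpM_bound : bounded_by (2 ^ L) (lpM lp).
Proof.
move=> i j; apply/ltnW/absz_lt_bits; rewrite -mxfE (raw_lpM lp T0) //.
by case: ifP => _; apply: input_entry_bits.
Qed.

Lemma lpe_bound : bounded_by (2 ^ L) (lpe lp).
Proof.
move=> i j; rewrite ord1; apply/ltnW/absz_lt_bits; rewrite -(mxfE (lpe lp) i 0).
by rewrite (raw_lpe lp T0) //; case: ifP => _; apply: input_entry_bits.
Qed.

Lemma lprow_bound : bounded_by (2 ^ L) (lprow lp).
Proof.
move=> i j; rewrite ord1; apply/ltnW/absz_lt_bits; rewrite -(mxfE (lprow lp) 0 j).
by rewrite (raw_lprow lp T0) //; apply: input_entry_bits.
Qed.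

(** With Y = 2^L, the numbers 4, n+1 and mA+mB+1 are at most Y, Y+1 is at most Y^2, the rate is at
    most Y^6 and n+1 is at most L. The product is thus at most Y^(11 + 6L), and L(11 + 6L) is at
    most 17 L^2. *)
Lemma gram_size_bound :
  (4 * (n.+1 ^ 3 * (mA + mB).+1 * (2 ^ L).+1 ^ 3 *
     fl_rate n ((mA + mB) * (2 ^ L * 2 ^ L)) ^ n.+1) <= 2 ^ (17 * L ^ 2))%N.
Proof.
have [wL L4] := dims_lt_bits; set Y := (2 ^ L)%N.
have LY : (L < Y)%N by apply: ltn_expl.
have Y4 : (4 <= Y)%N by apply: leq_trans L4 (ltnW LY).
have Y0 : (0 < Y)%N by apply: leq_trans Y4.
have nY : (n.+1 <= Y)%N by apply: leq_trans (ltnW LY); lia.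
have mY : ((mA + mB).+1 <= Y)%N by apply: leq_trans (ltnW LY); lia.
have YY : (Y.+1 <= Y ^ 2)%N by rewrite -mulnn; nia.
have rate : (fl_rate n ((mA + mB) * (Y * Y)) <= Y ^ 6)%N.
  rewrite /fl_rate; have h : (n * n * (mA + mB) <= Y * Y * Y)%N by rewrite !leq_mul //; lia.
  have e : (2 * n * n * ((mA + mB) * (Y * Y)) = 2 * (n * n * (mA + mB)) * (Y * Y))%N by lia.
  rewrite e; have : (2 * (n * n * (mA + mB)) * (Y * Y) <= 2 * (Y * Y * Y) * (Y * Y))%N.
    by rewrite leq_mul2r leq_mul2l h !orbT.
  have -> : (Y ^ 6 = Y * (Y * Y * Y * (Y * Y)))%N by rewrite !expnS expn0; lia.
  have : (0 < Y * Y * Y * (Y * Y))%N by rewrite !muln_gt0 Y0.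
  move: (Y * Y * Y * (Y * Y))%N (mulnA 2 (Y * Y * Y) (Y * Y))%N => P <-.
  move: (2 * _ * _)%N => Q; nia.
apply: leq_trans (_ : Y * (Y ^ 3 * Y * (Y ^ 2) ^ 3 * (Y ^ 6) ^ L) <= _)%N.
  have rL : (fl_rate n ((mA + mB) * (Y * Y)) ^ n.+1 <= (Y ^ 6) ^ L)%N.
    apply: leq_trans (_ : (Y ^ 6) ^ n.+1 <= _)%N; first by rewrite leq_exp2r.
    by rewrite leq_pexp2l ?expn_gt0 ?Y0 //; lia.
  by rewrite !leq_mul ?leq_exp2r.
have -> : (Y * (Y ^ 3 * Y * (Y ^ 2) ^ 3 * (Y ^ 6) ^ L) = Y ^ (1 + (3 + 1 + 2 * 3 + 6 * L)))%N.
  rewrite (expnD Y 1) (expnD Y (3 + 1 + 2 * 3)) (expnD Y (3 + 1)) (expnD Y 3).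
  by rewrite [in RHS](expnM Y 2 3) (expnM Y 6 L) !expn1.
rewrite /Y -expnM leq_pexp2l //.
rewrite -mulnn; nia.
Qed.

Let w := (n + mA + mB)%N.
Let V := (20 * w ^ 4)%N.

(** [V] is at most 2^(6L) and the largest address is quadratic in [V], so 14L + 1 bits are
    enough. *)
Lemma addr_bits : (nat_bits (addr V num_arrays V V) <= 36 * L ^ 2)%N.
Proof.
have [wL L4] := dims_lt_bits; set Y := (2 ^ L)%N.
have LY : (L < Y)%N by apply: ltn_expl.
have Y16 : (16 <= Y)%N by rewrite -[16%N]/(2 ^ 4)%N leq_pexp2l.
have wY : (w <= Y)%N by apply: leq_trans (ltnW LY); apply: ltnW.
have V1 : (0 < V)%N by rewrite muln_gt0 expn_gt0 (w_gt0 mA n mB_gt0).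
have VY : (V <= Y ^ 6)%N.
  rewrite /V (_ : 6 = 2 + 4)%N // expnD leq_mul // ?leq_exp2r //.
  by apply: leq_trans (_ : 16 ^ 2 <= _)%N; rewrite ?leq_exp2r.
have aV : (addr V num_arrays V V <= 16 ^ 2 * V ^ 2)%N.
  by rewrite /addr /num_arrays -mulnn; nia.
have aY : (addr V num_arrays V V <= 2 ^ (L * 14))%N.
  apply: leq_trans aV _; rewrite expnM -/Y (_ : 14 = 2 + 6 * 2)%N // expnD expnM.
  by rewrite leq_mul // leq_exp2r.
apply: leq_trans (nat_bits_le aY) _; rewrite /nat_bits trunc_expnK // -mulnn; nia.
Qed.

End Bounds.

Section Program.
Variables (R : realFieldType) (mA mB n : nat) (lp : LP mA mB n).
Hypotheses (zo : zero_one_polytope R lp) (nd : nondegenerate_polytope R lp).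
Hypothesis mB_gt0 : (0 < mB)%N.
Variables (T0 : {set 'I_mB}) (x0 : 'cV[R]_n).
Hypothesis bx0 : basic_feasible lp T0 x0.
Let L := input_bits lp T0.
Let V := (20 * (n + mA + mB) ^ 4)%N.
Variable S : nat.
Hypothesis S_large : (36 * L ^ 2 <= S)%N.

Lemma exec_prologue o : exists s, [/\ exec S (code prologue) (init lp T0 o) 9 s, fits S s,
  [/\ ireg s 0 = n, ireg s 1 = mA, ireg s 2 = mB & ireg s vbound = V],
  [/\ ireg s rW = V.+1, ireg s rK = num_arrays & forall v, (v < num_vars)%N -> (ireg s v <= V)%N] &
  rmem s = nth 0 (input lp T0) /\ choices s = o].
Proof.
have [wL L4] := dims_lt_bits lp T0 mB_gt0.
have w0 := w_gt0 mA n mB_gt0.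
have aS : (nat_bits (addr V num_arrays V V) <= S)%N.
  exact: leq_trans (addr_bits lp T0 mB_gt0) S_large.
have wV : (n + mA + mB <= V)%N.
  rewrite /V; have : (n + mA + mB <= (n + mA + mB) ^ 4)%N by rewrite -{1}(expn1 (n + mA + mB)) leq_pexp2l.
  by move: (_ ^ 4)%N => q; lia.
have sm x : (x <= V.+1 + 40)%N -> (nat_bits x <= S)%N.
  by move=> h; apply: leq_trans aS; apply: nat_bits_le; rewrite /addr /num_arrays; nia.
have Vw : (20 <= V)%N by rewrite /V leq_pmulr // expn_gt0 w0.
have w2V : ((n + mA + mB) * (n + mA + mB) <= V)%N.
  rewrite /V !expnS expn0 muln1; move: (n + mA + mB)%N w0 => w wp.
  by have := leq_pmulr (w * w) (_ : 0 < w * w)%N; rewrite muln_gt0 wp => /(_ isT); lia.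
have f0 : fits S (init lp T0 o).
  split=> [i|k] /=; last first.
    apply: leq_trans (input_entry_bits lp T0 mB_gt0 k) _; apply: leq_trans S_large.
    by rewrite -/L -mulnn; nia.
  by apply: sm; case: i => [|[|[|i]]] /=; rewrite ?nth_nil; lia.
have eV : ((n + mA + mB) * (n + mA + mB) * ((n + mA + mB) * (n + mA + mB)) * 20 = V)%N.
  by rewrite /V !expnS expn0; lia.
have V4 : ((n + mA + mB) * (n + mA + mB) * ((n + mA + mB) * (n + mA + mB)) <= V)%N.
  by rewrite -eV leq_pmulr.
have [|ex fx] := exec_index_code (l := prologue) f0.
  rewrite /= /upd /= eV; do ![split=> //]; apply: sm; have nK : num_arrays = 40%N by []; lia.
exists (foldl (fun s a => step a s) (init lp T0 o) prologue); split=> //.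
split; rewrite /= /upd /= ?eV ?addn1 // => v vn.
case: eqP => [e|_]; first by move: vn; rewrite e.
case: eqP => [e|_]; first by move: vn; rewrite e.
do ![case: ifP => _]; try lia.
by case: v vn => [|[|[|v]]] _ /=; rewrite ?nth_nil; lia.
Qed.

Lemma program_run o : exists p, [/\ follows lp o T0 p, complete_run R lp T0 p &
  computes_run R lp T0 simplex_program (9 + htime V simplex) S o p].
Proof.
have [s [ex fs [sn sA sB sV] [sW sK sle] [sr sc]]] := exec_prologue o.
(* The structured state is read off the machine memory; row 0 of array 0 then begins with the
   input. *)
pose h := HState (ireg s) (fun a i j => rmem s (addr V a i j)) (choices s).
have sh : sim S V h s by split=> // v vn; split=> //; apply: sle.
have aS : (nat_bits (addr V num_arrays V V) <= S)%N.
  exact: leq_trans (addr_bits lp T0 mB_gt0) S_large.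
(* Two numbers of 17 L^2 + 1 bits each: the origin of the factor 36. *)
have SZ : (nat_bits (2 ^ (17 * L ^ 2)) + nat_bits (2 ^ (17 * L ^ 2)) <= S)%N.
  apply: leq_trans S_large; rewrite /nat_bits trunc_expnK //.
  have [_ L4] := dims_lt_bits lp T0 mB_gt0; have : (1 <= L ^ 2)%N by rewrite expn_gt0; move: L4; rewrite -/L; lia.
  lia.
have [V_in V_out _] := index_bounds mA n mB_gt0.
have bits k : (rat_bits (nth 0%R (input lp T0) k) <= S)%N.
  apply: leq_trans (input_entry_bits lp T0 mB_gt0 k) _; apply: leq_trans S_large.
  by rewrite -/L -mulnn; nia.
have := hoare_simplex zo nd SZ (lpM_bound lp T0 mB_gt0) (lpe_bound lp T0 mB_gt0)
  (lprow_bound lp T0 mB_gt0) (gram_size_bound lp T0 mB_gt0) mB_gt0 bx0 V_in V_out bits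
  (s := h) sn sA sB sV.
case=> [k|hok_main hpost]; first by rewrite /h /= sr.
have [u [s' [ex' ut sh']]] := exec_compile aS simplex_wf sh hok_main.
have [p [fp cp pc pout]] := hpost (frame_hsem _ _).
rewrite /h /= sc in fp; exists p; split=> //.
pose y : 'cV[rat]_n := \col_j (basis_bits lp (last T0 p) j)%:R.
have [cp' np] := cp; have [x [bx _]] := pivot_chain zo nd bx0 cp'.
have [by1 by2] : basic_solution lp (last T0 p) y /\ map_mx ratr y = x.
  by apply: (rational_solution zo bx) => j; rewrite mxE.
exists (9 + u)%N, s', y; split=> //.
- exact: exec_seq ex ex'.
- have [sv' _ sm' _ _] := sh'; split; first by have [-> _] := sv' 0%N isT.
  have -> : flatten [seq set_code T | T <- p] ++ [seq y j 0 | j <- enum 'I_n] =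
      output_list lp T0 p.
    by congr (_ ++ _); apply: eq_map => j; rewrite mxE.
  have pV := pivot_chain_length zo nd bx0 cp'.
  have all_d : all (fun s => size s == mB) [seq set_code T | T <- p].
    by apply/allP => _ /mapP[T _ ->]; rewrite size_set_code.
  have outV : (size (output_list lp T0 p) <= V)%N.
    rewrite size_cat (size_flatten_rect all_d) 2!size_map size_enum_ord.
    by apply: leq_trans V_out; rewrite leq_add2r; apply: leq_mul => //; exact: leqW.
  move=> k ks; rewrite -pout //.
  exact: (sm' 0%N 0%N k isT (leq_trans (ltnW ks) outV)).
by rewrite by2; apply: (no_pivot_basis_optimal zo nd bx np).
Qed.

End Program.

Theorem theorem1 (R : realFieldType) :
  (* (i) *)
  (exists C k : nat, forall (mA mB n : nat) (lp : LP mA mB n),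
    standing_assumptions lp -> zero_one_polytope R lp ->
    forall x : 'cV[R]_n, vertex lp x ->
    exists p : seq 'cV[R]_n,
      [/\ chain (steepest_edge_step lp) x p,
          vertex lp (last x p),
          optimal lp (last x p) &
          (size p <= C * (n + mA + mB) ^ k)%N]) /\
  (* (ii) *)
  (exists (C k : nat) (P : program),
    forall (mA mB n : nat) (lp : LP mA mB n),
    standing_assumptions lp -> zero_one_polytope R lp -> nondegenerate_polytope R lp ->
    forall T0 : {set 'I_mB}, feasible_basis R lp T0 ->
    let time := (C * (n + mA + mB) ^ k)%N in
    let space := (C * input_bits lp T0 ^ k)%N in
    [/\ (* every run of the method, however ties are broken, is short, and it
           stops only at an optimal solution *)
        forall p : seq {set 'I_mB},
          chain (steepest_descent_pivot R lp) T0 p ->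
          (size p <= time)%N /\
          (complete_run R lp T0 p ->
           forall x : 'cV[R]_n, basic_solution lp (last T0 p) x -> optimal lp x),
        (* whatever the choices, the program P performs a complete run in
           strongly polynomial time *)
        forall o : nat -> nat, exists p : seq {set 'I_mB},
          complete_run R lp T0 p /\ computes_run R lp T0 P time space o p &
        (* P can perform any complete run, i.e. any way of breaking ties *)
        forall p : seq {set 'I_mB}, complete_run R lp T0 p ->
          exists o : nat -> nat, computes_run R lp T0 P time space o p]).
Proof.
have steps n w : (n <= w)%N -> (step_bound n <= 8 * w ^ 3)%N.
  move=> nw; have -> : (step_bound n = 8 * n ^ 3)%N.
    by rewrite /step_bound !expnS expn0; lia.
  by rewrite leq_mul2l leq_exp2r.
split.
  exists 8%N, 3%N => mA mB n lp _ zo x vx.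
  have [p [cp vp op sp]] := steepest_path zo vx; exists p; split=> //.
  by apply: leq_trans sp _; apply: steps; rewrite -addnA leq_addr.
have [C1 [k1 time1]] := htime_poly simplex.
(* The summands of [C] pay for the prologue, for the time of [simplex] with V + 1 at most 21 w^4,
   and for the space. In [k], the 3 covers the number of pivots and the square in the space
   bound. *)
pose C := (9 + C1 * 21 ^ k1 + 36)%N; pose k := (4 * k1 + 3)%N.
exists C, k, simplex_program => mA mB n lp [mB0 _ _] zo nd T0 [bT0 [x0 bs0 fx0]] time space.
have bx0 : basic_feasible lp T0 x0 by split.
pose w := (n + mA + mB)%N; have w0 : (0 < w)%N := w_gt0 mA n mB0.
have timeE : time = (C * w ^ k)%N by [].
have spaceE : space = (C * input_bits lp T0 ^ k)%N by [].
have S_large : (36 * input_bits lp T0 ^ 2 <= space)%N.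
  have [_ L4] := dims_lt_bits lp T0 mB0.
  rewrite spaceE; apply: leq_mul; first exact: leq_addl.
  by rewrite leq_pexp2l //; [apply: leq_trans L4 | rewrite /k; lia].
have T_large : (9 + htime (20 * w ^ 4) simplex <= time)%N.
  have [_ _ V21] := index_bounds mA n mB0.
  apply: leq_trans (_ : (9 + C1 * 21 ^ k1) * w ^ (4 * k1) <= _)%N; last first.
    rewrite timeE; apply: leq_mul; first exact: leq_addr.
    by rewrite leq_pexp2l // leq_addr.
  rewrite mulnDl; apply: leq_add; first by rewrite leq_pmulr // expn_gt0 w0.
  apply: leq_trans (time1 _) _; rewrite -mulnA leq_mul2l expnM -expnMn; apply/orP; right.
  by have [->|k0] := posnP k1; rewrite ?expn0 // leq_exp2r.
have run o : exists p, [/\ follows lp o T0 p, complete_run R lp T0 p &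
    computes_run R lp T0 simplex_program time space o p].
  have [p [fp cp [u [s [y [ex ut out by1 oy]]]]]] := program_run zo nd mB0 bx0 S_large o.
  exists p; split=> //; exists u, s, y; split=> //; exact: leq_trans ut T_large.
split.
- move=> p cp; split.
    apply: leq_trans (pivot_chain_length zo nd bx0 cp) _.
    apply: leq_trans (steps n w _) _; first by rewrite /w -addnA leq_addr.
    rewrite timeE; apply: leq_mul; first by rewrite /C; lia.
    by rewrite leq_pexp2l // leq_addl.
  move=> [_ np] x bsx; have [y [by' _]] := pivot_chain zo nd bx0 cp.
  have [bT bs _] := by'; rewrite (basic_unique bT bsx bs).
  exact: (no_pivot_basis_optimal zo nd by' np).
- by move=> o; have [p [_ cp rp]] := run o; exists p.
(* The program completes a run following these choices, and [ho] identifies it with the prescribed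
   one. *)
move=> p cp; have [o ho] := run_choices zo nd bx0 cp.
by exists o; have [p' [fp' cp' rp']] := run o; rewrite -(ho p' fp' cp').
Qed.
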